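(* Let $p$ be a prime and let $L/K$ be a ramified Galois extension of $p$-adic fields of degree $p$, with ramification jump $t$. Let $a\in\{0,\ldots,p-1\}$ be the residue class of $t$ modulo $p$ and set $\nu_i=\left\lfloor\frac{a+it}{p}\right\rfloor$ for $i=0,\ldots,p-1$. Then, if $a\neq 0$, $$v_p(m(L/K)) = f_K\left(\sum_{i=0}^{p-1}\nu_i + \min_{0\leq i\leq p-1}\bigl(i e_K-(p-1)\nu_i\bigr)\right),$$ while if $a=0$ we have $v_p(m(L/K))=\frac{1}{2}[L:\mathbb{Q}_p]$.
   Context: A $p$-adic field is a finite extension of $\mathbb{Q}_p$. For a Galois extension $L/K$ of $p$-adic fields with Galois group $G$, the minimal index is $m(L/K):=\min_{\alpha\in\mathcal{O}_L}[\mathcal{O}_L:\mathcal{O}_K[G]\alpha]$, where the index is that of additive groups and $\mathcal{O}_K[G]$ acts naturally on the ring of integers $\mathcal{O}_L$. $e_K$ and $f_K$ are the absolute ramification index and absolute inertia degree of $K$ (over $\mathbb{Q}_p$), and $v_p$ is the $p$-adic valuation on $\mathbb{Q}$. The lower ramification groups are $G_i=\{g\in G:(g-1)(\mathcal{O}_L)\subseteq(\pi_L)^{i+1}\}$ for $i\ge -1$, with $\pi_L$ a uniformiser of $L$; a (lower) ramification jump is an integer $t$ with $G_t\neq G_{t+1}$. A ramified Galois extension of degree $p$ has a unique ramification jump. *)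

(* Defs.v *)
From HB Require Import structures.
From mathcomp Require Import all_boot all_order all_algebra all_fingroup all_field.
From mathcomp Require Import boolp classical_sets.

Set Implicit Arguments.
Unset Strict Implicit.
Unset Printing Implicit Defensive.

Import Order.TTheory GRing.Theory Num.Theory.
Local Open Scope classical_set_scope.
Local Open Scope ring_scope.

Definition rat_padic_abs (p : nat) (r : rat) : rat :=
  if r == 0 then 0
  else p%:R ^+ logn p `|denq r|%N / p%:R ^+ logn p `|numq r|%N.

(* The field Q_p, specified as the completion of Q for the p-adic absolute
   value.  This determines it up to a unique isomorphism of valued fields.
   Absolute values of elements of Q_p are 0 or powers of p, hence rational. *)
Record padicNumbers (p : nat) := PadicNumbers {
  padic_field :> fieldType ;
  padic_abs : padic_field -> rat ;
  padic_abs_ge0 : forall x, 0 <= padic_abs x ;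
  padic_abs_eq0 : forall x, padic_abs x = 0 <-> x = 0 ;
  padic_absM : forall x y, padic_abs (x * y) = padic_abs x * padic_abs y ;
  padic_absD : forall x y,
    padic_abs (x + y) <= Num.max (padic_abs x) (padic_abs y) ;
  padic_abs_ratr : forall r : rat, padic_abs (ratr r) = rat_padic_abs p r ;
  padic_complete : forall u : nat -> padic_field,
    (forall eps : rat, 0 < eps -> exists N : nat, forall m n : nat,
        (N <= m)%N -> (N <= n)%N -> padic_abs (u m - u n) < eps) ->
    exists l : padic_field, forall eps : rat, 0 < eps ->
      exists N : nat, forall n : nat, (N <= n)%N -> padic_abs (u n - l) < eps ;
  padic_rat_dense : forall (x : padic_field) (eps : rat), 0 < eps ->
    exists r : rat, padic_abs (x - ratr r) < eps
}.

(* A p-adic field is an E : fieldExtType Qp with Qp : padicNumbers p. *)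
Section PadicField.
Variables (p : nat) (Qp : padicNumbers p) (E : fieldExtType Qp).

(* The ring of integers: the integral closure in E of Z_p = {c | |c| <= 1}. *)
Definition integers : set E :=
  [set x | exists q : {poly Qp},
     [/\ q \is monic,
         forall i : nat, padic_abs q`_i <= 1
       & root (map_poly (in_alg E) q) x]].

Definition maximal_ideal : set E :=
  [set x | integers x /\ ~ (exists2 y, integers y & x * y = 1)].

Definition principal_ideal (x : E) : set E := [set x * y | y in integers].

Definition uniformizer (pi : E) : Prop := maximal_ideal = principal_ideal pi.

(* x O_E = (pi_E)^e *)
Definition generates_power (x : E) (e : nat) : Prop :=
  exists2 pi : E, uniformizer pi & principal_ideal x = principal_ideal (pi ^+ e).

(* e_E; like the other invariants below, it is the unique number with the
   stated property, and the default value 0 of xget is never used. *)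
Definition abs_ramification_index : nat :=
  xget 0%N [set e : nat | generates_power p%:R e].

(* A family of n integers of E whose classes form a basis of O_E / m_E
   over F_p = Z_p / p Z_p. *)
Definition residue_basis (n : nat) (b : 'I_n -> E) : Prop :=
  (forall i, integers (b i)) /\
  (forall x, integers x -> exists! c : {ffun 'I_n -> 'F_p},
     maximal_ideal (x - \sum_(i < n) (c i : nat)%:R * b i)).

Definition abs_inertia_degree : nat :=
  xget 0%N [set f : nat | exists b : 'I_f -> E, residue_basis b].

End PadicField.

(* [A : B] = n, for B an additive subgroup of A: the r i represent the
   cosets of B in A. *)
Definition has_index (V : zmodType) (A B : set V) (n : nat) : Prop :=
  exists r : 'I_n -> V,
    (forall i, A (r i)) /\ (forall x, A x -> exists! i, B (x - r i)).

Section GaloisExtension.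
Variables (p : nat) (Qp : padicNumbers p).
Variables (K : fieldExtType Qp) (L : splittingFieldType K).

(* L is a p-adic field through the tower L / K / Q_p. *)
Definition O_K : set K := integers (E := K).
Definition O_L : set L := integers (E := baseFieldType L).

Definition ramification_index : nat :=
  xget 0%N [set e : nat | exists2 piK : K, uniformizer piK &
    generates_power (E := baseFieldType L) (in_alg L piK) e].

Definition ramified : Prop := (1 < ramification_index)%N.

(* O_K[G] alpha *)
Definition galois_orbit_module (alpha : L) : set L :=
  [set x | exists2 c : gal_of {:L} -> K, forall g, O_K (c g) &
     x = \sum_(g in 'Gal({:L} / 1)%g) c g *: g alpha].

Definition has_orbit_index (alpha : L) (n : nat) : Prop :=
  has_index O_L (galois_orbit_module alpha) n.

Definition is_minimal_index (m : nat) : Prop :=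
  (exists2 alpha, O_L alpha & has_orbit_index alpha m) /\
  (forall alpha n, O_L alpha -> has_orbit_index alpha n -> (m <= n)%N).

(* m(L/K); only the alpha of finite index matter in the minimum. *)
Definition minimal_index : nat := xget 0%N is_minimal_index.

(* G_i for i >= -1; the exponent i + 1 is an int. *)
Definition ramification_group (piL : L) (i : int) : set (gal_of {:L}) :=
  [set g | g \in 'Gal({:L} / 1)%g /\
     forall x, O_L x -> exists2 y, O_L y & g x - x = piL ^ (i + 1) * y].

Definition ramification_jump (piL : L) (t : int) : Prop :=
  -1 <= t /\ ramification_group piL t <> ramification_group piL (t + 1).

End GaloisExtension.

(* Main.v *)
(* Idea: the integral closure of Z_p in a finite extension is a discrete
   valuation ring (Hensel lifting), so indices of full lattices are read off
   from valuations of determinants.  Fix g in G_t outside G_(t+1), which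
   generates G since G has order p, and put X = g - 1.
   If p does not divide v(x), then v(X x) = v(x) + t.

   If t is prime to p, take z of valuation a: the elements X^i z / piK^(nu_i),
   i < p, have valuations 0, ..., p - 1 in some order, hence form an O_K-basis
   of O_L.  Any alpha in O_L is theta(X) z with
   theta = sum_j c_j piK^(-nu_j) X^j, c_j in O_K, and the index of O_K[G] alpha
   has exponent sum_i nu_i + v_K(det theta).  Giving X^i the weight
   i e_K / (p - 1) bounds v_K(det theta) below by min_j (j e_K - (p - 1) nu_j),
   and theta = 1 + piK^(-nu_j) X^j attains the bound.

   If p divides t, then (p - 1) t = p e_K, the operator Y = piK^(-t/p) X
   preserves O_L, and O_L is free of rank one over O_K[Y]; the index is then
   that of the span of the X^k = piK^(kt/p) Y^k in the span of the Y^k. *)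
Require Import Defs.
From HB Require Import structures.
From mathcomp Require Import all_boot all_order all_algebra all_fingroup all_field.
From mathcomp Require Import boolp classical_sets.
From mathcomp Require Import cyclic zify ring.

Set Implicit Arguments.
Unset Strict Implicit.
Unset Printing Implicit Defensive.

Import Order.TTheory GRing.Theory Num.Theory.
Local Open Scope ring_scope.

(** * Valuations *)

(** The weight [e_K / (p - 1)] of [X] is the slope of the Newton polygon of [((1 + X)^p - 1) / X].
    In the relation [\sum_(0 < l <= p) 'C(p, l) X^l = 0] only [l = 1] and [l = p] then have least
    weight, so rewriting high powers of [X] by lower ones never loses weight, and a Leibniz
    expansion in weights controls [det theta]. The obstacle is the trivial character of [G], on
    which [X] is 0 and theta acts by its constant term. Row and column 0 are therefore treated
    apart, and the other [p - 1] rows give [(p - 1) min_j (j e_K / (p - 1) - nu_j)], which is the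
    minimum of the theorem. This minimum is at most 0 because [nu_0 = 0]. When [p] divides [t],
    adding [t] no longer moves a valuation to another residue class modulo [p], and the first basis
    is lost. Its substitute: on elements of valuation [n], [Y] acts as the scalar [n c] up to higher
    valuation, with [c] a fixed unit. These scalars are distinct for [0 <= n < p], so products of
    factors [Y - i c] applied to a suitable element have valuations [0, ..., p - 1]. *)

Record valuation (F : fieldType) := Valuation {
  dv :> F -> int ;
  dvM : forall x y, x != 0 -> y != 0 -> dv (x * y) = dv x + dv y ;
  dvD : forall x y, x != 0 -> y != 0 -> x + y != 0 ->
    Num.min (dv x) (dv y) <= dv (x + y)
}.

Record dval (F : fieldType) := DVal {
  dval_valuation :> valuation F ;
  dv_unif : exists2 u, u != 0 & dval_valuation u = 1
}.

(* [v 0] is a junk value: [vge] treats 0 as having infinite valuation. *)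
Definition vge (F : fieldType) (v : valuation F) (n : int) (x : F) : bool :=
  (x == 0) || (n <= v x).
Definition veq (F : fieldType) (v : valuation F) (n : int) (x : F) : bool :=
  (x != 0) && (v x == n).

Section Valuation.
Variables (F : fieldType) (v : valuation F).
Implicit Types (x y : F) (m n : int).

Lemma dv1 : v 1 = 0.
Proof.
have := dvM v (oner_neq0 F) (oner_neq0 F).
by rewrite mulr1 => /esym/eqP; rewrite -subr_eq0 addrK => /eqP.
Qed.

Lemma dvV x : x != 0 -> v x^-1 = - v x.
Proof.
move=> x0; apply: (@addrI _ (v x)).
by rewrite -dvM ?invr_eq0 // divff // dv1 subrr.
Qed.

Lemma dvN x : v (- x) = v x.
Proof.
have [->|x0] := eqVneq x 0; first by rewrite oppr0.
have n10 : (-1 : F) != 0 by rewrite oppr_eq0; apply: oner_neq0.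
have h : v (-1) + v (-1) = 0 by rewrite -(dvM v n10 n10) mulrNN mulr1 dv1.
rewrite -mulN1r (dvM v n10 x0); move: h; generalize (v (-1)) => k h; lia.
Qed.

Lemma veqP n x : reflect (x != 0 /\ v x = n) (veq v n x).
Proof. by apply: (iffP andP) => -[? /eqP]. Qed.

Lemma vgeP n x : reflect (x != 0 -> n <= v x) (vge v n x).
Proof.
rewrite /vge; have [->|x0] /= := eqVneq x 0; first by constructor.
by apply: (iffP idP); [move=> ? _|apply].
Qed.

Lemma veq_neq0 n x : veq v n x -> x != 0.
Proof. by case/andP. Qed.

Lemma veq_dv x : x != 0 -> veq v (v x) x.
Proof. by move=> x0; apply/andP. Qed.

Lemma veq_uniq m n x : veq v m x -> veq v n x -> m = n.
Proof. by move=> /veqP[_ <-] /veqP[]. Qed.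

Lemma veq_vge n x : veq v n x -> vge v n x.
Proof. by move=> /veqP[_ h]; apply/vgeP; rewrite h. Qed.

Lemma vge_0 n : vge v n 0.
Proof. by rewrite /vge eqxx. Qed.

Lemma vge_le m n x : vge v n x -> m <= n -> vge v m x.
Proof. by move=> /vgeP h mn; apply/vgeP => /h; exact: le_trans. Qed.

Lemma veq_vge_le m n x : veq v n x -> vge v m x = (m <= n).
Proof. by case/veqP => x0 h; rewrite /vge (negPf x0) h. Qed.

Lemma vgeD n x y : vge v n x -> vge v n y -> vge v n (x + y).
Proof.
have [->|x0] := eqVneq x 0; first by rewrite add0r.
have [->|y0] := eqVneq y 0; first by rewrite addr0.
move=> /vgeP hx /vgeP hy; apply/vgeP => xy0.
by apply: (le_trans _ (dvD v x0 y0 xy0)); rewrite le_min hx ?hy.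
Qed.

Lemma vgeN n x : vge v n (- x) = vge v n x.
Proof. by rewrite /vge oppr_eq0 dvN. Qed.

Lemma vgeB n x y : vge v n x -> vge v n y -> vge v n (x - y).
Proof. by move=> ? ?; rewrite vgeD ?vgeN. Qed.

Lemma vge_sum n (I : Type) (r : seq I) (P : pred I) (f : I -> F) :
  (forall i, P i -> vge v n (f i)) -> vge v n (\sum_(i <- r | P i) f i).
Proof. by move=> h; apply: (big_ind (vge v n)) => //; [exact: vge_0|exact: vgeD]. Qed.

Lemma vgeM m n x y : vge v m x -> vge v n y -> vge v (m + n) (x * y).
Proof.
move=> /vgeP hx /vgeP hy; apply/vgeP.
by rewrite mulf_eq0 negb_or => /andP[x0 y0]; rewrite dvM // lerD ?hx ?hy.
Qed.

Lemma vge0M x y : vge v 0 x -> vge v 0 y -> vge v 0 (x * y).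
Proof. by move=> hx hy; rewrite -[0]addr0 vgeM. Qed.

Lemma veqM m n x y : veq v m x -> veq v n y -> veq v (m + n) (x * y).
Proof.
move=> /veqP[x0 <-] /veqP[y0 <-]; apply/veqP.
by rewrite mulf_neq0 // dvM.
Qed.

Lemma veqV n x : veq v n x -> veq v (- n) x^-1.
Proof. by move=> /veqP[x0 <-]; apply/veqP; rewrite invr_eq0 dvV. Qed.

Lemma veqN n x : veq v n (- x) = veq v n x.
Proof. by rewrite /veq oppr_eq0 dvN. Qed.

Lemma veq1 : veq v 0 1.
Proof. by rewrite /veq oner_eq0 dv1. Qed.

Lemma vge1 : vge v 0 1.
Proof. exact/veq_vge/veq1. Qed.

Lemma veqX n x k : veq v n x -> veq v (k%:Z * n) (x ^+ k).
Proof.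
move=> h; elim: k => [|k IH]; first by rewrite mul0r veq1.
by rewrite exprS intS mulrDl mul1r veqM.
Qed.

Lemma vgeX n x k : vge v n x -> vge v (k%:Z * n) (x ^+ k).
Proof.
move=> h; elim: k => [|k IH]; first by rewrite mul0r vge1.
by rewrite exprS intS mulrDl mul1r vgeM.
Qed.

Lemma vge0X x k : vge v 0 x -> vge v 0 (x ^+ k).
Proof. by move=> /(vgeX k); rewrite mulr0. Qed.

Lemma vge_nat n k x : vge v n x -> vge v n (x *+ k).
Proof.
by move=> h; elim: k => [|k IH]; rewrite ?mulr0n ?vge_0 // mulrS vgeD.
Qed.

Lemma vge_prod (I : Type) (r : seq I) (P : pred I) (f : I -> F) (w : I -> int) :
  (forall i, P i -> vge v (w i) (f i)) ->
  vge v (\sum_(i <- r | P i) w i) (\prod_(i <- r | P i) f i).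
Proof.
move=> h; elim: r => [|i r IH]; first by rewrite !big_nil vge1.
by rewrite !big_cons; case: ifP => // /h hi; rewrite vgeM.
Qed.

Lemma veq_prod (I : Type) (r : seq I) (P : pred I) (f : I -> F) (w : I -> int) :
  (forall i, P i -> veq v (w i) (f i)) ->
  veq v (\sum_(i <- r | P i) w i) (\prod_(i <- r | P i) f i).
Proof.
move=> h; elim: r => [|i r IH]; first by rewrite !big_nil veq1.
by rewrite !big_cons; case: ifP => // /h hi; rewrite veqM.
Qed.

Lemma vgeV n x : ~~ vge v n x -> exists2 m, m < n & veq v m x.
Proof.
by rewrite /vge negb_or -ltNge => /andP[x0 h]; exists (v x) => //; apply: veq_dv.
Qed.

Lemma vge_veq n x : vge v n x -> ~~ veq v n x -> vge v (n + 1) x.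
Proof.
rewrite /vge /veq; have [//|x0 /=] := eqVneq x 0.
by move=> h1 h2; lia.
Qed.

Lemma veqN_vge n x : veq v n x -> ~~ vge v (n + 1) x.
Proof. by move=> h; rewrite (veq_vge_le _ h); lia. Qed.

Lemma veqD n x y : veq v n x -> vge v (n + 1) y -> veq v n (x + y).
Proof.
move=> hx hy; have hxy : vge v n (x + y).
  by rewrite vgeD ?(veq_vge hx) // (vge_le hy) // ler_wpDr.
apply: contraT => /(vge_veq hxy) h.
by have := veqN_vge hx; rewrite -[x](addrK y) vgeB.
Qed.

Lemma veqDr n x y : vge v (n + 1) x -> veq v n y -> veq v n (x + y).
Proof. by move=> hx hy; rewrite addrC veqD. Qed.

Lemma veq_sum n (I : finType) (i0 : I) (f : I -> F) :
  veq v n (f i0) -> (forall i, i != i0 -> vge v (n + 1) (f i)) ->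
  veq v n (\sum_i f i).
Proof.
by move=> h0 h; rewrite (bigD1 i0) //= veqD // vge_sum.
Qed.

(** Distinct valuations forbid cancellation: the term of least valuation decides. All independence
    arguments on bases with prescribed valuations rest on this. *)
Lemma veq_min_sum (I : finType) (f : I -> F) :
  (forall i j, f i != 0 -> f j != 0 -> v (f i) = v (f j) -> i = j) ->
  (forall i, f i = 0) \/
  exists i0, [/\ f i0 != 0, veq v (v (f i0)) (\sum_i f i) &
     forall i, vge v (v (f i0)) (f i)].
Proof.
move=> inj; have [/existsP[i0 hi0]|/existsPn h] := boolP [exists i, f i != 0];
  last by left => i; apply/eqP/negPn/h.
right; case: (@Order.TotalTheory.arg_minP _ int I i0 (fun i => f i != 0)
  (fun i => v (f i)) hi0) => i hi hmin.
exists i; split => //; last by move=> j; apply/vgeP/hmin.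
apply: (@veq_sum _ _ i); first exact: veq_dv.
move=> j ji; apply/vgeP => fj0; have := hmin j fj0.
rewrite le_eqVlt => /orP[/eqP e|]; last by lia.
by move/eqP: ji; case; apply: inj.
Qed.

Lemma vge_sum_inj n (I : finType) (f : I -> F) :
  (forall i j, f i != 0 -> f j != 0 -> v (f i) = v (f j) -> i = j) ->
  vge v n (\sum_i f i) -> forall i, vge v n (f i).
Proof.
move=> /veq_min_sum[h _ i|[i0 [h1 h2 h3]] h i]; first by rewrite h vge_0.
by apply: vge_le (h3 i) _; rewrite -(veq_vge_le _ h2).
Qed.

Lemma veqXz m n u : veq v m u -> veq v (n * m) (u ^ n).
Proof.
move=> h; case: n => k; first by rewrite -exprnP veqX.
by rewrite NegzE -exprnN mulNr veqV // veqX.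
Qed.

Lemma veq_piz n u : veq v 1 u -> veq v n (u ^ n).
Proof. by move=> /(veqXz n); rewrite mulr1. Qed.

End Valuation.

Section DVal.
Variables (F : fieldType) (v : dval F).

Definition dval_pi : F := projT1 (cid2 (dv_unif v)).

Lemma veq_pi : veq v 1 dval_pi.
Proof. by rewrite /dval_pi; case: cid2 => u u0 e /=; apply/veqP. Qed.

Lemma pi_neq0 : dval_pi != 0.
Proof. exact: veq_neq0 veq_pi. Qed.

End DVal.

(** * The valuation of Q_p *)

Section QpValuation.
Variables (p : nat) (p_prime : prime p) (Qp : padicNumbers p).
Implicit Types x y : Qp.

Lemma padic_abs0 : padic_abs (0 : Qp) = 0.
Proof. exact/padic_abs_eq0. Qed.

Lemma padic_abs_gt0 x : x != 0 -> 0 < padic_abs x.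
Proof.
move=> x0; rewrite lt_neqAle padic_abs_ge0 andbT eq_sym.
by apply: contra x0 => /eqP/padic_abs_eq0/eqP.
Qed.

Lemma padic_abs1 : padic_abs (1 : Qp) = 1.
Proof.
have h := padic_absM (1 : Qp) 1; rewrite mulr1 in h.
have n0 := lt0r_neq0 (padic_abs_gt0 (oner_neq0 Qp)).
by apply: (mulfI n0); rewrite -h mulr1.
Qed.

Lemma padic_absN x : padic_abs (- x) = padic_abs x.
Proof.
rewrite -mulN1r padic_absM; suff -> : padic_abs (-1 : Qp) = 1 by rewrite mul1r.
have h : padic_abs (-1 : Qp) ^+ 2 == 1.
  by rewrite expr2 -padic_absM mulrNN mulr1 padic_abs1.
have := padic_abs_ge0 (-1 : Qp).
by move: h; rewrite sqrf_eq1 => /orP[/eqP ->//|/eqP ->].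
Qed.

Let pR : (0 : rat) < p%:R.
Proof. by rewrite ltr0n prime_gt0. Qed.

Let p_neq0 : (p%:R : rat) != 0.
Proof. exact: lt0r_neq0. Qed.

Lemma rat_padic_abs_pow (r : rat) : r != 0 ->
  rat_padic_abs p r =
    (p%:R : rat) ^ ((logn p `|denq r|%N)%:Z - (logn p `|numq r|%N)%:Z).
Proof.
by move=> r0; rewrite /rat_padic_abs (negPf r0) expfzDr // -exprnN.
Qed.

(** A rational number closer to [x] than [padic_abs x] has the same absolute value, by the
    ultrametric inequality; density provides one. *)
Lemma padic_abs_approx x : x != 0 ->
  exists2 r : rat, r != 0 & padic_abs x = rat_padic_abs p r.
Proof.
move=> x0; have [r hr] := padic_rat_dense x (padic_abs_gt0 x0).
have le1 : padic_abs x <= padic_abs (ratr r : Qp).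
  have := padic_absD (x - ratr r) (ratr r); rewrite subrK le_max.
  by rewrite leNgt hr.
have le2 : padic_abs (ratr r : Qp) <= padic_abs x.
  have := padic_absD (x - (x - ratr r)) 0; rewrite addr0.
  have := padic_absD x (- (x - ratr r)); rewrite padic_absN opprB addrC subrK.
  by rewrite le_max => /orP[//|/le_trans h] _; apply: h; apply: ltW.
exists r; last by rewrite -(padic_abs_ratr Qp); apply/eqP; rewrite eq_le le1 le2.
apply: contraTneq le1 => ->; rewrite padic_abs_ratr /rat_padic_abs eqxx -ltNge.
exact: padic_abs_gt0.
Qed.

Lemma padic_abs_pow x : x != 0 -> exists k : int, padic_abs x = p%:R ^ (- k).
Proof.
move=> /padic_abs_approx[r r0 ->]; rewrite rat_padic_abs_pow //.
by rewrite -[X in _ ^ X]opprK; eexists.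
Qed.

Let p_gt1 : (1 : rat) < p%:R.
Proof. by rewrite ltr1n prime_gt1. Qed.

Definition padic_val x : int := xget 0 [set k : int | padic_abs x = p%:R ^ (- k)].

Lemma padic_valE x : x != 0 -> padic_abs x = p%:R ^ (- padic_val x).
Proof. by move=> /padic_abs_pow; apply: xgetPex. Qed.

Lemma padic_val_uniq x k : padic_abs x = p%:R ^ (- k) -> padic_val x = k.
Proof.
move=> h; have x0 : x != 0.
  by apply/eqP => x0; have := expfz_neq0 (- k) p_neq0; rewrite -h x0 padic_abs0 eqxx.
apply: oppr_inj; apply: (@ieexprIz rat p%:R) => //; rewrite -?padic_valE //.
by rewrite gt_eqF.
Qed.

Lemma padic_val_le x k : x != 0 -> (padic_abs x <= p%:R ^ (- k)) = (k <= padic_val x).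
Proof. by move=> x0; rewrite padic_valE // ler_eXz2l // lerN2. Qed.

Fact padic_valM x y : x != 0 -> y != 0 ->
  padic_val (x * y) = padic_val x + padic_val y.
Proof.
move=> x0 y0; apply: padic_val_uniq.
by rewrite padic_absM !padic_valE // -expfzDr // opprD.
Qed.

Fact padic_valD x y : x != 0 -> y != 0 -> x + y != 0 ->
  Num.min (padic_val x) (padic_val y) <= padic_val (x + y).
Proof.
move=> x0 y0 xy0; rewrite -padic_val_le //; apply: (le_trans (padic_absD x y)).
by rewrite ge_max !padic_val_le // !ge_min !lexx orbT.
Qed.

Lemma padic_abs_nat n : (0 < n)%N -> padic_abs (n%:R : Qp) = p%:R ^ (- (logn p n)%:Z).
Proof.
move=> n0; rewrite -[n%:R](ratr_nat Qp) padic_abs_ratr rat_padic_abs_pow.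
  by rewrite -[n%:R]/(n%:~R) numq_int denq_int /= logn1 sub0r.
by rewrite pnatr_eq0 -lt0n.
Qed.

Lemma padic_nat_neq0 n : (0 < n)%N -> (n%:R : Qp) != 0.
Proof.
move=> /padic_abs_nat h; apply/eqP => e; have := expfz_neq0 (- (logn p n)%:Z) p_neq0.
by rewrite -h e padic_abs0 eqxx.
Qed.

Fact padic_val_p : padic_val p%:R = 1.
Proof. by apply: padic_val_uniq; rewrite padic_abs_nat ?prime_gt0 // logn_prime ?eqxx. Qed.

Definition padic_dval : dval Qp := @DVal _ (Valuation padic_valM padic_valD)
  (ex_intro2 _ _ p%:R (padic_nat_neq0 (prime_gt0 p_prime)) padic_val_p).

Lemma vge_padic k x : vge padic_dval k x = (padic_abs x <= p%:R ^ (- k)).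
Proof.
rewrite /vge; have [->|x0] /= := eqVneq x 0; last by rewrite padic_val_le.
by rewrite padic_abs0 exprz_ge0 // ltW.
Qed.

Lemma vge0_padic x : vge padic_dval 0 x = (padic_abs x <= 1).
Proof. by rewrite vge_padic oppr0. Qed.

Lemma v0_p : veq padic_dval 1 (p%:R : Qp).
Proof. by apply/veqP; rewrite padic_nat_neq0 ?prime_gt0 // /= padic_val_p. Qed.

Lemma v0_nat n : vge padic_dval 0 (n%:R : Qp).
Proof. exact/vge_nat/vge1. Qed.

Lemma v0_nat_unit n : ~~ (p %| n)%N -> veq padic_dval 0 (n%:R : Qp).
Proof.
move=> pn; have n0 : (0 < n)%N by rewrite lt0n; apply: contraNneq pn => ->.
apply/veqP; split; first exact: padic_nat_neq0.
by apply: padic_val_uniq; rewrite padic_abs_nat // lognE (negPf pn) !andbF.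
Qed.

Lemma exp_padic_small (eps : rat) : 0 < eps -> exists k : nat, p%:R ^ (- k%:Z) < eps.
Proof.
move=> e0; exists (Num.bound eps^-1).
have b := archi_boundP (ltW (e0 : 0 < eps)); set k := Num.bound _.
have hk : eps^-1 < k%:R by apply: archi_boundP; rewrite invr_ge0 ltW.
rewrite -exprnN invf_plt ?posrE ?exprn_gt0 //; apply: (lt_trans hk).
by rewrite -natrX ltr_nat ltn_expl ?prime_gt1.
Qed.

(** Bounds on successive differences suffice for the Cauchy property in an ultrametric field, and
    they also give the rate of convergence. *)
Lemma v0_complete (u : nat -> Qp) : (forall k, vge padic_dval k%:Z (u k.+1 - u k)) ->
  exists l, forall k, vge padic_dval k%:Z (l - u k).
Proof.
move=> hu; have hu2 k m : (k <= m)%N -> vge padic_dval k%:Z (u m - u k).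
  move=> /subnKC <-; elim: (m - k)%N => [|d IH]; first by rewrite addn0 subrr vge_0.
  rewrite -(subrKA (u (k + d)%N)) addnS vgeD // (vge_le (hu _)) //.
  by rewrite lez_nat leq_addr.
have [|l hl] := @padic_complete _ Qp u.
  move=> eps e0; have [k hk] := exp_padic_small e0; exists k => m n km kn.
  apply: le_lt_trans hk; rewrite -vge_padic -(subrKA (u k)) -(opprB (u n)) .
  by rewrite vgeB ?hu2.
exists l => k.
have [|N hN] := hl (p%:R ^ (- k%:Z)); first by rewrite exprz_gt0.
have h1 := hN (maxn N k) (leq_maxl _ _).
rewrite -(subrKA (u (maxn N k))) vgeD ?hu2 ?leq_maxr //.
by rewrite -opprB vgeN vge_padic ltW.
Qed.

Lemma v0_residue x : vge padic_dval 0 x -> exists2 c : nat, (c < p)%N & vge padic_dval 1 (x - c%:R).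
Proof.
move=> x0; have [|r hr] := @padic_rat_dense _ Qp x (p%:R ^ (-1)).
  by rewrite exprz_gt0.
have hxr : vge padic_dval 1 (x - ratr r) by rewrite vge_padic ltW.
(* If [p] divided the denominator, the numerator would be prime to [p] and [r] would not be
   integral. *)
have pdenq : ~~ (p %| `|denq r|)%N.
  apply/negP => pd.
  have : vge padic_dval 0 (ratr r : Qp).
    by rewrite -[ratr r](subKr x) vgeB // (vge_le hxr).
  have r0 : r != 0.
    by apply: contraTneq pd => ->; rewrite (_ : denq 0 = 1) // dvdn1 gtn_eqF ?prime_gt1.
  have pn : ~~ (p %| `|numq r|)%N.
    apply/negP => pn; have := coprime_num_den r; rewrite /coprime => /eqP e.
    by have := dvdn_gcd p `|numq r| `|denq r|; rewrite e pn pd dvdn1 gtn_eqF ?prime_gt1.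
  rewrite vge0_padic padic_abs_ratr rat_padic_abs_pow //.
  rewrite (@lognE p `|numq r|) (negPf pn) !andbF subr0 -[1](expr0z (p%:R : rat)).
  rewrite ler_eXz2l // lez_nat leqn0 lognE p_prime pd absz_gt0 denq_neq0 //.
have cop : coprime p `|denq r| by rewrite prime_coprime.
(* [c] is the numerator times [a], an inverse of the denominator modulo [p] given by Bezout. *)
have [c cp hc] : exists2 c : nat, (c < p)%N & (p%:Z %| numq r - c%:Z * denq r)%Z.
  have cz : coprimez (denq r) p by rewrite /coprimez /gcdz coprime_sym in cop *.
  have [[a b] /= hab] : exists ab : int * int, ab.1 * denq r + ab.2 * p%:Z = 1.
    by have [a [b ab]] := Bezoutz (denq r) p; exists (a, b); rewrite /= ab (eqP cz).
  have p0 : p%:Z != 0 by rewrite -lt0n prime_gt0 //.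
  exists `|(numq r * a %% p)%Z|%N.
    by rewrite -ltz_nat gez0_abs ?modz_ge0 // ltz_pmod // ltz_nat prime_gt0.
  rewrite gez0_abs ?modz_ge0 //; apply/dvdzP.
  have e := divz_eq (numq r * a) p.
  have -> : (numq r * a %% p)%Z = numq r * a - (numq r * a %/ p)%Z * p.
    by rewrite {2}e addrAC subrr add0r.
  rewrite -{1}[numq r]mulr1 -hab.
  exists (numq r * b + (numq r * a %/ p)%Z * denq r); ring.
exists c => //; rewrite -(subrKA (ratr r)) vgeD //.
have d0 : veq padic_dval 0 ((denq r)%:~R : Qp).
  by rewrite -[denq r]gez0_abs ?denq_ge0 // -pmulrn v0_nat_unit.
have -> : ratr r - c%:R = (numq r - c%:Z * denq r)%:~R / (denq r)%:~R :> Qp.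
  apply: (mulIf (veq_neq0 d0)); rewrite mulfVK ?(veq_neq0 d0) // /ratr mulrBl.
  by rewrite mulfVK ?(veq_neq0 d0) // rmorphB rmorphM.
rewrite -[1]addr0 vgeM //; last by rewrite veq_vge // -[0]oppr0 veqV.
have /dvdzP[k ->] := hc.
rewrite rmorphM -[1]add0r vgeM ?(veq_vge v0_p) //=.
by case: k {hc} => k; rewrite ?NegzE ?mulrNz ?vgeN v0_nat.
Qed.

End QpValuation.

(** * Hensel lifting *)

Section Hensel.
Variables (F : fieldType) (v : dval F).
Implicit Types f g q : {poly F}.

Definition pge (n : int) q := forall i, vge v n q`_i.

Lemma pgeD n f g : pge n f -> pge n g -> pge n (f + g).
Proof. by move=> hf hg i; rewrite coefD vgeD. Qed.

Lemma pgeN n f : pge n f -> pge n (- f).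
Proof. by move=> hf i; rewrite coefN vgeN. Qed.

Lemma pgeB n f g : pge n f -> pge n g -> pge n (f - g).
Proof. by move=> hf /pgeN; apply: pgeD. Qed.

Lemma pgeM m n f g : pge m f -> pge n g -> pge (m + n) (f * g).
Proof. by move=> hf hg i; rewrite coefM vge_sum // => j _; rewrite vgeM. Qed.

Lemma pge_le m n f : pge n f -> m <= n -> pge m f.
Proof. by move=> hf mn i; apply: vge_le (hf i) mn. Qed.

Lemma pgeZ m n c f : vge v m c -> pge n f -> pge (m + n) (c *: f).
Proof. by move=> hc hf i; rewrite coefZ vgeM. Qed.

Lemma pgeXn k : pge 0 'X^k.
Proof. by move=> i; rewrite coefXn; case: eqP; rewrite ?vge1 ?vge_0. Qed.

(** Long division divides only by the leading coefficient of [d], so a unit there preserves all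
    bounds. It is not taken to be 1 because the approximate factors in Hensel lifting are not
    monic. *)
Lemma pge_divmod n d f : pge 0 d -> veq v 0 (lead_coef d) -> pge n f ->
  pge n (f %/ d) /\ pge n (f %% d).
Proof.
move=> hd hl hf.
have d0 : (0 < size d)%N.
  by rewrite size_poly_gt0 -lead_coef_eq0 (veq_neq0 hl).
suff [q [r [-> szr hq hr]]] : exists q r,
    [/\ f = q * d + r, (size r < size d)%N, pge n q & pge n r].
  by rewrite divp_addl_mul_small // modp_addl_mul_small.
have [N szf] : exists N, (size f <= N)%N by exists (size f).
elim: N f hf szf => [|N IH] f hf szf.
  exists 0, f; rewrite mul0r add0r; split=> //; last by move=> i; rewrite coef0 vge_0.
  exact: leq_ltn_trans szf d0.
have [szd|szd] := leqP (size d) N.+1; last first.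
  exists 0, f; rewrite mul0r add0r; split=> //; last by move=> i; rewrite coef0 vge_0.
  exact: leq_ltn_trans szf szd.
have [fN|fN] := leqP (size f) N.
  by have [q [r h]] := IH f hf fN; exists q, r.
have szfN : size f = N.+1 by apply/eqP; rewrite eqn_leq szf fN.
pose c := f`_N / lead_coef d; pose m := (N - (size d).-1)%N.
have hc : vge v n c by rewrite -[n]addr0 vgeM // veq_vge // -oppr0 veqV.
have hcd : pge n (c *: ('X^m * d)).
  by rewrite -[n]addr0; apply: pgeZ => //; rewrite -[0]addr0; apply: pgeM => //; apply: pgeXn.
have [||q [r [e szr hq hr]]] := IH (f - c *: ('X^m * d)).
- exact: pgeB.
- apply/leq_sizeP => i Ni; rewrite coefB coefZ coefXnM.
  have mi : (i < m)%N = false by apply/negbTE; rewrite -leqNgt /m (leq_trans (leq_subr _ _)).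
  rewrite mi; case: (ltngtP N i) Ni => // [Ni|<-] _.
    rewrite nth_default ?szfN // [d`_ _]nth_default ?mulr0 ?subr0 //.
    by rewrite /m; move: szd d0 Ni; move: (size _) => D *; lia.
  have -> : (N - m)%N = (size d).-1 by rewrite /m; move: szd d0; move: (size _) => D *; lia.
  by rewrite -lead_coefE /c divfK ?subrr ?(veq_neq0 hl).
exists (c *: 'X^m + q), r; split => //.
  by rewrite mulrDl -addrA -e -scalerAl addrC subrK.
apply: pgeD => //; rewrite -[n]addr0; apply: pgeZ => //; exact: pgeXn.
Qed.

Hypothesis complete : forall u : nat -> F,
  (forall k, vge v k%:Z (u k.+1 - u k)) ->
  exists l, forall k, vge v k%:Z (l - u k).

Lemma vge_all_eq0 x : (forall k : nat, vge v k%:Z x) -> x = 0.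
Proof.
move=> h; apply/eqP; apply: contraT => x0.
have := h `|v x|%N.+1; rewrite /vge (negPf x0) /= => h1.
have := lez_abs (v x); lia.
Qed.

(* One step of Hensel lifting replaces the approximate divisor [a] of [g] by
   [a + g %% a]; since the cofactor is 1 modulo the maximal ideal, the
   remainder gains one order of smallness each time. *)
Lemma hensel_factor (g : {poly F}) (s : nat) :
  pge 0 g -> veq v 0 g`_s -> (forall i, (s < i)%N -> vge v 1 g`_i) ->
  exists2 a, a %| g & size a = s.+1.
Proof.
move=> hg gs hgs.
(* The start is [g] cut off after degree [s], congruent to [g] modulo the maximal ideal. *)
pose a k : {poly F} := iter k (fun a : {poly F} => a + g %% a) (take_poly s.+1 g).
have a0E i : (a 0%N)`_i = if (i < s.+1)%N then g`_i else 0 by rewrite coef_take_poly.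
have inv k : [/\ size (a k) = s.+1, pge 0 (a k), (a k)`_s = g`_s,
    pge 1 (g - a k) & pge k.+1%:Z (g %% a k)].
  elim: k => [|k [sz ha as_ hga hr]].
    have sz : size (a 0%N) = s.+1.
      apply/eqP; rewrite eqn_leq; apply/andP; split.
        by apply/leq_sizeP => i si; rewrite a0E ltnNge si.
      rewrite ltnNge; apply/negP => /leq_sizeP/(_ s (leqnn _)).
      by rewrite a0E ltnSn => e; have := veq_neq0 gs; rewrite e eqxx.
    have ha : pge 0 (a 0%N) by move=> i; rewrite a0E; case: ifP; rewrite ?vge_0.
    have as_ : (a 0%N)`_s = g`_s by rewrite a0E ltnSn.
    have hga : pge 1 (g - a 0%N).
      move=> i; rewrite coefB a0E; case: ifP => [_|/negbT]; first by rewrite subrr vge_0.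
      by rewrite -leqNgt subr0; apply: hgs.
    have lc : veq v 0 (lead_coef (a 0%N)) by rewrite lead_coefE sz /= as_.
    split => //; rewrite -[g](subrK (a 0%N)) modpD modpp addr0.
    by case: (pge_divmod ha lc hga).
  have aS : a k.+1 = a k + g %% a k by [].
  have lc : veq v 0 (lead_coef (a k)) by rewrite lead_coefE sz /= as_.
  have a_n0 : a k != 0 by rewrite -size_poly_gt0 sz.
  have szr : (size (g %% a k)%R <= s)%N by rewrite -ltnS -sz ltn_modp.
  have sz1 : size (a k.+1) = s.+1 by rewrite aS size_polyDl ?sz.
  have ha1 : pge 0 (a k.+1) by rewrite aS; apply: pgeD => //; apply: pge_le hr _.
  have as1 : (a k.+1)`_s = g`_s.
    by rewrite aS coefD as_ [X in _ + X]nth_default ?addr0.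
  have lc1 : veq v 0 (lead_coef (a k.+1)) by rewrite lead_coefE sz1 /= as1.
  have hga1 : pge 1 (g - a k.+1).
    by rewrite aS opprD addrA; apply: pgeB => //; apply: pge_le hr _.
  split => //.
  have hq : pge 1 (1 - g %/ a k).
    have -> : 1 - g %/ a k = - ((g - a k) %/ a k).
      by rewrite divpD divpN divpp // opprB addrC.
    by apply: pgeN; case: (pge_divmod ha lc hga).
  have -> : g %% a k.+1 = ((g %% a k) * (1 - g %/ a k)) %% a k.+1.
    rewrite {1}(divp_eq g (a k)).
    have -> : g %/ a k * a k + g %% a k =
        g %/ a k * a k.+1 + g %% a k * (1 - g %/ a k) by rewrite aS; ring.
    by rewrite modpD modp_mull add0r.
  have h : pge (k.+2)%:Z ((g %% a k) * (1 - g %/ a k)).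
    by rewrite -addn1 PoszD; apply: pgeM.
  by case: (pge_divmod ha1 lc1 h).
(* The corrections [g %% a k] tend to 0, so the coefficients of [a k] converge. *)
have ex i : exists l, forall k, vge v k%:Z (l - (a k)`_i).
  apply: complete => k; have [_ _ _ _ hr] := inv k.
  rewrite [a k.+1]/(a k + g %% a k) coefD addrAC subrr add0r.
  by apply: (vge_le (hr i)); rewrite lez_nat.
pose l i := projT1 (cid (ex i)).
have hl i k : vge v k%:Z (l i - (a k)`_i) by rewrite /l; case: cid.
pose b := \poly_(i < s.+1) l i.
have hb k : pge k%:Z (b - a k).
  move=> i; rewrite coefB coef_poly; case: ltnP => // si.
  by rewrite nth_default ?subr0 ?vge_0 //; have [-> _ _ _ _] := inv k.
have bs : b`_s = g`_s.
  rewrite coef_poly ltnSn; apply/eqP; rewrite -subr_eq0; apply/eqP/vge_all_eq0 => k.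
  by have [_ _ <- _ _] := inv k.
have szb : size b = s.+1.
  apply/eqP; rewrite eqn_leq size_poly ltnNge; apply/negP => /leq_sizeP/(_ s (leqnn _)).
  by rewrite bs => e; have := veq_neq0 gs; rewrite e eqxx.
have hb0 : pge 0 b.
  have -> : b = (b - a 0%N) + a 0%N by rewrite subrK.
  by apply: pgeD; [apply: hb|have [] := inv 0%N].
have lcb : veq v 0 (lead_coef b) by rewrite lead_coefE szb /= bs.
exists b => //; apply/eqP/polyP => i; rewrite coef0; apply: vge_all_eq0 => k.
have [sz ha as_ hga hr] := inv k.
have lc : veq v 0 (lead_coef (a k)) by rewrite lead_coefE sz /= as_.
(* As [b] and [a k] agree to order [k], so do the remainders; hence [g %% b] is of order [k] for
   every [k]. *)
have -> : g %% b = ((a k - b) * (g %/ a k) + g %% a k) %% b.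
  have {1}-> : g = g %/ a k * b + ((a k - b) * (g %/ a k) + g %% a k).
    by rewrite [LHS](divp_eq g (a k)); ring.
  by rewrite modpD modp_mull add0r.
suff h : pge k%:Z ((a k - b) * (g %/ a k) + g %% a k) by case: (pge_divmod hb0 lcb h).
apply: pgeD; last by apply: pge_le hr _; rewrite lez_nat.
rewrite -[k%:Z]addr0; apply: pgeM; first by rewrite -opprB; apply: pgeN.
by case: (pge_divmod ha lc hg).
Qed.

(** Suppose the least valuation [w] of the coefficients is below [n]. Scaled by its last coefficient
    of valuation [w], of index [s], the polynomial has a reduction of degree [s], and Hensel lifting
    gives a factor of degree [s]. The bounds at both ends exclude [s = 0] and [s = deg f], which
    contradicts irreducibility. *)
Lemma irreducible_pge (f : {poly F}) (n : int) : irreducible_poly f ->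
  vge v n f`_0 -> vge v n (lead_coef f) -> pge n f.
Proof.
move=> [szf irr] f0 fl i; apply: contraT => /vgeV[m m0 hm].
have fN (j : nat) : f`_j != 0 -> (j < size f)%N.
  by move=> h; rewrite ltnNge; apply: contra h => h; rewrite nth_default.
have [w [j0 fj0] hw] : exists2 w, exists j0, veq v w f`_j0 & forall j, vge v w f`_j.
  have si := fN i (veq_neq0 hm).
  case: (@Order.TotalTheory.arg_minP _ int 'I_(size f) (Ordinal si)
    (fun i => f`_i != 0) (fun i => v f`_i) (veq_neq0 hm)) => j hj hmin.
  exists (v f`_j); first by exists j; apply: veq_dv.
  by move=> k; apply/vgeP => fk; apply: (hmin (Ordinal (fN k fk))).
have [s fs smax] := @ex_maxnP (fun j => veq v w f`_j) (size f)
  (ex_intro _ j0 fj0) (fun j h => ltnW (fN j (veq_neq0 h))).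
have w0 : w < n by have := hw i; rewrite (veq_vge_le _ hm) => /le_lt_trans; apply.
have f_s := veq_neq0 fs.
have hc : veq v (- w) (f`_s)^-1 by rewrite veqV.
have [|||a ag sa] := @hensel_factor ((f`_s)^-1 *: f) s.
- by move=> k; rewrite coefZ -(addNr w) vgeM // veq_vge.
- by rewrite coefZ mulVf ?veq1.
- move=> k sk; rewrite coefZ -[X in vge _ X](addKr w) vgeM ?(veq_vge hc) // vge_veq //.
  by apply/negP => /smax; rewrite leqNgt sk.
have af : a %| f by rewrite dvdpZr ?invr_eq0 in ag.
have [s0|s0] := eqVneq s 0%N.
  by move: fs; rewrite s0 => fs; move: f0; rewrite (veq_vge_le _ fs) leNgt w0.
have := irr a; rewrite sa eqSS s0 af => /(_ isT isT)/eqp_size.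
rewrite sa => e.
move: fl; rewrite lead_coefE -e (veq_vge_le _ fs).
by rewrite leNgt w0.
Qed.

End Hensel.

(** * Extension of the valuation to a finite extension *)

Section ValuationRing.
Variables (F : fieldType) (v : dval F).

Definition vring : {pred F} := fun x => vge v 0 x.

Fact vring_subring : subring_closed vring.
Proof.
split; [exact: vge1|move=> x y; exact: vgeB|move=> x y; exact: vge0M].
Qed.

HB.instance Definition _ := GRing.isSubringClosed.Build F vring vring_subring.

(** The valuation ring as a type of its own, so that [integralOver] applies and integral elements
    are known to be closed under the ring operations. *)
Record vint := Vint { vint_val :> F; _ : vint_val \in vring }.
HB.instance Definition _ := [isSub for vint_val].
HB.instance Definition _ := [Choice of vint by <:].
HB.instance Definition _ := [SubChoice_isSubComNzRing of vint by <:].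

Lemma poly_vint (q : {poly F}) : pge v 0 q ->
  exists q' : {poly vint}, q = map_poly (val : vint -> F) q'.
Proof.
move=> hq; exists (\poly_(i < size q) (insubd (0 : vint) q`_i)).
apply/polyP => i; rewrite coef_map coef_poly; case: ltnP => si.
  by rewrite /= insubdK // /vring; apply: hq.
by rewrite nth_default // rmorph0.
Qed.

End ValuationRing.

(** At a point of negative valuation the leading term of a monic integral polynomial strictly
    dominates, so the value is not 0. *)
Lemma vring_int_closed (F : fieldType) (v : dval F) (q : {poly F}) (c : F) :
  q \is monic -> pge v 0 q -> root q c -> vge v 0 c.
Proof.
move=> qm hq; apply: contraTT => /vgeV[m m0 hm].
have [n szq] : exists n, size q = n.+1.
  by exists (size q).-1; rewrite prednK // size_poly_gt0 monic_neq0.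
rewrite rootE horner_coef szq big_ord_recr /=.
have -> : q`_n = 1 by have := monicP qm; rewrite lead_coefE szq.
rewrite mul1r; apply: (@veq_neq0 _ v (n%:Z * m)); apply: veqDr (veqX _ hm).
apply: vge_sum => i _; apply: (@vge_le _ _ _ (0 + i%:Z * m)).
  by rewrite vgeM // vgeX // veq_vge.
have h : (i < n)%N by [].
move: {hq qm szq hm} m0 h; case: i => i /= _; nia.
Qed.

(** * The integral closure is a discrete valuation ring *)

Section Integers.
Variables (p : nat) (p_prime : prime p) (Qp : padicNumbers p).
Variable (E : fieldExtType Qp).
Let v0 := padic_dval p_prime Qp.
Implicit Types x y : E.

Definition vint_alg : vint v0 -> E := in_alg E \o val.
HB.instance Definition _ := GRing.RMorphism.on vint_alg.

Lemma integersP x : integers x <-> integralOver vint_alg x.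
Proof.
split=> [[q [qm qi qx]]|[q qm qx]].
  have [|q' e] := @poly_vint _ v0 q; first by move=> i; rewrite vge0_padic.
  exists q'; last by rewrite map_poly_comp -e.
  move: qm; rewrite e !monicE (lead_coef_map_inj val_inj (rmorph0 _)) => /eqP h.
  exact/eqP/val_inj.
exists (map_poly (val : vint v0 -> Qp) q); split.
- exact: monic_map.
- by move=> i; rewrite coef_map -(vge0_padic p_prime); apply: (valP q`_i).
- by rewrite -map_poly_comp.
Qed.

Lemma integersB x y : integers x -> integers y -> integers (x - y).
Proof. by rewrite !integersP; apply: integral_sub. Qed.

Lemma integersM x y : integers x -> integers y -> integers (x * y).
Proof. by rewrite !integersP; apply: integral_mul. Qed.

Lemma integers1 : integers (1 : E).
Proof. by rewrite integersP; apply: integral1. Qed.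

Lemma integersX x k : integers x -> integers (x ^+ k).
Proof.
move=> hx; elim: k => [|k IH]; first exact: integers1.
by rewrite exprS; apply: integersM.
Qed.

Lemma minPoly_lift x : exists q : {poly Qp},
  [/\ q \is monic, irreducible_poly q & root (map_poly (in_alg E) q) x].
Proof.
have /polyOver1P[q e] := minPolyOver 1 x.
have qm : q \is monic by rewrite -(map_monic (in_alg E)) -e monic_minPoly.
exists q; split => //; last by rewrite -e root_minPoly.
split; first by rewrite -(size_map_poly (in_alg E)) -e size_minPoly ltnS lt0n.
move=> d sd dq; have := @minPoly_irr _ _ 1%AS x (map_poly (in_alg E) d).
rewrite e dvdp_map dq => /(_ _ isT); rewrite alg_polyOver => /(_ isT).
rewrite -(rmorph1 (map_poly (in_alg E))) !eqp_map => /orP[//|].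
by move=> /eqp_size; rewrite size_poly1 => h; rewrite h in sd.
Qed.

Lemma integers_or_inv x : integers x \/ integers x^-1.
Proof.
have [->|x0] := eqVneq x 0.
  by left; rewrite -(subrr 1); apply: integersB; exact: integers1.
have [q [qm qi qx]] := minPoly_lift x.
have pgeq := irreducible_pge (@v0_complete _ p_prime Qp) qi.
have q1 : lead_coef q = 1 by apply/eqP.
have [h|/vgeV[m m0 hm]] := boolP (vge v0 0 q`_0).
  left; exists q; split => // i; rewrite -(vge0_padic p_prime).
  by apply: (pgeq 0) => //; rewrite q1 vge1.
have {pgeq} hq : pge v0 m q.
  by apply: pgeq; rewrite ?(veq_vge hm) // q1 (vge_le (vge1 _)) // ltW.
right; have c0 := veq_neq0 hm; pose n := (size q).-1.
have szq : size q = n.+1 by rewrite prednK // size_poly_gt0 monic_neq0.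
(* The reversed polynomial, made monic. *)
pose r := \poly_(i < n.+1) ((q`_0)^-1 * q`_(n - i)).
have rn : r`_n = 1 by rewrite coef_poly ltnSn subnn mulVf.
have szr : size r = n.+1.
  apply/eqP; rewrite eqn_leq size_poly ltnNge; apply/negP => /leq_sizeP/(_ n (leqnn _)).
  by rewrite rn => /eqP; rewrite oner_eq0.
exists r; split.
- by rewrite monicE lead_coefE szr /= rn.
- move=> i; rewrite coef_poly -(vge0_padic p_prime); case: ifP => _; last exact: vge_0.
  by rewrite -(addNr m) vgeM // veq_vge // veqV.
have xV i : (i <= n)%N -> x^-1 ^+ i = x^-1 ^+ n * x ^+ (n - i).
  move=> ni.
  rewrite !exprVn -{1}(subnKC ni) exprD invfM -mulrA mulVf ?mulr1 //.
  by rewrite expf_neq0.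
move: qx; rewrite !rootE (@horner_coef_wide _ n.+1); last by rewrite size_map_poly szq.
rewrite (@horner_coef_wide _ n.+1); last by rewrite size_map_poly szr.
move/eqP => qx; suff -> : \sum_(i < n.+1) (map_poly (in_alg E) r)`_i * x^-1 ^+ i =
    (in_alg E (q`_0)^-1 * x^-1 ^+ n) * \sum_(i < n.+1) (map_poly (in_alg E) q)`_i * x ^+ i.
  by rewrite qx mulr0.
rewrite mulr_sumr (reindex_inj rev_ord_inj); apply: eq_bigr => i _.
have ni : (i <= n)%N by rewrite -ltnS.
rewrite !coef_map coef_poly /= subSS ltnS leq_subr subKn // xV ?leq_subr // subKn //.
by rewrite -!in_algE rmorphM /=; ring.
Qed.


Lemma integers0 : integers (0 : E).
Proof. by rewrite -(subrr 1); apply: integersB; exact: integers1. Qed.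

Lemma integersN x : integers x -> integers (- x).
Proof. by move=> hx; rewrite -sub0r; apply: integersB => //; exact: integers0. Qed.

Lemma integersD x y : integers x -> integers y -> integers (x + y).
Proof. by move=> hx /integersN hy; rewrite -[y]opprK; apply: integersB. Qed.

Lemma integers_alg (c : Qp) : integers (in_alg E c) <-> vge v0 0 c.
Proof.
split=> [[q [qm qi]]|hc].
  rewrite fmorph_root => qc; apply: (vring_int_closed qm) qc => i.
  by rewrite vge0_padic.
apply/integersP.
rewrite -(insubdK (0 : vint v0) (hc : c \in vring v0)).
exact: (integral_id vint_alg).
Qed.

Lemma integers_root x n : integers (x ^+ n.+1) -> integers x.
Proof.
move=> hn; have [//|hV] := integers_or_inv x.
have [->|x0] := eqVneq x 0; first exact: integers0.
have -> : x = x ^+ n.+1 * x^-1 ^+ n by rewrite exprS -mulrA -exprMn divff // expr1n mulr1.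
by apply: integersM => //; apply: integersX.
Qed.

(* [assoc x y] means that x and y have the same value in the value group
   [E^* / integers^*] of the valuation ring. *)
Definition assoc x y := integers (x / y) /\ integers (y / x).

Lemma assocM x y x' y' : assoc x x' -> assoc y y' -> assoc (x * y) (x' * y').
Proof.
by move=> [h1 h2] [h3 h4]; split; rewrite invfM mulrACA; apply: integersM.
Qed.

Lemma assocV x y : assoc x y -> assoc x^-1 y^-1.
Proof. by move=> [h1 h2]; split; rewrite invrK mulrC. Qed.

Lemma assocC x y : assoc x y -> assoc y x.
Proof. by case. Qed.

Lemma assoc_trans x y z : y != 0 -> assoc x y -> assoc y z -> assoc x z.
Proof.
move=> y0 [h1 h2] [h3 h4]; split.
  by rewrite -[x](divfK y0) -[X in integers X]mulrA; apply: integersM.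
by rewrite -[z](divfK y0) -[X in integers X]mulrA; apply: integersM.
Qed.

Lemma assoc_refl x : assoc x x.
Proof.
have [->|x0] := eqVneq x 0; first by split; rewrite mul0r; exact: integers0.
by split; rewrite divff //; exact: integers1.
Qed.

Lemma assocX x y k : assoc x y -> assoc (x ^+ k) (y ^+ k).
Proof.
move=> h; elim: k => [|k IH]; first by rewrite !expr0; exact: assoc_refl.
by rewrite !exprS; apply: assocM.
Qed.

Let P : E := in_alg E p%:R.

Let P0 : P != 0.
Proof. by rewrite fmorph_eq0 (veq_neq0 (v0_p p_prime Qp)). Qed.

Lemma assoc_p (m n : int) : assoc (P ^ m) (P ^ n) -> m = n.
Proof.
have key (k : int) : integers (P ^ k) -> 0 <= k.
  rewrite /P -rmorphXz ?unitfE ?(veq_neq0 (v0_p p_prime Qp)) // integers_alg.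
  by rewrite (veq_vge_le _ (veq_piz k (v0_p p_prime Qp))).
have e a b : P ^ (a - b) = P ^ a / P ^ b by rewrite expfzDr // invr_expz.
rewrite /assoc -!e => -[h1 h2].
have k1 := key _ h1; have k2 := key _ h2; rewrite !subr_ge0 in k1 k2.
by apply/eqP; rewrite eq_le k1 k2.
Qed.

Lemma assoc_alg (c : Qp) : c != 0 -> assoc (in_alg E c) (P ^ (v0 c)).
Proof.
move=> c0; have h := veq_dv v0 c0; have hp := veq_piz (v0 c) (v0_p p_prime Qp).
rewrite /assoc /P -rmorphXz ?unitfE ?(veq_neq0 (v0_p p_prime Qp)) //.
rewrite -!fmorphV -!rmorphM !integers_alg; split.
  by rewrite -(subrr (v0 c)) veq_vge // veqM // veqV.
by rewrite -(subrr (v0 c)) veq_vge // veqM // veqV.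
Qed.

(** Divisibility is total in a valuation ring, so a finite list has an element of least value. It
    serves to normalise a linear relation. *)
Lemma integers_max (s : seq E) : has (predC1 0) s ->
  exists y, [/\ y \in s, y != 0 & forall z, z \in s -> integers (z / y)].
Proof.
elim: s => //= x s IH.
have [/IH[y [ys y0 hy]] _|hs] := boolP (has (predC1 0) s).
  have [h|h] := integers_or_inv (x / y).
    exists y; rewrite inE ys orbT; split => // z; rewrite inE => /orP[/eqP->//|].
    exact: hy.
  have [x0|x0] := eqVneq x 0.
    exists y; rewrite inE ys orbT; split => // z; rewrite inE => /orP[/eqP->|].
      by rewrite x0 mul0r; exact: integers0.
    exact: hy.
  exists x; rewrite inE eqxx; split => // z; rewrite inE => /orP[/eqP->|zs].
    by rewrite divff //; exact: integers1.
  rewrite -[z](divfK y0) -[X in integers X]mulrA; apply: integersM; first exact: hy.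
  by rewrite invfM invrK mulrC in h.
rewrite orbF => x0; exists x; rewrite inE eqxx; split => // z.
rewrite inE => /orP[/eqP->|zs]; first by rewrite divff //; exact: integers1.
suff -> : z = 0 by rewrite mul0r; exact: integers0.
by apply/eqP; have /hasPn/(_ z zs) := hs; rewrite negbK.
Qed.

Lemma maximal_idealD x y :
  maximal_ideal x -> maximal_ideal y -> maximal_ideal (x + y).
Proof.
have key (a b : E) : maximal_ideal a -> maximal_ideal b -> integers (a / b) ->
    maximal_ideal (a + b).
  move=> [ha na] [hb nb] hab; split; first exact: integersD.
  have [b0|b0] := eqVneq b 0; first by rewrite b0 addr0.
  move=> [c hc e]; apply: nb; exists (c * (a / b + 1)); last by rewrite -[RHS]e; field.
  by apply: integersM => //; apply: integersD => //; exact: integers1.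
move=> hx hy; have [h|h] := integers_or_inv (x / y); first exact: key.
by rewrite addrC; apply: key => //; rewrite invfM invrK mulrC in h.
Qed.

Lemma maximal_ideal_sum (I : Type) (r : seq I) (Q : pred I) (f : I -> E) :
  (forall i, Q i -> maximal_ideal (f i)) -> maximal_ideal (\sum_(i <- r | Q i) f i).
Proof.
move=> h; apply: (big_ind (@maximal_ideal p Qp E)) => //; last exact: maximal_idealD.
split; first exact: integers0.
by move=> [y _ /eqP]; rewrite mul0r eq_sym oner_eq0.
Qed.

(* In a linear relation among powers of [x], two nonzero terms must share the
   same value. *)
Lemma assoc_power x : x != 0 -> exists m, assoc (x ^+ (\dim {:E})`!) (P ^ m).
Proof.
move=> x0.
have /polyOver1P[q eq] := minPolyOver 1 x.
have qm : q \is monic by rewrite -(map_monic (in_alg E)) -eq monic_minPoly.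
have qx : root (map_poly (in_alg E) q) x by rewrite -eq root_minPoly.
have szq : (size q <= (\dim {:E}).+1)%N.
  rewrite -(size_map_poly (in_alg E)) -eq size_minPoly ltnS.
  rewrite /adjoin_degree dimv1 divn1 prednK ?adim_gt0 //.
  exact: dimvS (subvf _).
pose f i := in_alg E q`_i * x ^+ i.
have sum0 : \sum_(i < size q) f i = 0.
  move: qx; rewrite rootE (@horner_coef_wide _ (size q)) ?size_map_poly //.
  by move=> /eqP h; rewrite -[RHS]h; apply: eq_bigr => i _; rewrite coef_map.
have q0 : (0 < size q)%N by rewrite size_poly_gt0 monic_neq0.
have f0 i : (f i != 0) = (q`_i != 0).
  by rewrite mulf_eq0 fmorph_eq0 expf_eq0 (negPf x0) andbF orbF.
have [|y [/mapP[i0 _ ey] y0 hy]] := @integers_max [seq f (nat_of_ord i) | i <- enum 'I_(size q)].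
  apply/hasP; exists (f (Ordinal (ltac:(by rewrite prednK) : ((size q).-1 < size q)%N))).
    by apply: map_f; rewrite mem_enum.
  by rewrite /= f0 -lead_coefE (monicP qm) oner_neq0.
have int_f (i : 'I_(size q)) : integers (f i / f i0).
  rewrite -ey; apply: hy.
  by apply: (map_f (fun i : 'I_(size q) => f i)); rewrite mem_enum.
(* If no other term shared the value of [f i0], dividing the relation by [f i0] would write the unit
   [-1] as a sum of elements of the maximal ideal. *)
have [i ii0 [fi hi]] : exists2 i : 'I_(size q), i != i0 & f i != 0 /\ assoc (f i) (f i0).
  apply: contrapT => hn.
  have [hM] : maximal_ideal (\sum_(i < size q | i != i0) f i / f i0).
    apply: maximal_ideal_sum => i ii0; split => // -[z hz e].
    apply: hn; exists i => //.
    have fi : f i != 0.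
      by apply/eqP => fi; move/eqP: e; rewrite fi !mul0r eq_sym oner_eq0.
    split => //; split; first exact: int_f.
    suff -> : f i0 / f i = z by [].
    apply: (mulfI fi); rewrite mulrC divfK //; move: e; rewrite -ey => e.
    by apply: (mulIf (invr_neq0 y0)); rewrite divff // -e; ring.
  case; exists (-1); first by apply: integersN; exact: integers1.
  have y0' : f i0 != 0 by rewrite -ey.
  rewrite mulrN1 -mulr_suml; apply: (mulIf y0'); rewrite mulNr divfK // mul1r.
  by apply/eqP; rewrite eqr_oppLR -addr_eq0 addrC; move: sum0; rewrite (bigD1 i0) //= => ->.
(* Two associated terms give [x ^ (l - k)] the value of [q]_k / q[_l], which lies in Q_p and so has
   the value of a power of [p]. *)
have key (k l : nat) : (k < l)%N -> f k != 0 -> f l != 0 -> assoc (f k) (f l) ->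
    exists m, assoc (x ^+ (l - k)) (P ^ m).
  move=> kl fk fl h.
  have qk : in_alg E q`_k != 0 by rewrite fmorph_eq0 -f0.
  have ql : in_alg E q`_l != 0 by rewrite fmorph_eq0 -f0.
  have qkl : q`_k / q`_l != 0 by rewrite mulf_neq0 ?invr_eq0 -?f0.
  exists (v0 (q`_k / q`_l)).
  apply: assoc_trans (assoc_alg qkl); first by rewrite fmorph_eq0.
  have -> : x ^+ (l - k) = x ^+ l / x ^+ k.
    by rewrite -[in RHS](subnK (ltnW kl)) exprD mulfK // expf_neq0.
  have -> : x ^+ l / x ^+ k = f l / f k * (in_alg E q`_k / in_alg E q`_l).
    by rewrite /f; field; rewrite expf_neq0 // qk ql.
  rewrite rmorphM fmorphV -[X in assoc _ X]mul1r; apply: assocM; last exact: assoc_refl.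
  by rewrite -(divff fk); apply: assocM; [apply: assocC|apply: assoc_refl].
have [d [dpos dle [m hm]]] : exists d, [/\ (0 < d)%N, (d <= \dim {:E})%N &
    exists m, assoc (x ^+ d) (P ^ m)].
  have lt_sz (k : 'I_(size q)) : (k <= \dim {:E})%N.
    by rewrite -ltnS; apply: leq_trans szq.
  case: (ltngtP i i0) => [h|h|/val_inj e]; last by rewrite e eqxx in ii0.
    exists (i0 - i)%N; rewrite subn_gt0 h; split => //; last by apply: key => //; rewrite -ey.
    exact: leq_trans (leq_subr _ _) (lt_sz i0).
  exists (i - i0)%N; rewrite subn_gt0 h; split => //.
    exact: leq_trans (leq_subr _ _) (lt_sz i).
  by apply: key => //; [rewrite -ey|apply: assocC].
(* The exponent [d] depends on [x]; since it is at most the degree, the factorial serves for all [x]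
   at once. *)
have /dvdnP[k ->] : (d %| (\dim {:E})`!)%N by apply: dvdn_fact; rewrite dpos.
exists (m * k); rewrite mulnC exprM -exprz_exp -exprnP.
exact: assocX.
Qed.


Let P_neq0 (m : int) : P ^ m != 0.
Proof. exact: expfz_neq0. Qed.

Let N := (\dim {:E})`!.

(** [N] times the extension to [E] of the p-adic valuation. The choice of [N] makes it integral, but
    1 need not be among its values. *)
Definition raw_val x : int := xget 0 [set m | assoc (x ^+ N) (P ^ m)].

Lemma raw_valE x : x != 0 -> assoc (x ^+ N) (P ^ raw_val x).
Proof. by move=> /assoc_power; apply: xgetPex. Qed.

Lemma raw_val_uniq x m : x != 0 -> assoc (x ^+ N) (P ^ m) -> raw_val x = m.
Proof.
move=> x0 h; apply: assoc_p; apply: assoc_trans h; first by rewrite expf_neq0.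
exact/assocC/raw_valE.
Qed.

Lemma raw_valM x y : x != 0 -> y != 0 -> raw_val (x * y) = raw_val x + raw_val y.
Proof.
move=> x0 y0; apply: raw_val_uniq; first by rewrite mulf_neq0.
by rewrite exprMn expfzDr //; apply: assocM; apply: raw_valE.
Qed.

Lemma raw_val1 : raw_val 1 = 0.
Proof.
by apply: raw_val_uniq; rewrite ?oner_neq0 // expr1n expr0z; exact: assoc_refl.
Qed.

Lemma raw_valV x : x != 0 -> raw_val x^-1 = - raw_val x.
Proof.
move=> x0; apply: raw_val_uniq; first by rewrite invr_eq0.
by rewrite exprVn -invr_expz; apply/assocV/raw_valE.
Qed.

Lemma raw_val_ge0 x : x != 0 -> 0 <= raw_val x <-> integers x.
Proof.
move=> x0; have [h1 h2] := raw_valE x0.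
have Pint (k : nat) : integers (P ^ k%:Z).
  rewrite -exprnP; apply: integersX; apply/integers_alg.
  exact: v0_nat.
split=> [|hx].
  case e : (raw_val x) => [k|//] _; rewrite e in h1.
  have : integers (x ^+ N) by rewrite -(divfK (P_neq0 k) (x ^+ N)); apply: integersM.
  by rewrite /N -(prednK (fact_gt0 _)); apply: integers_root.
rewrite leNgt; apply/negP => neg.
have : integers (P ^ raw_val x).
  by rewrite -(divfK (expf_neq0 N x0) (P ^ raw_val x)); apply: integersM => //; apply: integersX.
rewrite /P -rmorphXz ?unitfE ?(veq_neq0 (v0_p p_prime Qp)) // integers_alg.
by rewrite (veq_vge_le _ (veq_piz _ (v0_p p_prime Qp))) leNgt neg.
Qed.

Lemma raw_valD x y : x != 0 -> y != 0 -> x + y != 0 ->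
  Num.min (raw_val x) (raw_val y) <= raw_val (x + y).
Proof.
have key (a b : E) : a != 0 -> b != 0 -> a + b != 0 -> raw_val a <= raw_val b ->
    raw_val a <= raw_val (a + b).
  move=> a0 b0 ab0; rewrite -subr_ge0 -raw_valV // -raw_valM ?invr_eq0 //.
  rewrite raw_val_ge0 ?mulf_neq0 ?invr_eq0 // => h.
  rewrite -subr_ge0 -raw_valV // -raw_valM ?invr_eq0 //.
  rewrite raw_val_ge0 ?mulf_neq0 ?invr_eq0 // mulrDl divff //.
  by apply: integersD => //; exact: integers1.
move=> x0 y0 xy0; rewrite ge_min; case: (leP (raw_val x) (raw_val y)) => h.
  by rewrite key.
by rewrite addrC [X in _ || X]key ?orbT // 1?addrC // ltW.
Qed.

Lemma raw_val_P : raw_val P = N.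
Proof. by apply: raw_val_uniq; rewrite -?exprnP //; exact: assoc_refl. Qed.

(** The least positive value [d] generates the value group, by Euclidean division; dividing
    [raw_val] by [d] then normalises it. *)
Lemma ex_val_step : exists d : nat, [/\ (0 < d)%N, exists2 u, u != 0 & raw_val u = d%:Z &
  forall x, x != 0 -> (d%:Z %| raw_val x)%Z].
Proof.
pose Q d := `[< (0 < d)%N /\ exists2 u, u != 0 & raw_val u = d%:Z >].
have exQ : exists d, Q d.
  by exists N; apply/asboolP; rewrite fact_gt0; split => //; exists P => //; rewrite raw_val_P.
case: (ex_minnP exQ) => d /asboolP[d0 [u u0 hu]] dmin; exists d; split => //.
  by exists u.
have raw_valXz k : raw_val (u ^ k) = k * d%:Z.
  have raw_valX j : raw_val (u ^+ j) = j%:Z * d%:Z.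
    elim: j => [|j IH]; first by rewrite expr0 raw_val1 mul0r.
    by rewrite exprS raw_valM ?expf_neq0 // IH hu intS mulrDl mul1r.
  case: k => k; first by rewrite -exprnP raw_valX.
  by rewrite NegzE -exprnN raw_valV ?expf_neq0 // raw_valX mulNr.
move=> x x0; apply/dvdz_mod0P; pose r := (raw_val x %% d%:Z)%Z.
have dz : d%:Z != 0 by rewrite eqz_nat -lt0n.
have r0 : 0 <= r by rewrite modz_ge0.
have rd : r < d%:Z by rewrite ltz_pmod.
have hr : raw_val (x * u ^ (- (raw_val x %/ d%:Z)%Z)) = r.
  by rewrite raw_valM ?expfz_neq0 // raw_valXz {1}(divz_eq (raw_val x) d) mulNr addrAC subrr add0r.
move: r0 rd hr; rewrite -/r; case: r => [k|//] _ kd hr; rewrite ltz_nat in kd.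
have [->//|k0] := posnP k.
have : (d <= k)%N.
  apply: dmin; apply/asboolP; split => //; eexists; last exact: hr.
  by rewrite mulf_neq0 ?expfz_neq0.
by rewrite leqNgt kd.
Qed.

Theorem ex_valuation : exists v : dval E, forall x, integers x <-> vge v 0 x.
Proof.
have [d [d0 [u u0 hu] hd]] := ex_val_step.
have dz : d%:Z != 0 by rewrite eqz_nat -lt0n.
have hE x : x != 0 -> raw_val x = (raw_val x %/ d%:Z)%Z * d%:Z.
  by move=> /hd; rewrite dvdz_eq => /eqP ->.
have dpos : (0 : int) < d%:Z by rewrite ltz_nat.
have vM x y : x != 0 -> y != 0 ->
    (raw_val (x * y) %/ d%:Z)%Z = (raw_val x %/ d%:Z)%Z + (raw_val y %/ d%:Z)%Z.
  by move=> x0 y0; apply: (mulIf dz); rewrite mulrDl -!hE ?mulf_neq0 // raw_valM.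
have vD x y : x != 0 -> y != 0 -> x + y != 0 ->
    Num.min (raw_val x %/ d%:Z)%Z (raw_val y %/ d%:Z)%Z <= (raw_val (x + y) %/ d%:Z)%Z.
  move=> x0 y0 xy0; rewrite ge_min -(ler_pM2r dpos (raw_val x %/ d%:Z)%Z).
  rewrite -(ler_pM2r dpos (raw_val y %/ d%:Z)%Z) -!hE //.
  by have := raw_valD x0 y0 xy0; rewrite ge_min.
have vU : exists2 u, u != 0 & (raw_val u %/ d%:Z)%Z = 1.
  by exists u => //; rewrite hu divzz dz.
exists (@DVal _ (Valuation vM vD) vU) => x; rewrite /vge /=.
have [->|x0] /= := eqVneq x 0; first by split => // _; exact: integers0.
by rewrite -raw_val_ge0 // {1}hE // pmulr_lge0.
Qed.

End Integers.

(** * Residue field and ramification *)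

Section Dimension.
Variables (K : fieldType) (V : vectType K) (I : finType) (g : I -> V).

Let X := [tuple g (enum_val i) | i < #|I|].

Let sumX (k : I -> K) : \sum_(i < #|I|) k (enum_val i) *: X`_i = \sum_i k i *: g i.
Proof.
rewrite [RHS](reindex (@enum_val I I)) /=; last first.
  by exists enum_rank => i _; rewrite ?enum_valK ?enum_rankK.
apply: eq_bigr => i _; rewrite (_ : X`_i = g (enum_val i)) //.
by rewrite -tnth_nth tnth_mktuple.
Qed.

Lemma card_le_dim : (forall k : I -> K, \sum_i k i *: g i = 0 -> forall i, k i = 0) ->
  (#|I| <= \dim {:V})%N.
Proof.
move=> h; suff /eqP e : free X.
  by apply: leq_trans (dimvS (subvf <<X>>)); rewrite e size_tuple.
apply/freeP => k hk i; have := h (fun j => k (enum_rank j)).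
rewrite -sumX => /(_ _ (enum_val i)); rewrite enum_valK; apply.
by rewrite -[RHS]hk; apply: eq_bigr => j _; rewrite enum_valK.
Qed.

Lemma dim_le_card : (forall x, exists k : I -> K, x = \sum_i k i *: g i) ->
  (\dim {:V} <= #|I|)%N.
Proof.
move=> h; rewrite -(size_tuple X); apply: leq_trans (dim_span X).
apply: dimvS; apply/subvP => x _; have [k ->] := h x.
rewrite -sumX; apply: memv_suml => i _; apply: memvZ; apply: memv_span.
by rewrite mem_nth // size_tuple.
Qed.

End Dimension.

Section Invariants.
Variables (p : nat) (p_prime : prime p) (Qp : padicNumbers p).
Variables (E : fieldExtType Qp) (v : dval E).
Hypothesis vE : forall x : E, integers x <-> vge v 0 x.
Let v0 := padic_dval p_prime Qp.
Implicit Types x y : E.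

Lemma maximal_idealP x : maximal_ideal x <-> vge v 1 x.
Proof.
split=> [[/vE hx nx]|hx].
  rewrite -[1]add0r; apply: vge_veq => //; apply/negP => h; apply: nx.
  exists x^-1; last by rewrite divff // (veq_neq0 h).
  by rewrite vE veq_vge // -oppr0 veqV.
split; first by rewrite vE (vge_le hx).
move=> [y /vE hy xy]; have := vgeM hx hy.
by rewrite xy addr0 (veq_vge_le _ (veq1 v)).
Qed.

Lemma principal_idealP n x y : veq v n x -> principal_ideal x y <-> vge v n y.
Proof.
move=> hx; have x0 := veq_neq0 hx; split=> [[z /vE hz <-]|hy].
  by rewrite -[n]addr0 vgeM // veq_vge.
exists (y / x); last by rewrite mulrC divfK.
by rewrite vE -(subrr n) vgeM // veq_vge // veqV.
Qed.

Lemma principal_ideal_eq x y : x != 0 ->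
  principal_ideal x = principal_ideal y -> veq v (v x) y.
Proof.
move=> x0 e; have hx := veq_dv v x0.
have : principal_ideal y x.
  by rewrite -e; apply/(principal_idealP _ hx)/veq_vge.
move=> [z /vE hz xyz].
have y0 : y != 0 by apply: contraNneq x0 => y0; rewrite -xyz y0 mul0r.
have hy := veq_dv v y0.
have h1 : vge v (v y) x.
  by apply/(principal_idealP _ hy); rewrite -e; apply/(principal_idealP _ hx)/veq_vge.
have h2 : vge v (v x) y.
  by apply/(principal_idealP _ hx); rewrite e; apply/(principal_idealP _ hy)/veq_vge.
rewrite (veq_vge_le _ hx) in h1; rewrite (veq_vge_le _ hy) in h2.
by apply/veqP; split => //; apply/eqP; rewrite eq_le h1 h2.
Qed.

Lemma principal_ideal_congr n x y : veq v n x -> veq v n y ->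
  principal_ideal x = principal_ideal y.
Proof.
move=> hx hy; apply/seteqP; split=> z.
  by move=> /(principal_idealP _ hx) h; apply/(principal_idealP _ hy).
by move=> /(principal_idealP _ hy) h; apply/(principal_idealP _ hx).
Qed.

Lemma uniformizerP x : uniformizer x <-> veq v 1 x.
Proof.
have mE : @maximal_ideal p Qp E = principal_ideal (dval_pi v).
  apply/seteqP; split=> z.
    by move=> /maximal_idealP h; apply/(principal_idealP _ (veq_pi v)).
  by move=> /(principal_idealP _ (veq_pi v)) h; apply/maximal_idealP.
have [_ pi1] := veqP _ _ _ (veq_pi v).
rewrite /uniformizer mE; split=> [/(principal_ideal_eq (pi_neq0 v))|h].
  by rewrite pi1.
exact: principal_ideal_congr (veq_pi v) h.
Qed.

Lemma generates_powerP x (e : nat) : generates_power x e <-> veq v e%:Z x.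
Proof.
split=> [[u /uniformizerP hu]|hx].
  have /(veqX e) := hu; rewrite mulr1 => /veqP[ue h] /esym.
  by move/(principal_ideal_eq ue); rewrite h.
exists (dval_pi v); first by apply/uniformizerP/veq_pi.
by apply: principal_ideal_congr hx _; rewrite -[e%:Z]mulr1; apply/veqX/veq_pi.
Qed.

Lemma nat_alg k : in_alg E k%:R = k%:R.
Proof. exact: rmorph_nat. Qed.

Lemma v_nat k : vge v 0 (k%:R : E).
Proof. exact/vge_nat/vge1. Qed.

Lemma v_alg_ge0 (c : Qp) : vge v0 0 c -> vge v 0 (in_alg E c).
Proof. by move=> /(integers_alg p_prime E)/vE. Qed.

Lemma v_alg0 (c : Qp) : veq v0 0 c -> veq v 0 (in_alg E c).
Proof.
move=> hc; have h1 := v_alg_ge0 (veq_vge hc).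
have := v_alg_ge0 (veq_vge (veqV hc)).
have c0 : in_alg E c != 0 by rewrite fmorph_eq0 (veq_neq0 hc).
rewrite fmorphV => h2; apply/veqP; split => //.
have h3 := veq_dv v c0; have h4 := veqV h3.
rewrite (veq_vge_le _ h3) in h1; rewrite (veq_vge_le _ h4) oppr_ge0 in h2.
by apply/eqP; rewrite eq_le h1 h2.
Qed.

Lemma p_neq0 : (p%:R : E) != 0.
Proof. by rewrite -nat_alg fmorph_eq0 (veq_neq0 (v0_p p_prime Qp)). Qed.

Lemma vge1_p : vge v 1 (p%:R : E).
Proof.
apply: contraT => h.
have : veq v 0 (p%:R : E).
  by apply: contraT => h0; case/negP: h; rewrite -[X in vge v X _]add0r vge_veq ?v_nat.
move=> /veqV; rewrite oppr0 => /veq_vge/vE; rewrite -nat_alg -fmorphV.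
move/(integers_alg p_prime E).
by rewrite (veq_vge_le _ (veqV (v0_p p_prime Qp))).
Qed.

Lemma ex_ramification : exists2 e : nat, (0 < e)%N & veq v e%:Z (p%:R : E).
Proof.
have h := veq_dv v p_neq0; have := vge1_p; rewrite (veq_vge_le _ h).
by case e: (v _) => [k|//] k1; rewrite e in h; exists k.
Qed.

Lemma abs_ramification_indexP : (0 < abs_ramification_index E)%N /\
  veq v (abs_ramification_index E)%:Z (p%:R : E).
Proof.
have [e e0 he] := ex_ramification.
have h : veq v (abs_ramification_index E)%:Z (p%:R : E).
  by apply/generates_powerP; apply: xgetPex; exists e; apply/generates_powerP.
by split => //; rewrite -ltz_nat (veq_uniq h he) ltz_nat.
Qed.

Lemma v_alg (c : Qp) n : veq v0 n c ->
  veq v ((abs_ramification_index E)%:Z * n) (in_alg E c).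
Proof.
move=> hc; have [_ he] := abs_ramification_indexP.
have pn := veq_piz n (v0_p p_prime Qp).
have h : veq v0 0 (c / p%:R ^ n) by rewrite -(subrr n); apply: veqM hc (veqV pn).
have -> : in_alg E c = in_alg E (c / p%:R ^ n) * p%:R ^ n.
  rewrite -nat_alg -rmorphXz ?unitfE ?(veq_neq0 (v0_p p_prime Qp)) // -rmorphM.
  by rewrite divfK // (veq_neq0 pn).
rewrite -[_ * n]add0r; apply: veqM; last by rewrite mulrC; exact: veqXz.
exact: v_alg0.
Qed.


Lemma vge1_nat k : vge v 1 (k%:R : E) = (p %| k)%N.
Proof.
have [/dvdnP[m ->]|pk] := boolP (p %| k)%N.
  by rewrite natrM -[1]add0r vgeM ?v_nat ?vge1_p.
have := v_alg0 (v0_nat_unit p_prime Qp pk); rewrite nat_alg => h.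
by rewrite (veq_vge_le _ h).
Qed.

Lemma vge1_modn k : vge v 1 (k%:R - (k %% p)%:R : E).
Proof.
rewrite {1}(divn_eq k p) natrD addrK natrM -[1]add0r vgeM ?v_nat ?vge1_p //.
Qed.

Lemma modn_inv k : ~~ (p %| k)%N -> exists d, vge v 1 ((d * k)%:R - 1 : E).
Proof.
move=> pk; have k0 : (0 < k)%N by rewrite lt0n; apply: contraNneq pk => ->.
have [d m e _] := egcdnP p k0.
have g1 : gcdn k p = 1%N by apply/eqP; rewrite -/(coprime _ _) coprime_sym prime_coprime.
exists d; rewrite e g1 natrD addrK natrM -[1]add0r vgeM ?v_nat ?vge1_p //.
Qed.

(** Linear independence over F_p of the residue classes, with natural numbers in place of elements
    of F_p so that no quotient ring is formed. *)
Definition residue_indep (n : nat) (b : 'I_n -> E) :=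
  (forall i, vge v 0 (b i)) /\
  forall c : 'I_n -> nat, vge v 1 (\sum_i (c i)%:R * b i) -> forall i, (p %| c i)%N.

(** Divide by a coefficient of least valuation: the coefficients become integral and one of them is
    1. A sum of positive valuation would then reduce to a nontrivial relation modulo [p]. *)
Lemma residue_indep_veq n (b : 'I_n -> E) (k : 'I_n -> Qp) :
  residue_indep b -> (exists i, k i != 0) ->
  exists m, veq v ((abs_ramification_index E)%:Z * m) (\sum_i k i *: b i).
Proof.
move=> [hb ind] [i0 ki0].
case: (@Order.TotalTheory.arg_minP _ int 'I_n i0 (fun i => k i != 0)
  (fun i => v0 (k i)) ki0) => j kj hmin.
pose k' i := k i / k j.
have hk' i : vge v0 0 (k' i).
  rewrite /k' -(subrr (v0 (k j))) vgeM //; last by rewrite veq_vge // veqV // veq_dv.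
  by apply/vgeP => ki; exact: hmin.
pose c i := projT1 (cid2 (v0_residue (hk' i))).
have hc i : vge v0 1 (k' i - (c i)%:R) by rewrite /c; case: cid2.
have hc' i : vge v 1 (in_alg E (k' i) - (c i)%:R).
  rewrite -nat_alg -rmorphB; have [->|h0] := eqVneq (k' i - (c i)%:R) 0.
    by rewrite rmorph0 vge_0.
  have [e0 _] := abs_ramification_indexP.
  have := hc i; have h := veq_dv v0 h0; rewrite (veq_vge_le _ h).
  move=> h1; apply: vge_le (veq_vge (v_alg h)) _.
  by rewrite -[1]mul1r ler_pM.
exists (v0 (k j)).
have -> : \sum_i k i *: b i = in_alg E (k j) * \sum_i in_alg E (k' i) * b i.
  rewrite mulr_sumr; apply: eq_bigr => i _.
  by rewrite mulrA -rmorphM [k j * _]mulrC divfK // mulr_algl.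
rewrite -[X in veq _ X]addr0; apply: veqM; first exact/v_alg/veq_dv.
have h0 : vge v 0 (\sum_i in_alg E (k' i) * b i).
  by apply: vge_sum => i _; apply: vge0M => //; apply: v_alg_ge0.
apply: contraT => /(vge_veq h0); rewrite add0r => h1.
have /ind/(_ j) : vge v 1 (\sum_i (c i)%:R * b i).
  rewrite -[X in vge _ _ X](subKr (\sum_i in_alg E (k' i) * b i)) vgeB // -sumrB.
  by apply: vge_sum => i _; rewrite -mulrBl -[1]addr0 vgeM.
rewrite -vge1_nat => cj; have := vgeD (hc' j) cj.
rewrite subrK /k' divff // rmorph1.
by rewrite (veq_vge_le _ (veq1 v)).
Qed.

Lemma residue_indep_dim n b : @residue_indep n b -> (n <= \dim {:E})%N.
Proof.
move=> ind; rewrite -[n]card_ord; apply: (@card_le_dim _ _ _ b) => k hk.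
apply: contrapT => /existsNP[i0 /eqP ki0].
have [m] := residue_indep_veq ind (ex_intro _ i0 ki0).
by rewrite hk => /veq_neq0; rewrite eqxx.
Qed.

(** Independent families have at most [\dim {:E}] members, so a longest one exists. Adjoining [x] to
    it creates a relation whose coefficient at [x] is prime to [p], hence invertible modulo [p]. *)
Lemma ex_residue_span : exists n b, @residue_indep n b /\
  forall x, vge v 0 x -> exists c : 'I_n -> nat, vge v 1 (x - \sum_i (c i)%:R * b i).
Proof.
have ex0 : exists n, `[< exists b, @residue_indep n b >].
  exists 0%N; apply/asboolP; exists (fun _ => 0).
  by split => [i|c _ [i]]; first exact: vge_0.
have bnd n : `[< exists b, @residue_indep n b >] -> (n <= \dim {:E})%N.
  by move=> /asboolP[b]; apply: residue_indep_dim.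
case: (ex_maxnP ex0 bnd) => n /asboolP[b [hb ind]] nmax.
exists n, b; split => // x hx.
pose b' (i : 'I_n.+1) := if unlift ord0 i is Some j then b j else x.
have b'0 : b' ord0 = x by rewrite /b' unlift_none.
have b'S j : b' (lift ord0 j) = b j by rewrite /b' liftK.
have : ~ residue_indep b'.
  move=> h; have /nmax : `[< exists b, @residue_indep n.+1 b >].
    by apply/asboolP; exists b'.
  by rewrite ltnn.
move=> hn; have /existsNP[c /not_implyP[hc /existsNP[i0 /negP pc]]] :
    ~ forall c : 'I_n.+1 -> nat, vge v 1 (\sum_i (c i)%:R * b' i) -> forall i, (p %| c i)%N.
  by move=> h; apply: hn; split => // i; rewrite /b'; case: unlift.
rewrite big_ord_recl b'0 in hc.
have {}hc : vge v 1 ((c ord0)%:R * x + \sum_i (c (lift ord0 i))%:R * b i).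
  by move: hc; congr (vge _ _ (_ + _)); apply: eq_bigr => i _; rewrite b'S.
have pc0 : ~~ (p %| c ord0)%N.
  apply/negP => h.
  have : vge v 1 (\sum_i (c (lift ord0 i))%:R * b i).
    rewrite -[X in vge _ _ X](addKr ((c ord0)%:R * x)) addrC vgeB //.
    by rewrite -[1]addr0 vgeM // vge1_nat.
  move=> /ind h1; move: pc; case: (unliftP ord0 i0) => [j ->|->]; last by rewrite h.
  by rewrite h1.
have [d hd] := modn_inv pc0.
(* Coefficients are natural numbers, so [p.-1] stands for [-1] modulo [p]. *)
exists (fun i => (p.-1 * (d * c (lift ord0 i)))%N).
have -> : x - \sum_i (p.-1 * (d * c (lift ord0 i)))%:R * b i =
   d%:R * ((c ord0)%:R * x + \sum_i (c (lift ord0 i))%:R * b i)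
   - ((d * c ord0)%:R - 1) * x - p%:R * (d%:R * \sum_i (c (lift ord0 i))%:R * b i).
  have -> : \sum_i (p.-1 * (d * c (lift ord0 i)))%:R * b i =
      (p%:R - 1) * (d%:R * \sum_i (c (lift ord0 i))%:R * b i).
    rewrite !mulr_sumr; apply: eq_bigr => i _.
    by rewrite !natrM -subn1 natrB ?prime_gt0 // !mulrA.
  rewrite natrM; ring.
have hs : vge v 0 (\sum_i (c (lift ord0 i))%:R * b i).
  by apply: vge_sum => i _; apply: vge0M => //; apply: v_nat.
apply: vgeB; first apply: vgeB.
- by rewrite -[1]add0r vgeM ?v_nat.
- by rewrite -[1]addr0 vgeM.
- by rewrite -[1]addr0 vgeM ?vge1_p // vge0M ?v_nat.
Qed.


Lemma residue_indep_eqmod n b (c c' : 'I_n -> nat) : residue_indep b ->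
  vge v 1 (\sum_i (c i)%:R * b i - \sum_i (c' i)%:R * b i) ->
  forall i, c i = c' i %[mod p].
Proof.
move=> [hb ind] h i.
have /(_ i) : forall i, (p %| c i + p.-1 * c' i)%N.
  apply: ind.
  have -> : \sum_i (c i + p.-1 * c' i)%:R * b i =
     \sum_i (c i)%:R * b i - \sum_i (c' i)%:R * b i + p%:R * \sum_i (c' i)%:R * b i.
    rewrite -sumrB mulr_sumr -big_split; apply: eq_bigr => j _ /=.
    rewrite natrD natrM -subn1 natrB ?prime_gt0 //; ring.
  rewrite vgeD // -[1]addr0 vgeM ?vge1_p // vge_sum // => j _.
  by rewrite vge0M ?v_nat.
move=> /dvdnP[k e]; rewrite -[LHS](modnMDl (c' i)) addnC.
have -> : (c i + c' i * p = (c i + p.-1 * c' i) + c' i)%N.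
  by rewrite -addnA -mulSnr (prednK (prime_gt0 p_prime)) mulnC.
by rewrite e modnMDl.
Qed.

Lemma residue_basis_span n (b : 'I_n -> E) x : residue_basis b -> vge v 0 x ->
  exists c : 'I_n -> nat, vge v 1 (x - \sum_i (c i)%:R * b i).
Proof.
move=> [_ h] /vE/h[c [/maximal_idealP hc _]].
by exists (fun i => nat_of_ord (c i)).
Qed.

Lemma residue_basis_indep n (b : 'I_n -> E) : residue_basis b -> residue_indep b.
Proof.
move=> [hb h]; split => [i|c hc i]; first exact/vE.
have [c0 [_ uniq]] := h 0 (integers0 p_prime E).
pose c1 : {ffun 'I_n -> 'F_p} := [ffun i => (c i)%:R].
have e1 : c0 = c1.
  apply: uniq; apply/maximal_idealP; rewrite sub0r vgeN.
  rewrite -[X in vge _ _ X](subKr (\sum_i (c i)%:R * b i)) vgeB // -sumrB.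
  rewrite vge_sum // => j _; rewrite -mulrBl -[1]addr0 vgeM //; last exact/vE.
  by rewrite ffunE val_Fp_nat // vge1_modn.
have e2 : c0 = [ffun => 0].
  apply: uniq; apply/maximal_idealP; rewrite sub0r vgeN big1 ?vge_0 // => j _.
  by rewrite ffunE mul0r.
have := congr1 (fun f : {ffun 'I_n -> 'F_p} => f i : nat) (etrans (esym e1) e2).
by rewrite !ffunE val_Fp_nat // => /eqP.
Qed.

Lemma ex_residue_basis : exists n (b : 'I_n -> E), residue_basis b.
Proof.
have [n [b [[hb ind] sp]]] := ex_residue_span.
exists n, b; split => [i|x /vE/sp[c hc]]; first exact/vE.
exists [ffun i => (c i)%:R]; split.
  apply/maximal_idealP; rewrite -(subrKA (\sum_i (c i)%:R * b i)) vgeD //.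
  rewrite -sumrB vge_sum // => j _; rewrite -mulrBl -[1]addr0 vgeM //.
  by rewrite ffunE val_Fp_nat // vge1_modn.
move=> c' /maximal_idealP hc'; apply/ffunP => i; apply/val_inj.
rewrite ffunE [LHS]val_Fp_nat //.
have -> : (c i = c' i %[mod p])%N.
  apply: (residue_indep_eqmod (b := b) (c' := fun i => nat_of_ord (c' i))) => //.
  by rewrite -[X in vge _ _ X](subrKA x) addrC vgeD // -opprB vgeN.
by rewrite modn_small // -[X in (_ < X)%N](Fp_cast p_prime).
Qed.

Lemma ex_abs_inertia_basis :
  exists b : 'I_(abs_inertia_degree E) -> E, residue_basis b.
Proof. exact: (@xgetPex _ _ [set f | exists b : 'I_f -> E, residue_basis b] ex_residue_basis). Qed.

Lemma residue_representatives :
  exists r : 'I_(p ^ abs_inertia_degree E) -> E, (forall i, vge v 0 (r i)) /\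
    forall x, vge v 0 x -> exists! i, vge v 1 (x - r i).
Proof.
have [b [hb h]] := ex_abs_inertia_basis; set f := abs_inertia_degree E in b hb h *.
have cardE : #|{ffun 'I_f -> 'F_p}| = (p ^ f)%N by rewrite card_ffun card_Fp // card_ord.
pose r (i : 'I_(p ^ f)) : E :=
  let c := enum_val (cast_ord (esym cardE) i) in \sum_j (c j : nat)%:R * b j.
exists r; split => [i|x /vE/h[c [hc uniq]]].
  by apply: vge_sum => j _; rewrite vge0M ?v_nat //; apply/vE.
exists (cast_ord cardE (enum_rank c)); split.
  by rewrite /r cast_ordK enum_rankK; apply/maximal_idealP.
move=> i /maximal_idealP hi; rewrite (uniq _ hi) enum_valK.
by apply/val_inj.
Qed.


Let e := abs_ramification_index E.
Let f := abs_inertia_degree E.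
Let pi := dval_pi v.

Let v_piX n : veq v n%:Z (pi ^+ n).
Proof. by rewrite -[n%:Z]mulr1; apply/veqX/veq_pi. Qed.

Lemma residue_digits (b : 'I_f -> E) x (m : nat) : residue_basis b -> vge v 0 x ->
  exists c : nat -> 'I_f -> nat,
    vge v m%:Z (x - \sum_(i < m) pi ^+ i * \sum_j (c i j)%:R * b j).
Proof.
move=> hb hx; elim: m => [|m [c hc]].
  by exists (fun _ _ => 0%N); rewrite big_ord0 subr0.
set y := x - _ in hc.
have hy : vge v 0 (y / pi ^+ m).
  by rewrite -(subrr m%:Z) vgeM // veq_vge // veqV.
have [d hd] := residue_basis_span hb hy.
exists (fun i => if i == m then d else c i).
rewrite big_ord_recr /= eqxx.
have -> : \sum_(i < m) pi ^+ i * (\sum_j ((if (i : nat) == m then d else c i) j)%:R * b j) =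
   \sum_(i < m) pi ^+ i * (\sum_j (c i j)%:R * b j).
  by apply: eq_bigr => i _; rewrite ltn_eqF.
rewrite opprD addrA -/y.
have -> : y - pi ^+ m * (\sum_j (d j)%:R * b j) = pi ^+ m * (y / pi ^+ m - \sum_j (d j)%:R * b j).
  by rewrite mulrBr [_ * (y / _)]mulrC divfK // expf_neq0 // pi_neq0.
by rewrite -addn1 PoszD vgeM // veq_vge.
Qed.

(** The products [pi ^+ i * b j] form a basis over Q_p. They span by successive approximation modulo
    powers of [p] and completeness of Q_p; they are independent because different [i] give
    valuations in different classes modulo [e]. *)
Lemma padic_field_dim : (\dim {:E} = e * f)%N.
Proof.
have [b hb] := ex_abs_inertia_basis; have ind := residue_basis_indep hb.
have [hb0 _] := ind; have [e0 he] := abs_ramification_indexP.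
pose g (ij : 'I_e * 'I_f) := pi ^+ ij.1 * b ij.2.
have cardI : #|{: 'I_e * 'I_f}| = (e * f)%N by rewrite card_prod !card_ord.
have hg ij : vge v 0 (g ij).
  by apply: vge0M => //; apply: vge0X; apply: vge_le (veq_vge (veq_pi v)) _.
apply/eqP; rewrite eqn_leq -cardI; apply/andP; split.
  (* As [p] has valuation [e], the first [e] digits in [pi] determine [x] modulo [p]. *)
  have dig x : exists c : 'I_e * 'I_f -> nat,
      vge v 0 x -> vge v e%:Z (x - \sum_ij (c ij)%:R * g ij).
    have [hx|] := boolP (vge v 0 x); last by exists (fun _ => 0%N).
    have [c hc] := residue_digits e hb hx; exists (fun ij : 'I_e * 'I_f => c ij.1 ij.2) => _.
    congr (vge v _ (x - _)) : hc.
    rewrite -(pair_bigA _ (fun (i : 'I_e) (j : 'I_f) => (c i j)%:R * g (i, j))) /=.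
    by apply: eq_bigr => i _; rewrite mulr_sumr; apply: eq_bigr => j _; rewrite /g mulrCA.
  have {dig} [c hc] := choice dig.
  (* [T] removes the leading digit in base [p]; iterating it produces the partial sums [s n] of the
     coefficients. *)
  pose T x := (x - \sum_ij (c x ij)%:R * g ij) / p%:R.
  have hT x : vge v 0 x -> vge v 0 (T x).
    by move=> /hc h; rewrite -(subrr e%:Z) vgeM // veq_vge // veqV.
  have intE x : vge v 0 x -> exists k : 'I_e * 'I_f -> Qp, x = \sum_ij k ij *: g ij.
    move=> hx; pose xs n := iter n T x.
    have hxs n : vge v 0 (xs n) by elim: n => // n; apply: hT.
    pose s n ij : Qp := \sum_(l < n) p%:R ^+ l * (c (xs l) ij)%:R.
    have xE n : x = \sum_ij s n ij *: g ij + p%:R ^+ n * xs n.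
      elim: n => [|n IH].
        by rewrite mul1r big1 ?add0r // => ij _; rewrite /s big_ord0 scale0r.
      have step : xs n = \sum_ij (c (xs n) ij)%:R * g ij + p%:R * xs n.+1.
        by rewrite [p%:R * _]mulrC divfK ?p_neq0 // addrC subrK.
      rewrite {1}IH {1}step mulrDr mulrA -exprSr addrA; congr (_ + _).
      rewrite mulr_sumr -big_split; apply: eq_bigr => ij _ /=.
      rewrite /s big_ord_recr scalerDl; congr (_ + _).
      by rewrite -[RHS]mulr_algl -in_algE rmorphM rmorphXn !rmorph_nat mulrA.
    have ex ij : exists l, forall n, vge v0 n%:Z (l - s n ij).
      apply: v0_complete => n; rewrite /s big_ord_recr addrAC subrr add0r.
      rewrite -[n%:Z]addr0 vgeM // ?v0_nat // -[n%:Z]mulr1 vgeX //.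
      exact/veq_vge/v0_p.
    have [l hl] := choice ex; exists l.
    apply/eqP; rewrite -subr_eq0; apply/eqP/(vge_all_eq0 (v := v)) => n.
    rewrite {1}(xE n) addrAC -sumrB vgeD //.
      apply: vge_sum => ij _; rewrite -scalerBl -mulr_algl -[n%:Z]addr0 vgeM //.
      rewrite -vgeN -in_algE -rmorphN opprB; have [->|h0] := eqVneq (l ij - s n ij) 0.
        by rewrite rmorph0 vge_0.
      apply: vge_le (veq_vge (v_alg (veq_dv v0 h0))) _.
      have := hl ij n; rewrite (veq_vge_le _ (veq_dv v0 h0)) => h1.
      by rewrite -[n%:Z]mul1r ler_pM.
    rewrite -[n%:Z]addr0 vgeM // -[n%:Z]mulr1 vgeX //; exact: vge1_p.
  apply: (@dim_le_card _ _ _ g) => x.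
  have [|k hk] := intE (x * p%:R ^+ `|v x|%N).
    have [->|x0] := eqVneq x 0; first by rewrite mul0r vge_0.
    apply: vge_le (veq_vge (veqM (veq_dv v x0) (veqX `|v x| he))) _.
    by have : 0 < (abs_ramification_index E)%:Z by []; nia.
  have c0 : p%:R ^+ `|v x|%N != 0 :> Qp.
    by rewrite expf_neq0 // (veq_neq0 (v0_p p_prime Qp)).
  exists (fun ij => (p%:R ^+ `|v x|%N)^-1 * k ij).
  have c1 : in_alg E (p%:R ^+ `|v x|%N) != 0 by rewrite fmorph_eq0.
  apply: (mulfI c1).
  transitivity (x * p%:R ^+ `|v x|%N); first by rewrite rmorphXn rmorph_nat mulrC.
  rewrite hk mulr_sumr; apply: eq_bigr => ij _.
  by rewrite in_algE mulr_algl scalerA mulrA divff // mul1r.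
apply: (@card_le_dim _ _ _ g) => k hk ij; apply: contrapT => /eqP kij.
pose y (i : 'I_e) := \sum_(j < f) k (i, j) *: b j.
have sy : \sum_(i < e) pi ^+ i * y i = 0.
  rewrite -[RHS]hk (eq_bigr (fun ij => k (ij.1, ij.2) *: g (ij.1, ij.2))); last by case.
  rewrite -(pair_bigA _ (fun (i : 'I_e) (j : 'I_f) => k (i, j) *: g (i, j))) /=.
  apply: eq_bigr => i _; rewrite mulr_sumr; apply: eq_bigr => j _.
  by rewrite scalerAr.
(* A nonzero [y i] has valuation divisible by [e], so [pi ^+ i * y i] remembers [i] modulo [e]. *)
have hy (i : 'I_e) : pi ^+ i * y i != 0 -> exists m, veq v (i%:Z + e%:Z * m) (pi ^+ i * y i).
  rewrite mulf_eq0 negb_or => /andP[_ yi].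
  have [|m hm] := @residue_indep_veq _ b (fun j => k (i, j)) ind.
    apply: contrapT => hn; case/eqP: yi; apply: big1 => j _.
    apply/eqP; rewrite scaler_eq0; apply/orP; left.
    by apply: contrapT => /negP h; apply: hn; exists j.
  by exists m; apply: veqM.
have := @veq_min_sum _ v _ (fun i : 'I_e => pi ^+ i * y i).
case=> [i i' h1 h2||].
- have [m hm] := hy _ h1; have [m' hm'] := hy _ h2.
  have [_ ->] := veqP _ _ _ hm; have [_ ->] := veqP _ _ _ hm' => E1.
  apply/val_inj; have := congr1 (fun z => (z %% e%:Z)%Z) E1.
  rewrite /= ![_ + e%:Z * _]addrC ![e%:Z * _]mulrC !modzMDl.
  by rewrite !modz_small ?ltz_nat ?ltn_ord //= => -[].
- move=> /(_ ij.1)/eqP; rewrite mulf_eq0 expf_eq0 (negPf (pi_neq0 v)) andbF /= => /eqP y0.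
  have [|m] := @residue_indep_veq _ b (fun j => k (ij.1, j)) ind.
    by exists ij.2; rewrite -surjective_pairing.
  by rewrite -/(y _) y0 => /veq_neq0; rewrite eqxx.
- by move=> [i [_ + _]]; rewrite sy => /veq_neq0; rewrite eqxx.
Qed.

End Invariants.

(** * Indices of lattices *)

Section Index.
Variable V : zmodType.
Implicit Types A B C : set V.

Definition subgroup B := B 0 /\ forall x y, B x -> B y -> B (x - y).

Lemma subgroupD B x y : subgroup B -> B x -> B y -> B (x + y).
Proof.
move=> [B0 BB] Bx By; have := BB _ _ Bx (BB _ _ B0 By).
by rewrite sub0r opprK.
Qed.

Lemma has_index_fin (I : finType) (r : I -> V) A B :
  (forall i, A (r i)) -> (forall x, A x -> exists! i, B (x - r i)) ->
  has_index A B #|I|.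
Proof.
move=> hr h; exists (fun i => r (enum_val i)); split => // x /h[i [hi uniq]].
exists (enum_rank i); split; first by rewrite enum_rankK.
by move=> j hj; rewrite (uniq _ hj) enum_valK.
Qed.

Lemma has_index_uniq A B m n : subgroup B ->
  has_index A B m -> has_index A B n -> m = n.
Proof.
move=> sB.
have key m1 n1 : has_index A B m1 -> has_index A B n1 -> (m1 <= n1)%N.
  move=> [r [hr ur]] [s [hs us]].
  have ex i : exists k, B (r i - s k) by have [k [hk _]] := us _ (hr i); exists k.
  have [k hk] := choice ex.
  rewrite -[m1]card_ord -[n1]card_ord; apply: (leq_card k) => i j kij.
  have [l [_ ul]] := ur _ (hr i).
  rewrite -(ul i); last by rewrite subrr; case: sB.
  rewrite (ul j) //; have [_ BB] := sB.
  by have := BB _ _ (hk i) (hk j); rewrite kij opprB addrA subrK.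
by move=> hm hn; apply/eqP; rewrite eqn_leq !key.
Qed.

Lemma has_index_mul A B C m n : subgroup A -> subgroup C ->
  (forall x, B x -> A x) -> (forall x, C x -> B x) -> subgroup B ->
  has_index A B m -> has_index B C n -> has_index A C (m * n).
Proof.
move=> sA sC BA CB sB [r [hr ur]] [s [hs us]].
have -> : (m * n)%N = #|{: 'I_m * 'I_n}| by rewrite card_prod !card_ord.
apply: (@has_index_fin _ (fun ij => r ij.1 + s ij.2)) => [ij|x Ax].
  by apply: subgroupD => //; apply: BA.
have [i [hi ui]] := ur _ Ax; have [j [hj uj]] := us _ hi.
exists (i, j); split; first by rewrite /= opprD addrA.
move=> [i' j'] /=; rewrite opprD addrA => h.
have e : i = i'.
  by apply: ui; rewrite -(subrK (s j') (x - r i')); apply: subgroupD => //; apply: CB.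
by rewrite -e in h *; rewrite (uj _ h).
Qed.

(** Pigeonhole: two of the [m + 1] multiples [0, x, ..., m x] lie in the same coset. *)
Lemma has_index_multiple A B m x : subgroup A -> subgroup B -> has_index A B m -> A x ->
  exists2 k, (0 < k)%N & B (x *+ k).
Proof.
move=> sA sB [r [hr ur]] Ax.
have An k : A (x *+ k).
  by elim: k => [|k IH]; rewrite ?mulr0n ?mulrS; [case: sA|apply: subgroupD].
have ex (j : 'I_m.+1) : exists k, B (x *+ j - r k).
  by have [k [hk _]] := ur _ (An j); exists k.
have [k hk] := choice ex.
have [/injectiveP kinj|/injectivePn[i [j ij kij]]] := boolP (injectiveb k).
  by have := leq_card k kinj; rewrite !card_ord ltnn.
have BB (a b : 'I_m.+1) : k a = k b -> B (x *+ a - x *+ b).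
  move=> e; have [_ h] := sB; have := h _ _ (hk a) (hk b).
  by rewrite e opprB addrA subrK.
case: (ltngtP i j) => [h|h|/val_inj e]; last by rewrite e eqxx in ij.
  exists (j - i)%N; first by rewrite subn_gt0.
  by rewrite mulrnBr ?(ltnW h) //; apply: BB.
exists (i - j)%N; first by rewrite subn_gt0.
by rewrite mulrnBr ?(ltnW h) //; apply: BB.
Qed.

End Index.

Lemma has_index_morph (U V : zmodType) (phi : {additive U -> V})
    (A B : set U) (A' B' : set V) n :
  injective phi -> (forall y, A' y <-> exists2 x, A x & y = phi x) ->
  (forall y, B' y <-> exists2 x, B x & y = phi x) ->
  has_index A B n -> has_index A' B' n.
Proof.
move=> inj hA hB [r [hr ur]]; exists (phi \o r); split => [i|y /hA[x Ax ->]].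
  by apply/hA; exists (r i).
have E i : B' (phi x - phi (r i)) <-> B (x - r i).
  rewrite -raddfB hB; split=> [[z Bz /inj ->] //|]; by exists (x - r i).
have [i [/E hi ui]] := ur _ Ax; exists i; split => // j /E; exact: ui.
Qed.

Lemma has_index_morph_inv (U V : zmodType) (phi : {additive U -> V})
    (A B : set U) (A' B' : set V) n :
  injective phi -> (forall y, A' y <-> exists2 x, A x & y = phi x) ->
  (forall y, B' y <-> exists2 x, B x & y = phi x) ->
  has_index A' B' n -> has_index A B n.
Proof.
move=> inj hA hB [r [hr ur]].
have ex i : exists x, A x /\ r i = phi x by have /hA[x] := hr i; exists x.
have [r' hr'] := choice ex; exists r'; split => [i|x Ax]; first by case: (hr' i).
have E i : B' (phi x - r i) <-> B (x - r' i).
  have [_ ->] := hr' i.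
  rewrite -raddfB hB; split=> [[z Bz /inj ->] //|]; by exists (x - r' i).
have [|i [/E hi ui]] := ur (phi x); first by apply/hA; exists x.
by exists i; split => // j /E; exact: ui.
Qed.

(** * The index of a full lattice from its determinant *)

Section Lattice.
Variables (F : fieldType) (v : dval F) (q : nat) (rep : 'I_q -> F).
Hypothesis rep_int : forall i, vge v 0 (rep i).
Hypothesis rep_uniq : forall x, vge v 0 x -> exists! i, vge v 1 (x - rep i).

Definition intmx m n (A : 'M[F]_(m, n)) := forall i j, vge v 0 (A i j).

Lemma intmxM m n k (A : 'M[F]_(m, n)) (B : 'M[F]_(n, k)) :
  intmx A -> intmx B -> intmx (A *m B).
Proof. by move=> hA hB i j; rewrite mxE vge_sum // => l _; rewrite vge0M. Qed.

Lemma intmxB m n (A B : 'M[F]_(m, n)) : intmx A -> intmx B -> intmx (A - B).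
Proof. by move=> hA hB i j; rewrite !mxE vgeB. Qed.

Lemma intmx_det n (A : 'M[F]_n) : intmx A -> vge v 0 (\det A).
Proof.
move=> hA; apply: vge_sum => s _; apply: vge0M.
  by apply: vge0X; rewrite vgeN vge1.
by apply: (big_ind (vge v 0)) => //; [exact: vge1|exact: vge0M].
Qed.

Definition standard_lattice n : set 'rV[F]_n := [set w | intmx w].
Definition lattice n (A : 'M[F]_n) : set 'rV[F]_n := [set x | exists2 w, intmx w & x = w *m A].

Lemma subgroup_standard_lattice n : subgroup (@standard_lattice n).
Proof.
by split=> [i j|x y]; [rewrite mxE vge_0|exact: intmxB].
Qed.

Lemma subgroup_lattice n (A : 'M[F]_n) : subgroup (lattice A).
Proof.
split=> [|_ _ [w hw ->] [z hz ->]].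
  by exists 0; rewrite ?mul0mx // => i j; rewrite mxE vge_0.
by exists (w - z); rewrite ?mulmxBl //; apply: intmxB.
Qed.

Lemma latticeP n (A : 'M[F]_n) x : A \in unitmx -> lattice A x <-> intmx (x *m invmx A).
Proof.
move=> uA; split=> [[w hw ->]|h]; first by rewrite mulmxK.
by exists (x *m invmx A); rewrite ?mulmxKV.
Qed.

Lemma lattice_sub_standard n (A : 'M[F]_n) x : intmx A -> lattice A x -> standard_lattice x.
Proof. by move=> hA [w hw ->]; apply: intmxM. Qed.

Definition replace_row n (i : 'I_n) (u : 'rV[F]_n) : 'M[F]_n :=
  \matrix_(k, j) if k == i then u 0 j else (k == j)%:R.

(** The cofactors along row [i] do not see that row, so they are those of the identity matrix. *)
Lemma det_replace_row n (i : 'I_n) (u : 'rV[F]_n) : \det (replace_row i u) = u 0 i.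
Proof.
have adj1 : \adj (1%:M : 'M[F]_n) = 1%:M by rewrite -[LHS]mul1mx mul_mx_adj det1.
rewrite (expand_det_row _ i) (bigD1 i) //= big1 ?addr0 => [|j ji].
  rewrite mxE eqxx (_ : cofactor _ i i = 1) ?mulr1 //.
  have := congr1 (fun M : 'M[F]_n => M i i) adj1; rewrite !mxE eqxx => e; apply: etrans e.
  by congr (_ * \det _); apply/matrixP => a b; rewrite !mxE eq_sym (negPf (neq_lift _ _)).
rewrite (_ : cofactor _ i j = 0) ?mulr0 //.
have := congr1 (fun M : 'M[F]_n => M j i) adj1; rewrite !mxE (negPf ji) => e; apply: etrans e.
by congr (_ * \det _); apply/matrixP => a b; rewrite !mxE eq_sym (negPf (neq_lift _ _)).
Qed.

Let pi := dval_pi v.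
Let pi0 : pi != 0 := pi_neq0 v.

(** In coordinates on the larger lattice, the smaller one is cut out by the single condition that
    coordinate [i] lies in the maximal ideal. Cosets thus correspond to residue classes, [q] in
    number. *)
Lemma has_index_replace_row n (A : 'M[F]_n) (i : 'I_n) (u : 'rV[F]_n) :
  A \in unitmx -> intmx u -> veq v 0 (u 0 i) ->
  (forall x, lattice A x -> lattice (replace_row i (pi^-1 *: u) *m A) x) /\
  has_index (lattice (replace_row i (pi^-1 *: u) *m A)) (lattice A) q.
Proof.
move=> uA hu ui; set E := replace_row _ _.
have uE : E \in unitmx.
  rewrite unitmxE det_replace_row mxE unitfE mulf_neq0 ?invr_eq0 ?(veq_neq0 ui) //.
have uEA : E *m A \in unitmx by rewrite unitmx_mul uE.
have wE (w : 'rV[F]_n) j : (w *m E) 0 j =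
    w 0 i * (u 0 j / pi) + (if j == i then 0 else w 0 j).
  rewrite mxE (bigD1 i) //= !mxE eqxx [pi^-1 * _]mulrC; congr (_ + _).
  case: eqP => [->|/eqP ji].
    by apply: big1 => k ki; rewrite !mxE (negPf ki) mulr0.
  rewrite (bigD1 j) //= !mxE (negPf ji) eqxx mulr1 big1 ?addr0 // => k /andP[ki kj].
  by rewrite !mxE (negPf ki) (negPf kj) mulr0.
have latE w : lattice A (w *m (E *m A)) <-> vge v 1 (w 0 i) /\ intmx w.
  rewrite latticeP // mulmxA mulmxK //.
  have veq_ui : veq v 1 (pi / u 0 i) by rewrite -[1]subr0 veqM ?veq_pi // veqV.
  split=> [h|[wi hw] k j].
    have wi : vge v 1 (w 0 i).
      have := h 0 i; rewrite wE eqxx addr0 => hi.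
      have -> : w 0 i = w 0 i * (u 0 i / pi) * (pi / u 0 i).
        by field; rewrite pi0 (veq_neq0 ui).
      by rewrite -[1]add0r vgeM // veq_vge.
    split => // k j; rewrite (ord1 k).
    have [->|ji] := eqVneq j i; first exact: vge_le wi _.
    have := h 0 j; rewrite wE (negPf ji) => hj.
    rewrite -[w 0 j](addKr (w 0 i * (u 0 j / pi))) addrC vgeB //.
    rewrite mulrCA -[0]addr0 vgeM // -(subrr 1) vgeM //.
    by rewrite veq_vge // veqV // veq_pi.
  rewrite (ord1 k) wE vgeD //; last by case: eqP; rewrite ?vge_0.
  rewrite mulrCA -[0]addr0 vgeM // -(subrr 1) vgeM //.
  by rewrite veq_vge // veqV // veq_pi.
split=> [x|].
  by rewrite -{1}(mulmxKV uEA x) => /latE[_ hw]; exists (x *m invmx (E *m A)); rewrite ?mulmxKV.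
pose e : 'rV[F]_n := delta_mx 0 i.
exists (fun k => (rep k *: e) *m (E *m A)); split => [k|x /latticeP-/(_ uEA) hx].
  exists (rep k *: e) => // a b; rewrite !mxE vge0M //.
  by case: (_ && _); rewrite ?vge1 ?vge_0.
pose w := x *m invmx (E *m A).
have xw : x = w *m (E *m A) by rewrite mulmxKV.
have [k [hk uk]] := rep_uniq (hx 0 i).
have E1 l : lattice A (x - (rep l *: e) *m (E *m A)) <-> vge v 1 (w 0 i - rep l).
  rewrite {1}xw -mulmxBl latE !mxE !eqxx mulr1; split=> [[]//|h]; split => // a b.
  apply: intmxB => // c d; rewrite !mxE vge0M //.
  by case: (_ && _); rewrite ?vge1 ?vge_0.
by exists k; split=> [|l /E1]; [apply/E1|apply: uk].
Qed.

(* [u] is a scaled row of [invmx A] through an entry of least valuation. *)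
Lemma nonintegral_inverse n (A : 'M[F]_n) : A \in unitmx -> ~ intmx (invmx A) ->
  exists i (u : 'rV[F]_n), [/\ intmx u, veq v 0 (u 0 i) & intmx (u *m A *m (pi^-1)%:M)] :> Prop.
Proof.
move=> uA hn; set B := invmx A.
have [rc0 hrc0] : exists rc : 'I_n * 'I_n, ~~ vge v 0 (B rc.1 rc.2).
  apply: contrapT => h; apply: hn => i j; apply: contrapT => /negP h1; apply: h.
  by exists (i, j).
have nz0 : B rc0.1 rc0.2 != 0 by apply: contraNneq hrc0 => ->; rewrite vge_0.
case: (@Order.TotalTheory.arg_minP _ int _ rc0 (fun rc => B rc.1 rc.2 != 0)
  (fun rc => v (B rc.1 rc.2)) nz0) => -[r c] /= nz hmin.
have vneg : v (B r c) < 0.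
  by apply: le_lt_trans (hmin _ nz0) _; move: hrc0; rewrite /vge (negPf nz0) /= ltNge.
pose m := `|v (B r c)|%N.
have vm : v (B r c) = - m%:Z by rewrite /m; lia.
have hm : veq v m%:Z (pi ^+ m) by rewrite -[m%:Z]mulr1; apply/veqX/veq_pi.
exists c, (pi ^+ m *: row r B); split.
- move=> i j; rewrite !mxE -(subrr m%:Z) vgeM ?(veq_vge hm) //.
  by rewrite -vm; apply/vgeP => h; apply: (hmin (r, j)).
- by rewrite !mxE -(subrr m%:Z); apply: veqM => //; rewrite -vm veq_dv.
rewrite -scalemxAl -row_mul mulVmx // mul_mx_scalar => i j; rewrite !mxE mulrA.
have hp : vge v 0 (pi^-1 * pi ^+ m).
  have m1 : (0 < m)%N by rewrite /m; lia.
  apply: (@vge_le _ _ _ (- 1 + m%:Z)); last by lia.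
  by rewrite vgeM ?(veq_vge hm) // veq_vge // veqV // veq_pi.
by rewrite vge0M //; case: eqP; rewrite ?vge_0 ?vge1.
Qed.

(** Induction on the valuation of the determinant, in place of elementary divisors: replacing one
    row enlarges the lattice with index [q], keeps it integral and lowers the valuation by one. *)
Lemma has_index_lattice n (A : 'M[F]_n) (d : nat) : intmx A -> veq v d%:Z (\det A) ->
  has_index (@standard_lattice n) (lattice A) (q ^ d).
Proof.
have step (B : 'M[F]_n) i (u : 'rV[F]_n) : intmx B -> intmx u -> intmx (u *m B *m (pi^-1)%:M) ->
    intmx (replace_row i (pi^-1 *: u) *m B).
  move=> hB hu huB k j; have [->|ki] := eqVneq k i.
    have := huB 0 j; rewrite mul_mx_scalar !mxE mulr_sumr; congr (vge v 0 _).
    by apply: eq_bigr => l _; rewrite !mxE eqxx mulrA.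
  have -> : (replace_row i (pi^-1 *: u) *m B) k j = B k j; last exact: hB.
  rewrite mxE (bigD1 k) //= !mxE (negPf ki) eqxx mul1r big1 ?addr0 // => l lk.
  by rewrite !mxE (negPf ki) eq_sym (negPf lk) mul0r.
have det_step (B : 'M[F]_n) i (u : 'rV[F]_n) m : veq v m (\det B) -> veq v 0 (u 0 i) ->
    veq v (m - 1) (\det (replace_row i (pi^-1 *: u) *m B)).
  move=> hm hu; rewrite det_mulmx det_replace_row mxE addrC; apply: veqM => //.
  by rewrite -[-1]addr0; apply: veqM => //; apply/veqV/veq_pi.
have unit_det (B : 'M[F]_n) m : veq v m (\det B) -> B \in unitmx.
  by move=> /veq_neq0; rewrite unitmxE unitfE.
elim: d A => [|d IH] A hA hd; have uA := unit_det _ _ hd.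
  have hinv : intmx (invmx A).
    apply: contrapT => /(nonintegral_inverse uA)[i [u [hu ui huA]]].
    have := intmx_det (step _ i _ hA hu huA).
    by rewrite (veq_vge_le _ (det_step _ _ _ _ hd ui)).
  exists (fun _ => 0); split => [_|x hx]; first by case: (subgroup_standard_lattice n).
  exists ord0; split; last by move=> k _; apply/val_inj; case: k => -[].
  by rewrite subr0; apply/(latticeP _ uA)/intmxM.
have [i [u [hu ui huA]]] : exists i (u : 'rV[F]_n),
    [/\ intmx u, veq v 0 (u 0 i) & intmx (u *m A *m (pi^-1)%:M)] :> Prop.
  apply: (nonintegral_inverse uA) => /intmx_det.
  by rewrite det_inv (veq_vge_le _ (veqV hd)) oppr_ge0 lez_nat.
have hA' := step _ i _ hA hu huA.
have hd' : veq v d%:Z (\det (replace_row i (pi^-1 *: u) *m A)).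
  by rewrite (_ : d%:Z = d.+1%:Z - 1); [apply: det_step|lia].
have [sub hi] := has_index_replace_row uA hu ui.
rewrite expnSr; apply: has_index_mul (IH _ hA' hd') hi => //.
- exact: subgroup_standard_lattice.
- exact: subgroup_lattice.
- by move=> x; apply: lattice_sub_standard.
- exact: subgroup_lattice.
Qed.

(** Some positive multiple of each standard vector lies in the lattice, so a multiple [W *m A] is
    diagonal with nonzero natural numbers on the diagonal. *)
Lemma finite_index_unitmx n (A : 'M[F]_n) m :
  (forall k, (0 < k)%N -> (k%:R : F) != 0) ->
  has_index (@standard_lattice n) (lattice A) m -> A \in unitmx.
Proof.
move=> char0 h.
have ex (i : 'I_n) : exists kw : nat * 'rV[F]_n,
    (0 < kw.1)%N /\ delta_mx 0 i *+ kw.1 = kw.2 *m A.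
  have [|k k0 [w hw e]] := has_index_multiple (x := delta_mx 0 i)
    (subgroup_standard_lattice n) (subgroup_lattice A) h.
    by move=> a b; rewrite mxE; case: (_ && _); rewrite ?vge1 ?vge_0.
  by exists (k, w).
have [kw hkw] := choice ex.
pose W := \matrix_(i, j) (kw i).2 0 j.
have WA : W *m A = diag_mx (\row_i (kw i).1%:R).
  apply/row_matrixP => i; rewrite row_mul.
  have -> : row i W = (kw i).2 by apply/rowP => j; rewrite !mxE.
  have [_ <-] := hkw i; apply/rowP => j; rewrite !mxE mulmxnE !mxE.
  by rewrite eqxx eq_sym; case: eqP => _ /=; rewrite ?mulr1n ?mulr0n ?mul0rn.
have : W *m A \in unitmx.
  rewrite WA unitmxE det_diag unitfE; apply/prodf_neq0 => i _.
  by rewrite mxE char0 //; case: (hkw i).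
by rewrite unitmx_mul => /andP[].
Qed.

End Lattice.

(** * The extension L/K *)

Section Extension.
Variables (p : nat) (p_prime : prime p) (Qp : padicNumbers p).
Variables (K : fieldExtType Qp) (L : splittingFieldType K).

Lemma ex_valuation_L : exists v : dval L, forall x : L, O_L x <-> vge v 0 x.
Proof. exact: (ex_valuation p_prime (baseFieldType L)). Qed.

Lemma in_alg_base (c : Qp) : in_alg (baseFieldType L) c = in_alg L (in_alg K c).
Proof. by rewrite !in_algE baseField_scaleE. Qed.

Lemma map_poly_base (q : {poly Qp}) :
  map_poly (in_alg (baseFieldType L)) q = map_poly (in_alg L) (map_poly (in_alg K) q).
Proof. by apply/polyP => i; rewrite !coef_map; apply: in_alg_base. Qed.

Lemma O_L_alg (c : K) : O_L (in_alg L c) <-> O_K c.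
Proof.
split=> -[q [qm qi qc]]; exists q; split => //; move: qc.
  by rewrite map_poly_base fmorph_root.
by rewrite map_poly_base fmorph_root.
Qed.

Lemma gal_alg (g : gal_of {:L}) (c : K) : g (in_alg L c) = in_alg L c.
Proof. exact: rmorph_alg. Qed.

Lemma O_L_gal (g : gal_of {:L}) (x : L) : O_L x -> O_L (g x).
Proof.
move=> [q [qm qi qx]]; exists q; split => //; move: qx.
rewrite map_poly_base => qx.
have -> : map_poly (in_alg L) (map_poly (in_alg K) q) =
  map_poly g (map_poly (in_alg L) (map_poly (in_alg K) q)).
  by apply/polyP => i; rewrite !coef_map /= gal_alg.
by rewrite fmorph_root.
Qed.


Variables (vK : dval K) (vL : dval L).
Hypothesis vKE : forall x : K, integers x <-> vge vK 0 x.
Hypothesis vLE : forall x : L, O_L x <-> vge vL 0 x.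

Lemma vge_alg (c : K) : vge vL 0 (in_alg L c) = vge vK 0 c.
Proof. by apply/idP/idP => [/vLE/O_L_alg/vKE|/vKE/O_L_alg/vLE]. Qed.

Lemma veq_alg0 (c : K) : veq vK 0 c -> veq vL 0 (in_alg L c).
Proof.
move=> hc; have h1 : vge vL 0 (in_alg L c) by rewrite vge_alg veq_vge.
have h2 : vge vL 0 (in_alg L c)^-1 by rewrite -fmorphV vge_alg veq_vge // (veqV hc).
have c0 : in_alg L c != 0 by rewrite fmorph_eq0 (veq_neq0 hc).
have h3 := veq_dv vL c0; rewrite (veq_vge_le _ h3) in h1.
rewrite (veq_vge_le _ (veqV h3)) oppr_ge0 in h2.
by apply/veqP; split => //; apply/eqP; rewrite eq_le h1 h2.
Qed.

Lemma veq_alg_mul (e : int) (u : K) (n : int) (c : K) :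
  veq vK 1 u -> veq vL e (in_alg L u) ->
  veq vK n c -> veq vL (n * e) (in_alg L c).
Proof.
move=> hu he hc; have hun := veq_piz n hu.
have -> : in_alg L c = in_alg L (c / u ^ n) * in_alg L u ^ n.
  rewrite -rmorphXz ?unitfE ?(veq_neq0 hu) // -rmorphM divfK //.
  exact: veq_neq0 hun.
rewrite -[n * e]add0r; apply: veqM; last exact: veqXz.
by apply: veq_alg0; rewrite -(subrr n); apply: veqM hc (veqV hun).
Qed.

Lemma vge0_gal (g : gal_of {:L}) (x : L) : vge vL 0 (g x) = vge vL 0 x.
Proof.
apply/idP/idP => [/vLE/(O_L_gal (g^-1)%g)|/vLE/(O_L_gal g)/vLE //].
by rewrite -galM ?memvf // mulgV gal_id => /vLE.
Qed.

Lemma veq0_gal (g : gal_of {:L}) (x : L) : veq vL 0 x -> veq vL 0 (g x).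
Proof.
move=> hx; have h1 : vge vL 0 (g x) by rewrite vge0_gal veq_vge.
have h2 : vge vL 0 (g x)^-1 by rewrite -fmorphV vge0_gal veq_vge // (veqV hx).
have x0 : g x != 0 by rewrite fmorph_eq0 (veq_neq0 hx).
have h3 := veq_dv vL x0; rewrite (veq_vge_le _ h3) in h1.
rewrite (veq_vge_le _ (veqV h3)) oppr_ge0 in h2.
by apply/veqP; split => //; apply/eqP; rewrite eq_le h1 h2.
Qed.

(** An automorphism preserves integers and units, so it multiplies valuations by [k], the valuation
    of the image of a uniformiser. Applied to [g^-1 u] this shows that [k] divides 1, and
    [k >= 0]. *)
Lemma veq_gal (g : gal_of {:L}) (n : int) (x : L) : veq vL n x -> veq vL n (g x).
Proof.
have hu := veq_pi vL; set u := dval_pi vL in hu.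
have gu0 : g u != 0 by rewrite fmorph_eq0 (veq_neq0 hu).
have hgu := veq_dv vL gu0; set k := vL (g u) in hgu.
have gen m y : veq vL m y -> veq vL (m * k) (g y).
  move=> hy; have hum := veq_piz m hu.
  have -> : g y = g (y / u ^ m) * g u ^ m.
    by rewrite -rmorphXz ?unitfE ?(veq_neq0 hu) // -rmorphM divfK // (veq_neq0 hum).
  rewrite -[m * k]add0r; apply: veqM; last exact: veqXz.
  by apply: veq0_gal; rewrite -(subrr m); apply: veqM hy (veqV hum).
have k0 : 0 <= k.
  by rewrite -(veq_vge_le 0 hgu) vge0_gal (vge_le (veq_vge hu)).
have guV0 : (g^-1)%g u != 0 by rewrite fmorph_eq0 (veq_neq0 hu).
have := gen _ _ (veq_dv vL guV0).
rewrite -galM ?memvf // mulVg gal_id => h; have e1 := veq_uniq hu h.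
have k1 : k = 1.
  move: k0 e1; move: (vL ((g^-1)%g u)) => m; clearbody k; clear gen hgu h.
  move: k => [[|[|k]]|k] // _; first by rewrite mulr0.
  by case: m => [[|m]|m]; rewrite ?mul0r //; nia.
by move=> /gen; rewrite k1 mulr1.
Qed.

Lemma vge_gal (g : gal_of {:L}) (n : int) (x : L) : vge vL n x -> vge vL n (g x).
Proof.
have [->|x0] := eqVneq x 0; first by rewrite rmorph0 vge_0.
have h := veq_dv vL x0; rewrite (veq_vge_le _ h) => nx.
exact: vge_le (veq_vge (veq_gal g h)) nx.
Qed.

Hypothesis galLK : galois 1%VS {:L}.
Hypothesis degLK : \dim {:L} = p.

Lemma card_gal : #|'Gal({:L} / 1)%g| = p.
Proof. by rewrite -(galois_dim galLK) dimv1 divn1. Qed.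

(** The norm of a uniformiser of [L] is an element of [K] of valuation [p] in [L], and all
    valuations coming from [K] are multiples of [e]; so [e] divides the prime [p]. *)
Lemma ramification_degree (e : nat) (u : K) : (1 < e)%N ->
  veq vK 1 u -> veq vL e%:Z (in_alg L u) -> e = p.
Proof.
move=> e1 hu he; have hpi := veq_pi vL.
have /(mem_galNorm galLK)/vlineP[c hc] := memvf (dval_pi vL).
have hN : veq vL p%:Z (galNorm 1 {:L} (dval_pi vL)).
  have -> : p%:Z = \sum_(g in 'Gal({:L} / 1)%g) 1 by rewrite sumr_const card_gal natz.
  by apply: veq_prod => g _; apply: veq_gal.
rewrite hc in hN.
have c0 : c != 0 by have := veq_neq0 hN; apply: contraNneq => ->; rewrite scale0r.
have := veq_alg_mul hu he (veq_dv vK c0).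
move=> /(veq_uniq hN) E1.
have : (e %| p)%N by rewrite -[e]/(`|e%:Z|)%N -[p]/(`|p%:Z|)%N E1 abszM dvdn_mull.
by move/(prime_nt_dvdP p_prime) => -> //; rewrite gtn_eqF.
Qed.

End Extension.

(** * Weighted determinants *)

Section WeightedDeterminant.
Variables (F : fieldType) (v : valuation F) (n : nat) (r c : 'I_n -> int).

Let sum_perm (s : 'S_n) : \sum_i (r i + c (s i)) = \sum_i r i + \sum_i c i.
Proof. by rewrite big_split; congr (_ + _); rewrite [RHS](reindex_inj (@perm_inj _ s)). Qed.

Let vge_sign (b : bool) : vge v 0 ((-1) ^+ b).
Proof. by apply: vge0X; rewrite vgeN vge1. Qed.

(** Splitting the weight of an entry into a row part and a column part gives all Leibniz terms the
    same bound. *)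
Lemma vge_det (A : 'M[F]_n) : (forall i k, vge v (r i + c k) (A i k)) ->
  vge v (\sum_i r i + \sum_i c i) (\det A).
Proof.
move=> hA; apply: vge_sum => s _; rewrite -[X in vge _ X]add0r.
by rewrite vgeM // -(sum_perm s) vge_prod.
Qed.

Lemma veq_det (A : 'M[F]_n) (s : 'S_n) :
  (forall i, veq v (r i + c (s i)) (A i (s i))) ->
  (forall i k, k != s i -> vge v (r i + c k + 1) (A i k)) ->
  veq v (\sum_i r i + \sum_i c i) (\det A).
Proof.
move=> hs hA; apply: (@veq_sum _ _ _ _ s) => [|u us].
  rewrite -[X in veq _ X]add0r; apply: veqM; last by rewrite -(sum_perm s) veq_prod.
  by rewrite -[0](mulr0 (s : nat)%:Z); apply: veqX; rewrite veqN veq1.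
rewrite -[X in vge _ X]add0r vgeM // -(sum_perm u).
have [i ui] : exists i, u i != s i.
  apply/existsP; rewrite -negb_forall; apply: contra us => /forallP h.
  by apply/eqP/permP => i; apply/eqP.
apply: (@vge_le _ _ _ (\sum_j (r j + c (u j) + (u j != s j)%:R))).
  apply: vge_prod => j _; case: eqP => [->|/eqP uj]; last exact: hA.
  by rewrite addr0 veq_vge.
rewrite [leRHS]big_split lerD2l (bigD1 i) //= ui lerDl.
by apply: sumr_ge0 => j _; case: (_ != _).
Qed.

End WeightedDeterminant.

Section Scaling.
Variables (F : fieldType) (v : valuation F) (m : nat).
Hypothesis m0 : (0 < m)%N.

Fact scaleM x y : x != 0 -> y != 0 -> m%:Z * v (x * y) = m%:Z * v x + m%:Z * v y.
Proof. by move=> x0 y0; rewrite dvM // mulrDr. Qed.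

Fact scaleD x y : x != 0 -> y != 0 -> x + y != 0 ->
  Num.min (m%:Z * v x) (m%:Z * v y) <= m%:Z * v (x + y).
Proof.
move=> x0 y0 xy0; have mp : (0 : int) < m%:Z by rewrite ltz_nat.
by rewrite ge_min !(ler_pM2l mp) -ge_min dvD.
Qed.

(** With [m = p - 1] the fractional weights [i e_K / (p - 1)] become integers. *)
Definition scale_valuation : valuation F := Valuation scaleM scaleD.

Lemma vge_scale (n : int) x : vge scale_valuation (m%:Z * n) x = vge v n x.
Proof. by rewrite /vge /= ler_pM2l // ltz_nat. Qed.

Lemma veq_scale (n : int) x : veq scale_valuation (m%:Z * n) x = veq v n x.
Proof.
rewrite /veq /=; congr (_ && _); apply/eqP/eqP => [|-> //].
by apply: mulfI; rewrite eqz_nat -lt0n.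
Qed.

End Scaling.

(** * Determinants of polynomials in an operator X with (1 + X)^p = 1 *)

Section Companion.
Variables (p : nat) (p_prime : prime p) (K : fieldType) (vK : dval K) (e : nat).
Hypothesis e0 : (0 < e)%N.
Hypothesis vKp : veq vK e%:Z p%:R.
Variables (V : lmodType K) (X : {linear V -> V}) (z : V).
Hypothesis Xp : forall y : V, \sum_(1 <= l < p.+1) iter l X y *+ 'C(p, l) = 0.

Let p1_gt0 : (0 < p.-1)%N.
Proof. by case: p p_prime => [|[]]. Qed.

Let w := scale_valuation vK p1_gt0.

Let w_binom l : (0 < l < p)%N -> vge w (p.-1%:Z * e%:Z) ('C(p, l))%:R.
Proof.
move=> hl; have /dvdnP[k ->] := prime_dvd_bin p_prime hl.
by rewrite natrM vge_scale -[e%:Z]add0r vgeM ?(veq_vge vKp) // vge_nat // vge1.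
Qed.

Lemma iter_linear_sum (I : finType) (f : I -> V) (d : I -> K) m :
  iter m X (\sum_i d i *: f i) = \sum_i d i *: iter m X (f i).
Proof.
elim: m => //= m ->; rewrite linear_sum; apply: eq_bigr => i _.
by rewrite linearZ.
Qed.

(** With [X] of weight [e] for [w], the third clause says that writing [X ^ m] on lower powers loses
    no weight. In the last clause [X ^ p] equals [- p X] up to higher weight, which makes one
    coordinate exact and the others strictly heavier. The range ends at [2 p - 2], the largest sum
    of two exponents below [p]. *)
Definition power_coords (m : nat) (g : nat -> K) :=
  [/\ iter m X z = \sum_(k < p) g k *: iter k X z,
      (m < p)%N -> forall k, g k = (k == m)%:R,
      forall k, vge w ((m%:Z - k%:Z) * e%:Z) (g k),
      (0 < m)%N -> g 0%N = 0 &
      (p <= m < p.*2.-1)%N -> veq w (p.-1%:Z * e%:Z) (g (m - p.-1)%N) /\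
        forall k, k != (m - p.-1)%N -> vge w ((m%:Z - k%:Z) * e%:Z + 1) (g k)].

(* The relation [X ^+ p = - \sum_(0 < l < p) 'C(p, l) X ^+ l] raises weights
   because [p] divides the coefficients; only [l = 1] keeps them. *)
Lemma ex_power_coords m : exists g, power_coords m g.
Proof.
elim/ltn_ind: m => m IH; have [mp|pm] := ltnP m p.
  exists (fun k => (k == m)%:R); split => //.
  - rewrite (bigD1 (Ordinal mp)) //= eqxx scale1r big1 ?addr0 // => i.
    by rewrite -val_eqE /= => /negPf ->; rewrite scale0r.
  - by move=> k; case: eqP => [->|_]; rewrite ?vge_0 // subrr mul0r vge1.
  - by move=> m0; rewrite eq_sym gtn_eqF.
  - by rewrite leqNgt mp.
have p1 := prime_gt1 p_prime.
pose m' := (m - p)%N; have mE : m = (p + m')%N by rewrite subnKC.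
have ex l : exists g, (0 < l < p)%N -> power_coords (m' + l) g.
  have [hl|] := boolP (0 < l < p)%N; last by exists (fun _ => 0).
  have [|g hg] := IH (m' + l)%N; first by rewrite mE addnC ltn_add2r; case/andP: hl.
  by exists g.
have [g hg] := choice ex.
exists (fun k => - \sum_(1 <= l < p) 'C(p, l)%:R * g l k); split.
- have := Xp (iter m' X z); rewrite big_nat_recr ?prime_gt0 // binn mulr1n -iterD -mE /=.
  move/eqP; rewrite addrC addr_eq0 => /eqP ->.
  under [RHS]eq_bigr do rewrite scaleNr scaler_suml.
  rewrite sumrN [in RHS]exchange_big; congr (- _) => /=.
  apply: eq_big_nat => l hl; have [e1 _ _ _ _] := hg l hl.
  rewrite -iterD addnC e1 -sumrMnl; apply: eq_bigr => k _.
  by rewrite scalerMnl mulr_natl.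
- by rewrite ltnNge pm.
- move=> k; rewrite vgeN big_nat vge_sum // => l hl; have [_ _ h _ _] := hg l hl.
  apply: vge_le (vgeM (w_binom hl) (h k)) _; rewrite mE; move: hl p1 e0; clear; nia.
- move=> _; rewrite big_nat big1 ?oppr0 // => l hl; have [_ _ _ h _] := hg l hl.
  by rewrite h ?mulr0 //; case/andP: hl => l0 _; rewrite addn_gt0 l0 orbT.
(* In this range [X ^ (m' + 1)] is itself a basic power, so the term [l = 1] has a single
   coordinate. *)
move=> hm; have m'p : (m' + 1 < p)%N by move: hm p1; rewrite mE; clear; lia.
have k0E : (m - p.-1)%N = (m' + 1)%N by move: p1; rewrite mE; clear; lia.
have rest k : vge w ((m%:Z - k%:Z) * e%:Z + 1) (\sum_(2 <= l < p) 'C(p, l)%:R * g l k).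
  rewrite big_nat vge_sum // => l hl; have hl1 : (0 < l < p)%N by case/andP: hl => /ltnW ->.
  have [_ _ h _ _] := hg l hl1.
  apply: vge_le (vgeM (w_binom hl1) (h k)) _; rewrite mE; move: hl p1 e0; clear; nia.
have gE k : g 1%N k = (k == (m' + 1)%N)%:R.
  by have [_ h _ _ _] := hg 1%N p1; rewrite h.
rewrite k0E; split=> [|k km]; rewrite big_ltn // gE bin1.
  rewrite eqxx mulr1 veqN; apply: veqD; first by rewrite veq_scale.
  apply: vge_le (rest _) _; move: p1; rewrite mE; clear; nia.
by rewrite (negPf km) mulr0 add0r vgeN.
Qed.

(** [T] expresses multiplication by theta = [\sum_j d j X ^ j] on the vectors [X ^ k z]. *)
Definition coords_of (d : 'I_p -> K) (T : 'M[K]_p) :=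
  forall i : 'I_p, iter i X (\sum_j d j *: iter j X z) = \sum_k T i k *: iter k X z.

Let gam m := projT1 (cid (ex_power_coords m)).
Let gamP m : power_coords m (gam m).
Proof. by rewrite /gam; case: cid. Qed.

Let gam_small m k : (m < p)%N -> gam m k = (k == m)%:R.
Proof. by move=> mp; have [_ h _ _ _] := gamP m; exact: h. Qed.

Let gam_zero m : (0 < m)%N -> gam m 0%N = 0.
Proof. by have [_ _ _ h _] := gamP m. Qed.

Let Theta d : 'M[K]_p := \matrix_(i, k) \sum_(j < p) d j * gam (i + j) k.

Let coords_Theta d : coords_of d (Theta d).
Proof.
move=> i; rewrite iter_linear_sum.
under [RHS]eq_bigr do rewrite mxE scaler_suml.
rewrite exchange_big; apply: eq_bigr => j _ /=.
rewrite -iterD; have [-> _ _ _ _] := gamP (i + j)%N.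
by rewrite scaler_sumr; apply: eq_bigr => k _; rewrite scalerA.
Qed.

Let i0 : 'I_p := Ordinal (prime_gt0 p_prime).

(** Opposite shifts [x] and [- x] of row 0 and column 0 cancel, which leaves [x] free; the other
    [p - 1] rows contribute [s] each. *)
Let sum_weights (s x : int) :
  \sum_(i < p) (if i == i0 then x else s + i%:Z * e%:Z) +
  \sum_(k < p) (if k == i0 then - x else - (k%:Z * e%:Z)) = p.-1%:Z * s.
Proof.
rewrite /= -big_split (bigD1 i0) //= ?eqxx subrr add0r.
rewrite (eq_bigr (fun _ => s)); last by move=> i /negPf ->; rewrite addrK.
rewrite sumr_const -mulr_natl natz; congr (_%:Z * _).
by rewrite (eq_card (B := predC1 i0)) // cardC1 card_ord.
Qed.

(** Column 0 vanishes below its corner [d i0], because [X] maps into positive powers. Its weight can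
    be set to [- s], against [s] for row 0, as the corner only has to have weight 0. The total
    [(p - 1) s] for [w] is [s] for [vK]. *)
Lemma companion_bound (d : 'I_p -> K) (s : int) :
  vge vK 0 (d i0) -> (forall j : 'I_p, vge w (s - j%:Z * e%:Z) (d j)) ->
  exists2 T, coords_of d T & vge vK s (\det T).
Proof.
move=> d0 hd; exists (Theta d) => //.
rewrite -(vge_scale vK p1_gt0) -(sum_weights s s); apply: vge_det => i k.
rewrite mxE; have [->|ii0] := eqVneq i i0; have [->|kk0] := eqVneq k i0.
- rewrite subrr (bigD1 i0) //= vgeD //.
    rewrite (gam_small _ (prime_gt0 p_prime : (i0 + i0 < p)%N)) mulr1 -[0](mulr0 p.-1%:Z).
    by rewrite vge_scale.
  rewrite vge_sum // => j jj0; rewrite gam_zero ?mulr0 ?vge_0 // add0n lt0n.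
  by rewrite -(inj_eq val_inj) in jj0.
- rewrite (bigD1 k) //= vgeD //.
    by rewrite add0n gam_small // eqxx mulr1.
  rewrite vge_sum // => j jk; rewrite add0n gam_small // eq_sym.
  by rewrite -(inj_eq val_inj) in jk; rewrite (negPf jk) mulr0 vge_0.
- rewrite big1 ?vge_0 // => j _; rewrite gam_zero ?mulr0 // addn_gt0 lt0n.
  by rewrite -(inj_eq val_inj) in ii0; rewrite ii0.
- rewrite vge_sum // => j _; have [_ _ h _ _] := gamP (i + j)%N.
  by apply: vge_le (vgeM (hd j) (h k)) _; clear; lia.
Qed.


Section ExactValue.
Variables (j0 : 'I_p) (s : int) (u : K).
Hypotheses (j0_neq0 : j0 != i0) (s_lt0 : s < 0) (hu : veq w (s - j0%:Z * e%:Z) u).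

Let d j : K := if j == i0 then 1 else if j == j0 then u else 0.

Let ThetaE (i k : 'I_p) : Theta d i k = (k == i)%:R + u * gam (i + j0) k.
Proof.
rewrite mxE (bigD1 i0) //= (bigD1 j0) //= big1 ?addr0 => [|j /andP[h1 h2]]; last first.
  by rewrite /d (negPf h1) (negPf h2) mul0r.
rewrite /d !eqxx (negPf j0_neq0) mul1r addn0; congr (_ + _).
by rewrite gam_small.
Qed.

(** The exponent of the principal term of [X ^ (i + j0)]: past [p - 1] it is
    [- p X ^ (i + j0 - (p - 1))]. On [1, ..., p - 1] this is the cyclic shift by [j0]. *)
Let rho_nat (i : nat) := if i == 0%N then 0%N
  else if (i + j0 < p)%N then (i + j0)%N else (i + j0 - p.-1)%N.

Let rho_lt (i : 'I_p) : (rho_nat i < p)%N.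
Proof.
have := ltn_ord i; have := ltn_ord j0; move: p1_gt0; rewrite /rho_nat.
case: eqP => [_ *|_]; first exact: prime_gt0.
by case: ifP => [//|]; clear; lia.
Qed.

Let rho_fun (i : 'I_p) := Ordinal (rho_lt i).

Let rho_inj : injective rho_fun.
Proof.
move=> a b /(congr1 val) /= h; apply: val_inj => /=; move: h.
have := ltn_ord a; have := ltn_ord b; have := ltn_ord j0.
have : (0 < j0)%N by have := j0_neq0; rewrite -(inj_eq val_inj) lt0n.
rewrite /rho_nat; case: eqP; case: eqP => //; try case: ifP; try case: ifP; clear; lia.
Qed.

Let rho := perm rho_inj.

(* In the Leibniz expansion only [rho] reaches the least weight. The extra
   shift by 1 in the weights of row and column 0 makes the bound strict on the
   rest of row 0; it is harmless because column 0 vanishes off the diagonal. *)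
Lemma companion_exact : exists2 T, coords_of d T & veq vK s (\det T).
Proof.
exists (Theta d) => //.
have j00 : (0 < j0)%N by have := j0_neq0; rewrite -(inj_eq val_inj) lt0n.
have j0p := ltn_ord j0.
rewrite -(veq_scale vK p1_gt0) -(sum_weights s (s - 1)); apply: (@veq_det _ _ _ _ _ _ rho) => i.
  rewrite permE ThetaE; have [->|ii0] := eqVneq i i0.
    have -> : rho_fun i0 = i0 by apply/val_inj.
    by rewrite !eqxx subrr gam_zero // mulr0 addr0 veq1.
  have inz : (i : nat) != 0%N by rewrite -(inj_eq val_inj) in ii0.
  have rnz : rho_fun i != i0.
    apply/negP => /eqP h; case/eqP: ii0; apply: rho_inj; rewrite h.
    by apply: val_inj.
  rewrite (negPf rnz); apply: veqDr.
    case: eqP => [->|_]; last exact: vge_0.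
    by apply: vge_le (vge1 _) _; rewrite addrK; move: s_lt0; clear; lia.
  rewrite /= /rho_nat (negPf inz); case: ifP => [lt|ge].
    by rewrite gam_small // eqxx mulr1 (_ : _ - _ = s - j0%:Z * e%:Z) //; clear; nia.
  have [_ _ _ _ []] := gamP (i + j0)%N.
    have := ltn_ord i; move: j0p ge; clear; lia.
  move=> h _; have := veqM hu h; congr (veq _ _ _).
  have := ltn_ord i; move: j0p p1_gt0 ge; clear; nia.
move=> k; rewrite permE => kr; rewrite ThetaE.
have [ii|ii0] := eqVneq i i0; have [kk|kk0] := eqVneq k i0.
- by rewrite ii kk in kr; case/eqP: kr; apply: val_inj.
- have -> : (k == i) = false by rewrite ii (negPf kk0).
  rewrite add0r ii add0n gam_small //.
  case: eqP => [->|_]; last by rewrite mulr0 vge_0.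
  by rewrite mulr1; apply: vge_le (veq_vge hu) _; clear; lia.
- have -> : (k == i) = false by rewrite kk eq_sym (negPf ii0).
  by rewrite kk gam_zero ?mulr0 ?addr0 ?vge_0 // addn_gt0 j00 orbT.
have inz : (i : nat) != 0%N by rewrite -(inj_eq val_inj) in ii0.
apply: vgeD.
  case: eqP => [->|_]; last exact: vge_0.
  by apply: vge_le (vge1 _) _; rewrite addrK; move: s_lt0; clear; lia.
have {}kr : (k : nat) != rho_nat i by rewrite -(inj_eq val_inj) in kr.
move: kr; rewrite /rho_nat (negPf inz); case: ifP => [lt kr|ge kr].
  by rewrite gam_small // (negPf kr) mulr0 vge_0.
have [_ _ _ _ []] := gamP (i + j0)%N.
  have := ltn_ord i; move: j0p ge; clear; lia.
move=> _ /(_ k kr) h; apply: vge_le (vgeM (veq_vge hu) h) _; clear; nia.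
Qed.

End ExactValue.

End Companion.

(** * Bases with prescribed valuations *)

Lemma span_of_free_card (K : fieldType) (V : vectType K) (n : nat) (g : 'I_n -> V) :
  \dim {:V} = n ->
  (forall k : 'I_n -> K, \sum_i k i *: g i = 0 -> forall i, k i = 0) ->
  forall x, exists k : 'I_n -> K, x = \sum_i k i *: g i.
Proof.
move=> dimV h x; pose X := [tuple g i | i < n].
have XE (i : 'I_n) : X`_i = g i by rewrite -tnth_nth tnth_mktuple.
have fX : free X.
  apply/freeP => k hk i; apply: h; rewrite -[RHS]hk.
  by apply: eq_bigr => j _; rewrite XE.
have bX : basis_of {:V} X by rewrite basisEfree fX subvf dimV size_tuple leqnn.
exists (fun i => coord X i x); rewrite {1}(coord_basis bX (memvf x)).
by apply: eq_bigr => i _; rewrite XE.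
Qed.

Lemma ord_eq_mod (p : nat) (i j : 'I_p) (k : int) : i%:Z - j%:Z = k * p%:Z -> i = j.
Proof.
move=> h; apply: val_inj; have := ltn_ord i; have := ltn_ord j.
move: h => /=; move: (nat_of_ord i) (nat_of_ord j) => a b h hb ha.
have k0 : k = 0 by clear -h ha hb; case: k h => [[|k]|k]; nia.
by rewrite k0 in h; lia.
Qed.

Section RamifiedBasis.
Variables (p : nat) (p_gt0 : (0 < p)%N) (K : fieldType) (L : fieldExtType K).
Variables (vK : dval K) (vL : dval L).
Hypothesis vLK : forall n c, veq vK n c -> veq vL (n * p%:Z) (in_alg L c).
Hypothesis degLK : \dim {:L} = p.

Lemma vge_algE n c : vge vL (n * p%:Z) (in_alg L c) = vge vK n c.
Proof.
have [->|c0] := eqVneq c 0; first by rewrite rmorph0 !vge_0.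
have h := veq_dv vK c0; rewrite (veq_vge_le _ h) (veq_vge_le _ (vLK h)).
by rewrite ler_pM2r // ltz_nat.
Qed.

Lemma vge_alg0 c : vge vL 0 (in_alg L c) = vge vK 0 c.
Proof. by rewrite -vge_algE mul0r. Qed.

Section Basis.
Variables (y : 'I_p -> L) (n : 'I_p -> int).
Hypothesis hy : forall i, veq vL (n i) (y i).
Hypothesis n_inj : forall i j k, n i - n j = k * p%:Z -> i = j.

Lemma veq_term c i m : veq vK m c -> veq vL (m * p%:Z + n i) (c *: y i).
Proof. by move=> /vLK hc; rewrite -mulr_algl veqM. Qed.

(** Valuations from [K] are multiples of [p], so a term with index [i] has valuation congruent to
    [n i], and these classes differ. *)
Lemma term_inj (c : 'I_p -> K) i j : c i *: y i != 0 -> c j *: y j != 0 ->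
  vL (c i *: y i) = vL (c j *: y j) -> i = j.
Proof.
rewrite !scaler_eq0 !negb_or => /andP[ci _] /andP[cj _].
have [_ ->] := veqP _ _ _ (veq_term i (veq_dv vK ci)).
have [_ ->] := veqP _ _ _ (veq_term j (veq_dv vK cj)).
move=> e; apply: (@n_inj _ _ (vK (c j) - vK (c i))).
by rewrite mulrBl; move/eqP: e; rewrite addrC eq_sym -subr_eq => /eqP <-; ring.
Qed.

Lemma comb_indep (c : 'I_p -> K) : \sum_i c i *: y i = 0 -> forall i, c i = 0.
Proof.
case: (veq_min_sum (@term_inj c)) => [h _ i|[i [_ h _]] e]; last first.
  by have := veq_neq0 h; rewrite e eqxx.
by apply/eqP; have /eqP := h i; rewrite scaler_eq0 (negPf (veq_neq0 (hy i))) orbF.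
Qed.

Lemma comb_span x : exists c : 'I_p -> K, x = \sum_i c i *: y i.
Proof. exact: span_of_free_card degLK comb_indep x. Qed.

Lemma comb_vge m (c : 'I_p -> K) : vge vL m (\sum_i c i *: y i) ->
  forall i, vge vL m (c i *: y i).
Proof. exact: vge_sum_inj (@term_inj c). Qed.

Hypothesis n_small : forall i, 0 <= n i < p%:Z.

(** For [0 <= n i < p], the inequality [v(c) p + n i >= 0] means [v(c) >= 0]; hence the family is an
    [O_K]-basis of [O_L]. *)
Lemma comb_int (c : 'I_p -> K) :
  vge vL 0 (\sum_i c i *: y i) <-> forall i, vge vK 0 (c i).
Proof.
split=> [/comb_vge h i|h].
  have [->|ci] := eqVneq (c i) 0; first exact: vge_0.
  have hc := veq_dv vK ci; have := h i.
  rewrite (veq_vge_le _ (veq_term i hc)) (veq_vge_le _ hc).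
  by have := n_small i; clear; nia.
apply: vge_sum => i _; rewrite -mulr_algl vge0M ?vge_alg0 //.
by apply: vge_le (veq_vge (hy i)) _; case/andP: (n_small i).
Qed.

End Basis.

End RamifiedBasis.

(** * The Galois module structure *)

Lemma iter_translate (K : fieldType) (V : lmodType K) (f g : {linear V -> V}) (u : K) :
  (forall x, f x = g x + u *: x) -> forall n x,
  iter n f x = \sum_(k < n.+1) (u ^+ (n - k) *+ 'C(n, k)) *: iter k g x.
Proof.
move=> fE; elim=> [|n IH] x; first by rewrite big_ord1 bin0 expr0 mulr1n scale1r.
rewrite iterS IH fE linear_sum scaler_sumr.
under eq_bigr do rewrite linearZ /= -iterS.
under [X in _ + X]eq_bigr do rewrite scalerA mulrnAr -exprS.
rewrite [RHS]big_ord_recl [X in _ + X]big_ord_recl /= !subn0 !bin0.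
rewrite addrCA; congr (_ + _).
have -> : \sum_(i < n) (u ^+ (n - bump 0 i).+1 *+ 'C(n, bump 0 i)) *: iter (bump 0 i) g x =
   \sum_(i < n.+1) (u ^+ (n - i) *+ 'C(n, i.+1)) *: iter i.+1 g x.
  rewrite [RHS]big_ord_recr /= bin_small // mulr0n scale0r addr0.
  by apply: eq_bigr => i _; rewrite /bump add1n subnSK.
rewrite -big_split; apply: eq_bigr => i _ /=.
by rewrite -scalerDl /bump add1n subSS binS mulrnDr addrC.
Qed.

Section WildExtension.
Variables (p : nat) (p_prime : prime p) (Qp : padicNumbers p).
Variables (K : fieldExtType Qp) (L : splittingFieldType K).
Variables (vK : dval K) (vL : dval L).
Hypothesis vKE : forall x : K, integers x <-> vge vK 0 x.
Hypothesis vLE : forall x : L, O_L x <-> vge vL 0 x.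
Hypothesis galLK : galois 1%VS {:L}.
Hypothesis degLK : \dim {:L} = p.
Hypothesis vLK : forall n c, veq vK n c -> veq vL (n * p%:Z) (in_alg L c).
Variables (s : gal_of {:L}) (piL : L) (t : nat).
Hypothesis s_gal : s \in 'Gal({:L} / 1)%g.
Hypothesis hpi : veq vL 1 piL.
Hypothesis hspi : veq vL (t%:Z + 1) (s piL - piL).

Let e := abs_ramification_index K.
Let e_gt0 : (0 < e)%N. Proof. by case: (abs_ramification_indexP p_prime vKE). Qed.
Let vKp : veq vK e%:Z (p%:R : K). Proof. by case: (abs_ramification_indexP p_prime vKE). Qed.
Let p0 := prime_gt0 p_prime.
Let p1 := prime_gt1 p_prime.

Let alg_nat k : in_alg L k%:R = k%:R.
Proof. exact: rmorph_nat. Qed.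

Lemma vLp : veq vL (e%:Z * p%:Z) (p%:R : L).
Proof. by rewrite -alg_nat; apply: vLK. Qed.

Lemma vL_nat k : vge vL 0 (k%:R : L).
Proof. exact/vge_nat/vge1. Qed.

Lemma vL_nat_unit k : ~~ (p %| k)%N -> veq vL 0 (k%:R : L).
Proof.
move=> pk; rewrite -alg_nat -[0](mul0r p%:Z); apply: vLK.
by have := v_alg0 vKE (v0_nat_unit p_prime Qp pk); rewrite nat_alg.
Qed.

Lemma s_neq1 : s != 1%g.
Proof.
by apply: contraTneq hspi => ->; rewrite gal_id subrr /veq eqxx.
Qed.

Lemma order_s : #[s]%g = p.
Proof.
have : (#[s]%g %| #|'Gal({:L} / 1)%g|)%N by rewrite orderE cardSg // cycle_subG.
rewrite (card_gal galLK degLK).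
move/(prime_nt_dvdP p_prime) => -> //; rewrite order_eq1; exact: s_neq1.
Qed.

Lemma expg_gal k (x : L) : (s ^+ k)%g x = iter k s x.
Proof.
by elim: k => [|k IH]; rewrite ?expg0 ?gal_id // expgSr galM ?memvf // IH.
Qed.

Lemma iter_p x : iter p s x = x.
Proof.
have := congr1 (fun k => (s ^+ k)%g x) order_s.
by rewrite expg_order gal_id expg_gal.
Qed.

Lemma sum_gal (V : nmodType) (f : gal_of {:L} -> V) :
  \sum_(g in 'Gal({:L} / 1)%g) f g = \sum_(i < p) f (s ^+ i)%g.
Proof.
have e1 : 'Gal({:L} / 1)%g = <[s]>%g.
  apply/eqP; rewrite eq_sym eqEcard cycle_subG s_gal /= -orderE order_s.
  by rewrite (card_gal galLK degLK).
have -> : \sum_(g in 'Gal({:L} / 1)%g) f g = \sum_(g in [set (s ^+ i)%g | i : 'I_p]) f g.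
  apply: eq_bigl => g; rewrite e1; apply/idP/imsetP => [/cyclePmin[m mp ->]|[i _ ->]].
    by rewrite order_s in mp; exists (Ordinal mp).
  exact: mem_cycle.
rewrite big_imset //= => i j _ _ /eqP.
by rewrite eq_expg_mod_order order_s !modn_small // => /eqP/val_inj.
Qed.

Definition gal_sub1 : 'End(L) := (gal_repr s : 'End(L)) - \1%VF.

Local Notation X := gal_sub1.

Lemma gal_sub1E x : X x = s x - x.
Proof. by rewrite add_lfunE opp_lfunE id_lfunE. Qed.


(** This is [s ^ p = 1] expanded with [s = 1 + X], the constant terms having cancelled. *)
Lemma X_relation y : \sum_(1 <= l < p.+1) iter l X y *+ 'C(p, l) = 0.
Proof.
have sE x : s x = X x + 1 *: x by rewrite gal_sub1E scale1r subrK.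
have := @iter_translate _ _ (gal_repr s : 'End(L)) X 1 sE p y.
rewrite iter_p -(big_mkord xpredT (fun k => 1 ^+ (p - k) *+ 'C(p, k) *: iter k X y)).
rewrite big_nat_recl // expr1n bin0 mulr1n scale1r -{1}[y]addr0 => /addrI e1.
rewrite [RHS]e1 big_add1 /=; apply: eq_bigr => l _.
by rewrite expr1n -scaler_nat.
Qed.

Lemma iter_sX n x : iter n s x = \sum_(k < n.+1) ('C(n, k))%:R *: iter k X x.
Proof.
have sE z : s z = X z + 1 *: z by rewrite gal_sub1E scale1r subrK.
rewrite (@iter_translate _ _ (gal_repr s : 'End(L)) X 1 sE n x).
by apply: eq_bigr => k _; rewrite expr1n.
Qed.

Lemma iter_Xs n x : iter n X x = \sum_(k < n.+1) ((-1) ^+ (n - k) *+ 'C(n, k)) *: iter k s x.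
Proof.
have sE z : X z = s z + (-1) *: z by rewrite gal_sub1E scaleN1r.
by rewrite (@iter_translate _ _ X (gal_repr s : 'End(L)) (-1) sE n x).
Qed.

Definition Ospan (y : nat -> L) : set L :=
  [set x | exists2 c : 'I_p -> K, forall i, vge vK 0 (c i) & x = \sum_(i < p) c i *: y i].

Lemma Ospan_sum (y : nat -> L) (I : Type) (r : seq I) (P : pred I) (f : I -> L) :
  (forall i, P i -> Ospan y (f i)) -> Ospan y (\sum_(i <- r | P i) f i).
Proof.
move=> h; apply: (big_ind (Ospan y)) => //.
  exists (fun _ => 0); first by move=> i; exact: vge_0.
  by rewrite big1 // => i _; rewrite scale0r.
move=> _ _ [c hc ->] [d hd ->]; exists (fun i => c i + d i).
  by move=> i; rewrite vgeD.
by rewrite -big_split; apply: eq_bigr => i _; rewrite scalerDl.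
Qed.

Lemma OspanZ (y : nat -> L) a x : vge vK 0 a -> Ospan y x -> Ospan y (a *: x).
Proof.
move=> ha [c hc ->]; exists (fun i => a * c i).
  by move=> i; rewrite vge0M.
by rewrite scaler_sumr; apply: eq_bigr => i _; rewrite scalerA.
Qed.

Lemma Ospan_id (y : nat -> L) (i : nat) : (i < p)%N -> Ospan y (y i).
Proof.
move=> ip; exists (fun j => (j == Ordinal ip)%:R).
  by move=> j; case: eqP => _; [exact: vge1|exact: vge_0].
rewrite (bigD1 (Ordinal ip)) //= eqxx scale1r big1 ?addr0 // => j /negPf ->.
by rewrite scale0r.
Qed.

Lemma Ospan_trans (y z : nat -> L) : (forall i, (i < p)%N -> Ospan z (y i)) ->
  forall x, Ospan y x -> Ospan z x.
Proof.
move=> h _ [c hc ->]; apply: Ospan_sum => i _; apply: OspanZ => //; exact: h.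
Qed.

(** The binomial formulas between powers of [s] and powers of [X] have integer coefficients in both
    directions, so the two families have the same span over [O_K]. *)
Lemma orbit_moduleE alpha x : galois_orbit_module alpha x <->
  Ospan (fun i => iter i X alpha) x.
Proof.
have -> : galois_orbit_module alpha x <-> Ospan (fun i => iter i s alpha) x.
  split=> [[c hc ->]|[c hc ->]].
    exists (fun i => c (s ^+ i)%g); first by move=> i; apply/vKE/hc.
    by rewrite sum_gal; apply: eq_bigr => i _; rewrite expg_gal.
  pose d g := if [pick i : 'I_p | g == (s ^+ i)%g] is Some i then c i else 0.
  exists d.
    move=> g; apply/vKE; rewrite /d; case: pickP => // _; exact: vge_0.
  rewrite sum_gal; apply: eq_bigr => i _; rewrite expg_gal; congr (_ *: _).
  rewrite /d; case: pickP => [j|/(_ i)]; last by rewrite eqxx.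
  by rewrite eq_expg_mod_order order_s !modn_small // => /eqP/val_inj ->.
split; apply: Ospan_trans => i ip.
  rewrite iter_sX; apply: Ospan_sum => k _; apply: OspanZ; first exact/vge_nat/vge1.
  by apply: (@Ospan_id (fun j => iter j X alpha)); apply: leq_trans ip; rewrite ltn_ord.
rewrite iter_Xs; apply: Ospan_sum => k _; apply: OspanZ.
  by apply/vge_nat/vge0X; rewrite vgeN vge1.
by apply: (@Ospan_id (fun j => iter j s alpha)); apply: leq_trans ip; rewrite ltn_ord.
Qed.


Lemma vge_X n x : vge vL n x -> vge vL n (X x).
Proof. by move=> hx; rewrite gal_sub1E vgeB //; apply: (vge_gal vLE). Qed.

Lemma vge_iterX k n x : vge vL n x -> vge vL n (iter k X x).
Proof. by move=> hx; elim: k => //= k IH; apply: vge_X. Qed.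

(** * The index of an orbit module as a determinant *)

Section OrbitIndex.
Variables (y : 'I_p -> L) (n : 'I_p -> int).
Hypothesis hy : forall i, veq vL (n i) (y i).
Hypothesis n_inj : forall i j k, n i - n j = k * p%:Z -> i = j.
Hypothesis n_small : forall i, 0 <= n i < p%:Z.

Definition coord_comb (w : 'rV[K]_p) : L := \sum_i w 0 i *: y i.

Fact coord_comb_additive : zmod_morphism coord_comb.
Proof.
move=> w z; rewrite /coord_comb -sumrB; apply: eq_bigr => i _.
by rewrite !mxE scalerBl.
Qed.

HB.instance Definition _ := GRing.isZmodMorphism.Build _ _ coord_comb coord_comb_additive.

Let coord_comb_inj : injective coord_comb.
Proof.
apply: (@raddf_inj _ _ coord_comb) => w hw; apply/rowP => i; rewrite mxE.
exact: (comb_indep vLK hy n_inj (hw : \sum_i w 0 i *: y i = 0)).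
Qed.

Let O_LE x : O_L x <-> exists2 w : 'rV[K]_p, standard_lattice vK w & x = coord_comb w.
Proof.
split=> [/vLE hx|[w hw ->]].
  have [c e1] := comb_span vLK degLK hy n_inj x.
  exists (\row_i c i); last by rewrite /coord_comb e1; apply: eq_bigr => i _; rewrite mxE.
  move=> i j; rewrite mxE; move: hx; rewrite e1.
  by move/(comb_int p0 vLK hy n_inj n_small).
by apply/vLE/(comb_int p0 vLK hy n_inj n_small) => i; apply: hw.
Qed.

Let orbitE alpha (M : 'M[K]_p) : (forall i : 'I_p, iter i X alpha = \sum_j M i j *: y j) ->
  forall x, galois_orbit_module alpha x <-> exists2 w : 'rV[K]_p, lattice vK M w & x = coord_comb w.
Proof.
move=> hM x.
have key (w : 'rV[K]_p) : coord_comb (w *m M) = \sum_(i < p) w 0 i *: iter i X alpha.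
  rewrite /coord_comb; under eq_bigr do rewrite mxE scaler_suml.
  rewrite exchange_big; apply: eq_bigr => i _; rewrite hM scaler_sumr.
  by apply: eq_bigr => j _; rewrite scalerA.
split=> [/orbit_moduleE[c hc ->]|[_ [w hw ->] ->]].
  exists ((\row_i c i) *m M).
    by exists (\row_i c i) => // i j; rewrite mxE.
  by rewrite key; apply: eq_bigr => i _; rewrite mxE.
apply/orbit_moduleE; exists (w 0); last exact: key.
by move=> i; apply: hw.
Qed.

Lemma coords_int alpha (M : 'M[K]_p) : O_L alpha ->
  (forall i : 'I_p, iter i X alpha = \sum_j M i j *: y j) -> intmx vK M.
Proof.
move=> /vLE ha hM i j; have := vge_iterX i ha; rewrite hM.
by move/(comb_int p0 vLK hy n_inj n_small).
Qed.

Lemma orbit_index alpha (M : 'M[K]_p) (d : nat) : O_L alpha ->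
  (forall i : 'I_p, iter i X alpha = \sum_j M i j *: y j) ->
  veq vK d%:Z (\det M) -> has_orbit_index alpha ((p ^ abs_inertia_degree K) ^ d).
Proof.
move=> ha hM hd; have [r [hr ur]] := residue_representatives p_prime vKE.
have hi := has_index_lattice hr ur (coords_int ha hM) hd.
exact: (has_index_morph coord_comb_inj O_LE (orbitE hM) hi).
Qed.

(** Finite index forces a nonzero determinant. Every finite index is thus a power of [p ^ f_K], and
    minimising it amounts to minimising a determinant valuation. *)
Lemma orbit_index_inv alpha (M : 'M[K]_p) (m : nat) : O_L alpha ->
  (forall i : 'I_p, iter i X alpha = \sum_j M i j *: y j) ->
  has_orbit_index alpha m ->
  exists2 d : nat, veq vK d%:Z (\det M) & m = ((p ^ abs_inertia_degree K) ^ d)%N.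
Proof.
move=> ha hM hm; have [r [hr ur]] := residue_representatives p_prime vKE.
have hi := has_index_morph_inv coord_comb_inj O_LE (orbitE hM) hm.
have : M \in unitmx.
  apply: finite_index_unitmx hi => k k0.
  by rewrite -nat_alg fmorph_eq0 padic_nat_neq0.
rewrite unitmxE unitfE => /(veq_dv vK) hd.
have := intmx_det (coords_int ha hM); rewrite (veq_vge_le _ hd).
case e1 : (vK _) => [d|//] _; rewrite e1 in hd; exists d => //.
apply: has_index_uniq hi (has_index_lattice hr ur (coords_int ha hM) hd).
exact: subgroup_lattice.
Qed.

End OrbitIndex.


(** * The effect of X on valuations *)

Let pin (i : 'I_p) : int := i%:Z.
Let piy (i : 'I_p) : L := piL ^+ i.

Let hpiX m : veq vL m%:Z (piL ^+ m).
Proof. by rewrite -[m%:Z]mulr1; apply: veqX. Qed.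

Let hpin (i : 'I_p) : veq vL (pin i) (piy i).
Proof. exact: hpiX. Qed.

Let pin_inj (i j : 'I_p) k : pin i - pin j = k * p%:Z -> i = j.
Proof. exact: ord_eq_mod. Qed.

Let pin_small (i : 'I_p) : 0 <= pin i < p%:Z.
Proof. by rewrite /pin ltz_nat ltn_ord. Qed.

(** Total ramification: modulo the maximal ideal only the constant coordinate on the powers of [piL]
    survives, so [K] and [L] have the same residue field. *)
Lemma residue_approx x : vge vL 0 x ->
  exists2 c, vge vK 0 c & vge vL 1 (x - in_alg L c).
Proof.
move=> hx; have [c e1] := comb_span vLK degLK hpin pin_inj x.
have hc : forall i, vge vK 0 (c i).
  by move: hx; rewrite e1; move/(comb_int p0 vLK hpin pin_inj pin_small).
exists (c (Ordinal p0)) => //; rewrite e1 (bigD1 (Ordinal p0)) //=.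
rewrite /piy expr0 addrAC subrr add0r vge_sum // => i i0.
rewrite -mulr_algl -[1]add0r vgeM ?(vge_alg0 p0 vLK) //.
apply: vge_le (veq_vge (hpiX i)) _.
by rewrite lez_nat lt0n; move: i0; rewrite -(inj_eq val_inj).
Qed.

(** Frobenius is injective on the residue field: [(b - 1) ^ p] is congruent to [b ^ p - 1] modulo
    [p]. *)
Lemma vge1_pth_root (b : L) : vge vL 0 b -> vge vL 1 (b ^+ p - 1) -> vge vL 1 (b - 1).
Proof.
move=> hb hbp; set y := b - 1; have hy : vge vL 0 y by rewrite vgeB ?vge1.
have hyp : vge vL 1 (y ^+ p).
  have bE : b = y + 1 by rewrite subrK.
  move: hbp; rewrite bE exprD1n -(big_mkord xpredT (fun i => y ^+ i *+ 'C(p, i))).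
  rewrite big_nat_recr //= binn mulr1n big_ltn // expr0 bin0 mulr1n.
  rewrite addrAC -addrA [1 + _]addrC addrK => h.
  rewrite -[y ^+ p](addKr (\sum_(1 <= i < p) y ^+ i *+ 'C(p, i))) addrC.
  rewrite vgeB //; first by rewrite addrC.
  rewrite big_nat vge_sum // => i hi; have /dvdnP[k ->] := prime_dvd_bin p_prime hi.
  rewrite -mulr_natr natrM mulrA -[1]add0r vgeM ?vge0M ?vge0X ?vL_nat //.
  by apply: vge_le (veq_vge vLp) _; move: e_gt0 p0; clear; nia.
rewrite -[1]add0r; apply: vge_veq => //; apply/negP => /(veqX p).
by rewrite mulr0 => h; have := veqN_vge h; rewrite add0r hyp.
Qed.

Lemma iter_s_prod k : \prod_(i < k) iter i s (s piL / piL) = iter k s piL / piL.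
Proof.
have pi0 := veq_neq0 hpi.
elim: k => [|k IH]; first by rewrite big_ord0 divff.
rewrite big_ord_recr /= IH.
have -> : iter k s (s piL / piL) = s (iter k s piL) / iter k s piL.
  by rewrite -!expg_gal fmorph_div /= !expg_gal -iterS iterSr.
by rewrite mulrC mulrA divfK // -expg_gal fmorph_eq0.
Qed.

(* A wild ramification jump is positive: if [s piL / piL] were not 1 modulo
   the maximal ideal, its residue would be a nontrivial [p]-th root of unity. *)
Lemma jump_gt0 : (0 < t)%N.
Proof.
have pi0 := veq_neq0 hpi; rewrite lt0n; apply/negP => /eqP t0.
set u := s piL / piL.
have hu : veq vL 0 u by rewrite -(subrr 1); apply: veqM (veqV hpi); apply: (veq_gal vLE).
have [c hc huc] := residue_approx (veq_vge hu); set b := in_alg L c in huc.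
have hb : vge vL 0 b by rewrite (vge_alg0 p0 vLK).
(* [s] fixes [b], so every conjugate of [u] is congruent to [b]; for [k = p] the product telescopes
   to 1. *)
have hk k : vge vL 1 (\prod_(i < k) iter i s u - b ^+ k).
  elim: k => [|k IH]; first by rewrite big_ord0 expr0 subrr vge_0.
  rewrite big_ord_recr exprSr /= -(subrKA (b ^+ k * iter k s u)) -mulrBl -mulrBr.
  have hsk x n : vge vL n x -> vge vL n (iter k s x).
    by move=> hx; rewrite -expg_gal; apply: (vge_gal vLE).
  rewrite vgeD //; first by rewrite -[1]addr0 vgeM // hsk // veq_vge.
  rewrite -[1]add0r vgeM ?vge0X //.
  suff -> : iter k s u - b = iter k s (u - b) by apply: hsk.
  by rewrite -!expg_gal rmorphB /= (gal_alg _ c).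
have := hk p; rewrite iter_s_prod iter_p divff // -vgeN opprB.
move/(vge1_pth_root hb) => hb1.
have : vge vL (1 + 1) (s piL - piL).
  have -> : s piL - piL = piL * (u - b + (b - 1)).
    by rewrite subrKA mulrBr mulr1 mulrC divfK.
  by rewrite vgeM ?(veq_vge hpi) // vgeD.
by rewrite (veq_vge_le _ hspi) t0.
Qed.

Lemma X_one : X 1 = 0.
Proof. by rewrite gal_sub1E rmorph1 subrr. Qed.

Lemma vge_spi_pow m : vge vL (m%:Z + 1) (s piL ^+ m - piL ^+ m).
Proof.
have hs : veq vL 1 (s piL) by apply: (veq_gal vLE).
elim: m => [|m IH]; first by rewrite subrr vge_0.
rewrite !exprS -(subrKA (s piL * piL ^+ m)) -mulrBr -mulrBl vgeD //.
  by rewrite intS -addrA vgeM // veq_vge.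
apply: vge_le (vgeM (veq_vge hspi) (veq_vge (hpiX m))) _.
by have := jump_gt0; clear; lia.
Qed.

(** In the factorisation of a difference of powers, each of the [i + 1] terms of the cofactor is
    congruent to [piL ^+ i], since [s piL] is close to [piL]. *)
Lemma Xpi_factor i : exists2 S, X (piL ^+ i.+1) = (s piL - piL) * S &
  vge vL (i%:Z + 1) (S - i.+1%:R * piL ^+ i).
Proof.
rewrite gal_sub1E rmorphXn subrXX; eexists; first by [].
rewrite (eq_bigr (fun k : 'I_i.+1 => piL ^+ i + (s piL ^+ (i - k) - piL ^+ (i - k)) * piL ^+ k)).
  rewrite big_split sumr_const card_ord /= mulr_natl addrAC subrr add0r.
  apply: vge_sum => k _.
  apply: vge_le (vgeM (vge_spi_pow _) (veq_vge (hpiX k))) _.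
  by have := ltn_ord k; clear; lia.
move=> k _; rewrite mulrBl -exprD subnK ?subrKC //.
by rewrite -ltnS.
Qed.

Lemma veq_Xpi i : (0 < i < p)%N -> veq vL (i%:Z + t%:Z) (X (piL ^+ i)).
Proof.
move=> /andP[i0 ip]; case: i i0 ip => // i _ ip.
have [S -> hS] := Xpi_factor i.
have -> : i.+1%:Z + t%:Z = (t%:Z + 1) + i%:Z by clear; lia.
apply: veqM => //=; rewrite -(subrK (i.+1%:R * piL ^+ i) S); apply: veqDr => //.
rewrite -[i%:Z]add0r; apply: veqM => //; apply: vL_nat_unit.
by rewrite gtnNdvd.
Qed.

Lemma X_expand (c : 'I_p -> K) : X (\sum_i c i *: piy i) = \sum_i c i *: X (piy i).
Proof. by rewrite linear_sum; apply: eq_bigr => i _; rewrite linearZ. Qed.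

Lemma vge_Xterm (c : K) (i : 'I_p) n :
  vge vL n (c *: piy i) -> vge vL (n + t%:Z) (c *: X (piy i)).
Proof.
have [->|c0] := eqVneq c 0; first by rewrite !scale0r !vge_0.
have hc := veq_dv vK c0; rewrite (veq_vge_le _ (veq_term vLK hpin i hc)).
have [i0|i0] := posnP i; first by rewrite /piy i0 expr0 X_one scaler0 vge_0.
move=> h; rewrite -mulr_algl.
apply: vge_le (veq_vge (veqM (vLK hc) (veq_Xpi _))) _; first by rewrite i0 ltn_ord.
by move: h; rewrite /pin; clear; lia.
Qed.

Lemma vge_Xt n x : vge vL n x -> vge vL (n + t%:Z) (X x).
Proof.
have [c ->] := comb_span vLK degLK hpin pin_inj x.
move=> /(comb_vge vLK hpin pin_inj) h; rewrite X_expand vge_sum // => i _.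
exact: vge_Xterm.
Qed.

(** Expand [x] on the powers of [piL]. The term of least valuation has index prime to [p], because
    [n] is; [X] raises it by exactly [t] and the others by at least [t]. *)
Lemma veq_Xt n x : veq vL n x -> ~~ (p%:Z %| n)%Z -> veq vL (n + t%:Z) (X x).
Proof.
have [c ->] := comb_span vLK degLK hpin pin_inj x => hx pn.
have inj := @term_inj _ _ _ _ _ vLK _ _ hpin pin_inj c.
case: (veq_min_sum inj) => [h|[i [fi hi hmin]]].
  by have := veq_neq0 hx; rewrite big1 ?eqxx // => i _; rewrite h.
have en := veq_uniq hx hi; rewrite -en in hmin.
have ci : c i != 0 by move: fi; rewrite scaler_eq0 negb_or => /andP[].
have hc := veq_dv vK ci.
have nE : n = vK (c i) * p%:Z + i%:Z.
  by rewrite en; have [_ ->] := veqP _ _ _ (veq_term vLK hpin i hc).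
have i0 : (0 < i)%N.
  by rewrite lt0n; apply: contra pn => /eqP i0; rewrite nE i0 addr0 dvdz_mull.
rewrite X_expand; apply: (@veq_sum _ _ _ _ i).
  rewrite -mulr_algl nE -addrA; apply: veqM; first exact: vLK.
  by apply: veq_Xpi; rewrite i0 ltn_ord.
move=> j ji; rewrite addrAC; apply: vge_Xterm.
apply: vge_veq => //; apply/negP => hj; case/eqP: ji; apply: inj => //.
  exact: veq_neq0 hj.
by have [_ ->] := veqP _ _ _ hj; rewrite -en.
Qed.


(** [X] kills [K], so a representative of the residue class may be subtracted from [x] first; this
    gains the extra 1. *)
Lemma X_jump x : vge vL 0 x -> vge vL (t%:Z + 1) (X x).
Proof.
move=> /residue_approx[c _ hc]; have := vge_Xt hc.
by rewrite [1 + _]addrC linearB /= [X (in_alg L c)]gal_sub1E (gal_alg s c) subrr subr0.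
Qed.

Lemma minimal_indexE d :
  (exists2 alpha : L, O_L alpha & has_orbit_index alpha ((p ^ abs_inertia_degree K) ^ d)) ->
  (forall (alpha : L) m, O_L alpha -> has_orbit_index alpha m ->
     exists2 d', m = ((p ^ abs_inertia_degree K) ^ d')%N & (d <= d')%N) ->
  minimal_index L = ((p ^ abs_inertia_degree K) ^ d)%N.
Proof.
set q := (p ^ _)%N => ex lower; have q0 : (0 < q)%N by rewrite expn_gt0 p0.
have le (alpha : L) m : O_L alpha -> has_orbit_index alpha m -> (q ^ d <= m)%N.
  by move=> ha /(lower _ _ ha)[d' -> dd']; rewrite leq_pexp2l.
have [[a ha hm] hmin] : is_minimal_index L (minimal_index L).
  by apply: xgetPex; exists (q ^ d)%N.
have [b hb hbd] := ex.
by apply/eqP; rewrite eqn_leq (hmin _ _ hb hbd) (le _ _ ha hm).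
Qed.

(** * The case of a jump prime to p *)

Section JumpPrimeToP.
Hypothesis pt : ~~ (p %| t)%N.

Let a := (t %% p)%N.
Let nu (i : nat) := ((a + i * t) %/ p)%N.
Let z (i : nat) : L := iter i X (piL ^+ a).

(** As [a] is congruent to [t], [a + i t] is congruent to [(i + 1) t]. This is what singles out [a]
    as the starting valuation: [X] can be applied [p - 1] times before a multiple of [p] occurs. *)
Let dvd_val i : (p %| a + i * t)%N = (p %| i.+1)%N.
Proof.
rewrite -[LHS](dvdn_addr _ (dvdn_mull (t %/ p) (dvdnn p))) addnA -divn_eq -mulSn.
by rewrite Euclid_dvdM // (negPf pt) orbF.
Qed.

Let hz (i : 'I_p) : veq vL (a + i * t)%N%:Z (z i).
Proof.
case: i => i /=; elim: i => [|i IH] ip; first by rewrite mul0n addn0; apply: hpiX.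
have -> : (a + i.+1 * t)%N%:Z = (a + i * t)%N%:Z + t%:Z by clear; lia.
apply: veq_Xt; first exact: (IH (ltnW ip)).
by rewrite -[(_ %| _)%Z]/(p %| a + i * t)%N dvd_val gtnNdvd.
Qed.

Let u := dval_pi vK.
Let hu m : veq vK m%:Z (u ^+ m).
Proof. by rewrite -[m%:Z]mulr1; apply/veqX/veq_pi. Qed.
Let u0 m : u ^+ m != 0. Proof. exact: veq_neq0 (hu m). Qed.

Let y (i : 'I_p) : L := (u ^+ nu i)^-1 *: z i.
Let n (i : 'I_p) : int := ((a + i * t) %% p)%N%:Z.

Let zy (i : 'I_p) : z i = u ^+ nu i *: y i.
Proof. by rewrite scalerA divff // scale1r. Qed.

Let hy i : veq vL (n i) (y i).
Proof.
rewrite /y -mulr_algl.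
have -> : n i = (- (nu i)%:Z) * p%:Z + (a + i * t)%N%:Z.
  rewrite /n /nu; move: (a + i * t)%N => b.
  by rewrite {3}(divn_eq b p) PoszD PoszM mulNr addKr.
by apply: veqM => //; apply: vLK; apply: veqV.
Qed.

Let n_small i : 0 <= n i < p%:Z.
Proof. by rewrite /n ltz_nat ltn_mod. Qed.

Let n_inj (i j : 'I_p) k : n i - n j = k * p%:Z -> i = j.
Proof.
move=> h; have e1 : n i = n j.
  have := n_small i; have := n_small j; move: h p0; move: (n i) (n j).
  clear => a b h p0 hb ha; have : k = 0 by case: k h => [[|k]|k]; nia.
  by move=> k0; rewrite k0 in h; lia.
apply: val_inj => /=; move: e1 => /eqP; rewrite eqz_nat eqn_modDl.
wlog ij : i j {h} / (i <= j)%N.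
  move=> w; case: (leqP i j) => [/w//|/ltnW/w h1].
  by rewrite eq_sym => /h1/esym.
rewrite eq_sym eqn_mod_dvd ?leq_mul2r ?ij ?orbT // -mulnBl Euclid_dvdM // (negPf pt) orbF.
have [d0|d0] := posnP (j - i)%N; last first.
  by rewrite gtnNdvd // (leq_ltn_trans (leq_subr _ _)).
by move=> _; apply/eqP; rewrite eqn_leq ij -subn_eq0 d0.
Qed.

Let nu0 : nu 0 = 0%N.
Proof. by rewrite /nu mul0n addn0 divn_small // ltn_mod. Qed.

Let diag_nu : 'M[K]_p := diag_mx (\row_k u ^+ nu k).

Let coords_diag (alpha : L) (T : 'M[K]_p) :
  (forall i : 'I_p, iter i X alpha = \sum_k T i k *: z k) ->
  forall i : 'I_p, iter i X alpha = \sum_k (T *m diag_nu) i k *: y k.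
Proof.
move=> hT i; rewrite hT; apply: eq_bigr => k _; rewrite zy scalerA.
by rewrite mul_mx_diag !mxE.
Qed.

Let det_diag_nu : veq vK (\sum_(i < p) (nu i)%:Z) (\det diag_nu).
Proof. by rewrite det_diag; apply: veq_prod => i _; rewrite mxE. Qed.

Let G (i : nat) : int := i%:Z * e%:Z - p.-1%:Z * (nu i)%:Z.

Lemma orbit_index_lower (s0 : int) (alpha : L) m : (forall i : 'I_p, s0 <= G i) ->
  O_L alpha -> has_orbit_index alpha m ->
  exists2 d, m = ((p ^ abs_inertia_degree K) ^ d)%N & \sum_(i < p) (nu i)%:Z + s0 <= d%:Z.
Proof.
move=> hs ha hm; have [c ec] := comb_span vLK degLK hy n_inj alpha.
have hc i : vge vK 0 (c i).
  by move: ha => /vLE; rewrite ec; move/(comb_int p0 vLK hy n_inj n_small).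
pose d (j : 'I_p) := c j / u ^+ nu j.
have hd (j : 'I_p) : vge vK (- (nu j)%:Z) (d j).
  by rewrite -[- _]add0r vgeM // veq_vge // veqV.
have ed : alpha = \sum_j d j *: z j.
  by rewrite ec; apply: eq_bigr => j _; rewrite scalerA.
have [||T hT vT] := @companion_bound p p_prime K vK e e_gt0 vKp L X (piL ^+ a) X_relation d s0.
(* The constant coefficient is integral because [nu 0 = 0]. *)
- by have := hd (Ordinal p0); rewrite /= nu0.
- move=> j; apply: (@vge_le _ _ _ (p.-1%:Z * - (nu j)%:Z)); first by rewrite vge_scale.
  by have := hs j; rewrite /G; clear; lia.
have hM : forall i : 'I_p, iter i X alpha = \sum_k (T *m diag_nu) i k *: y k.
  by apply: coords_diag => i; rewrite ed; apply: hT.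
have [d' hd' ->] := orbit_index_inv hy n_inj n_small ha hM hm.
exists d' => //; rewrite det_mulmx in hd'.
by have := vgeM vT (veq_vge det_diag_nu); rewrite (veq_vge_le _ hd') addrC.
Qed.

Lemma orbit_index_attained (s0 : int) (j0 : 'I_p) : s0 = G j0 -> s0 <= 0 ->
  exists2 d, d%:Z = \sum_(i < p) (nu i)%:Z + s0 &
    exists2 alpha : L, O_L alpha & has_orbit_index alpha ((p ^ abs_inertia_degree K) ^ d).
Proof.
move=> sE; rewrite le_eqVlt => s_le.
have z_int (i : 'I_p) : vge vL 0 (z i) by apply: vge_le (veq_vge (hz i)) _.
suff [alpha [T [ha hT vT]]] : exists (alpha : L) (T : 'M[K]_p), [/\ O_L alpha,
    forall i : 'I_p, iter i X alpha = \sum_k T i k *: z k & veq vK s0 (\det T)] :> Prop.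
  have hM := coords_diag hT.
  have vM := veqM vT det_diag_nu; rewrite -det_mulmx addrC in vM.
  have := intmx_det (coords_int hy n_inj n_small ha hM); rewrite (veq_vge_le _ vM).
  case e1 : (_ + s0) => [d|//] _; rewrite e1 in vM; exists d => //.
  by exists alpha => //; apply: (orbit_index hy n_inj n_small ha hM vM).
(* If the minimum is 0, theta = 1 attains it. Otherwise [s0 < 0] makes the other summand of theta
   dominate 1 in all rows but row 0. *)
case/orP: s_le => [/eqP s00|s_lt].
  exists (z 0), 1%:M; split; first by apply/vLE/(z_int (Ordinal p0)).
    move=> i; rewrite (bigD1 i) //= mxE eqxx scale1r big1 ?addr0 // => k ki.
    by rewrite mxE eq_sym (negPf ki) scale0r.
  by rewrite det1 s00 veq1.
have j00 : j0 != Ordinal p0.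
  by apply: contraTneq s_lt => j00; rewrite sE j00 /G /= nu0 !mul0r mulr0 subr0 ltxx.
have [|T hT vT] := @companion_exact p p_prime K vK e e_gt0 vKp L X (piL ^+ a) X_relation j0 s0
   (u ^+ nu j0)^-1 j00 s_lt.
- have -> : s0 - j0%:Z * e%:Z = p.-1%:Z * - (nu j0)%:Z by rewrite sE /G; clear; lia.
  by rewrite veq_scale veqV.
(* Here alpha is [z 0 + y j0], a sum of two integers. *)
eexists; exists T; split; [|exact: hT|exact: vT].
apply/vLE; apply: vge_sum => j _; case: eqP => [_|_]; first by rewrite scale1r z_int.
case: eqP => [->|_]; last by rewrite scale0r vge_0.
by apply: vge_le (veq_vge (hy j0)) _; case/andP: (n_small j0).
Qed.

Lemma minimal_index_prime_to_p (s0 : int) (j0 : 'I_p) :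
  (forall i : 'I_p, s0 <= G i) -> s0 = G j0 ->
  (logn p (minimal_index L))%:Z =
    (abs_inertia_degree K)%:Z * (\sum_(i < p) (nu i)%:Z + s0).
Proof.
move=> hs sE; have s_le : s0 <= 0.
  by have := hs (Ordinal p0); rewrite /G /= nu0 !mul0r mulr0 subr0.
have [d dE ex] := orbit_index_attained sE s_le.
rewrite (minimal_indexE ex) -?dE; last first.
  move=> alpha m ha /(orbit_index_lower hs ha)[d' ->].
  by rewrite -dE lez_nat => dd'; exists d'.
by rewrite -expnM pfactorK // PoszM.
Qed.

End JumpPrimeToP.


(** * The case of a jump divisible by p *)

Section JumpDivisible.
Hypothesis pt : (p %| t)%N.

Let t' := (t %/ p)%N.
Let tE : t = (t' * p)%N. Proof. by rewrite divnK. Qed.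

(** The valuations stay congruent to 1 modulo [p], so [X] always raises them by exactly [t]. *)
Let veq_iterX l : veq vL (1 + (l * t)%N%:Z) (iter l X piL).
Proof.
elim: l => [|l IH]; first by rewrite mul0n addr0.
have -> : 1 + (l.+1 * t)%N%:Z = (1 + (l * t)%N%:Z) + t%:Z by clear; lia.
apply: veq_Xt => //; rewrite -[(_ %| _)%Z]/(p %| 1 + l * t)%N.
by rewrite dvdn_addl ?dvdn_mull // dvdn1 gtn_eqF.
Qed.

(* In the relation satisfied by the powers of [X], the terms of degree 1 and
   [p] are those of least valuation, hence must have equal valuations. *)
Lemma divisible_jumpE : e = (p.-1 * t')%N.
Proof.
have := X_relation piL; rewrite big_nat_recr ?p0 // binn mulr1n /=.
have h1 : veq vL (e%:Z * p%:Z + (1 + t%:Z)) (\sum_(1 <= l < p) iter l X piL *+ 'C(p, l)).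
  rewrite big_ltn // bin1 /=; apply: veqD.
    rewrite -mulr_natl; apply: veqM; first exact: vLp.
    by have := veq_iterX 1; rewrite mul1n.
  rewrite big_nat vge_sum // => l /andP[l1 lp].
  have /dvdnP[k ->] : (p %| 'C(p, l))%N by rewrite prime_dvd_bin // (ltnW l1).
  rewrite -mulr_natl natrM -mulrA -[X in vge _ X]add0r vgeM ?vL_nat //.
  apply: vge_le (vgeM (veq_vge vLp) (veq_vge (veq_iterX l))) _.
  by have := jump_gt0; move: l1; clear; nia.
move/eqP; rewrite addr_eq0 => /eqP h; rewrite h veqN in h1.
have := veq_uniq h1 (veq_iterX p); rewrite tE; move: p1 {h1 h}; clear.
case: p => // q _ h; have : (e + t' = q.+1 * t')%N by nia.
rewrite /=; lia.
Qed.

Let u := dval_pi vK.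
Let hu m : veq vK m%:Z (u ^+ m).
Proof. by rewrite -[m%:Z]mulr1; apply/veqX/veq_pi. Qed.
Let u0 m : u ^+ m != 0. Proof. exact: veq_neq0 (hu m). Qed.

Let Y : 'End(L) := (u ^+ t')^-1 *: X.

Let YE x : Y x = (u ^+ t')^-1 *: X x.
Proof. by rewrite scale_lfunE. Qed.

Let iterXY k x : iter k X x = u ^+ (t' * k) *: iter k Y x.
Proof.
elim: k => [|k IH]; first by rewrite muln0 expr0 scale1r.
by rewrite !iterS IH linearZ YE scalerA mulnS exprD mulrC mulrA mulVf ?mul1r.
Qed.

Let vuV : veq vL (- t%:Z) (in_alg L (u ^+ t')^-1).
Proof. by rewrite tE PoszM -mulNr; apply: vLK; apply: veqV. Qed.

Let vge_Y n x : vge vL n x -> vge vL n (Y x).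
Proof.
move=> /vge_Xt hx; rewrite YE -mulr_algl.
by have := vgeM (veq_vge vuV) hx; rewrite addrCA addNr addr0.
Qed.

(** [Y piL / piL] is a unit, and its residue class comes from [K]; it governs the action of [Y] on
    every graded piece. *)
Let ex_slope : exists2 c, veq vK 0 c & vge vL 1 (Y piL / piL - in_alg L c).
Proof.
have hY : veq vL 0 (Y piL / piL).
  have := veqM (veqM vuV hspi) (veqV hpi).
  by rewrite YE gal_sub1E -mulr_algl addrA addNr add0r subrr.
have [c hc hYc] := residue_approx (veq_vge hY); exists c => //.
apply: contraT => /(vge_veq hc) h; have := veqN_vge hY.
rewrite -(subrK (in_alg L c) (Y piL / piL)) vgeD // (@vge_le _ _ _ ((0 + 1) * p%:Z)) //.
  by rewrite (vge_algE p0 vLK).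
by move: p0; clear; lia.
Qed.

Let c := projT1 (cid2 ex_slope).
Let hc : veq vK 0 c. Proof. by rewrite /c; case: cid2. Qed.
Let hYc : vge vL 1 (Y piL / piL - in_alg L c). Proof. by rewrite /c; case: cid2. Qed.
Let hcL : veq vL 0 (in_alg L c). Proof. by rewrite -[0](mul0r p%:Z); apply: vLK. Qed.

(** To first order [Y] behaves like a derivation on powers of [piL], by the factorisation of
    [X (piL ^+ i)]. *)
Let Ypi i : vge vL (i%:Z + 1) (Y (piL ^+ i) - (i%:R * c) *: piL ^+ i).
Proof.
case: i => [|i]; first by rewrite mul0r scale0r subr0 YE X_one scaler0 vge_0.
have [S SE hS] := Xpi_factor i.
have -> : Y (piL ^+ i.+1) - (i.+1%:R * c) *: piL ^+ i.+1 =
   Y piL * (S - i.+1%:R * piL ^+ i) + (Y piL / piL - in_alg L c) * (i.+1%:R * piL ^+ i.+1).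
  rewrite [Y (piL ^+ _)]YE SE -mulr_algl -[_ *: piL ^+ _]mulr_algl -!in_algE !rmorphM rmorph_nat /=.
  have -> : in_alg L (u ^+ t')^-1 * ((s piL - piL) * S) = Y piL * S.
    by rewrite mulrA YE gal_sub1E -[in RHS]mulr_algl.
  rewrite exprS; field; exact: veq_neq0 hpi.
rewrite vgeD //.
  have -> : i.+1%:Z + 1 = 1 + (i%:Z + 1) by clear; lia.
  apply: vgeM; last by [].
  exact/vge_Y/veq_vge.
rewrite addrC; apply: vgeM => //; rewrite -[i.+1%:Z]add0r vgeM ?vL_nat //.
exact: veq_vge.
Qed.

Let D m x := Y x - (m%:R * c) *: x.

Let DE m n x : D m x = D n x + ((n%:R - m%:R) * c) *: x.
Proof. by rewrite /D mulrBl scalerBl addrA subrK. Qed.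

Let D_add m x y : D m (x + y) = D m x + D m y.
Proof. by rewrite /D linearD scalerDr opprD addrACA. Qed.

Let vge_kc k n x : vge vL n x -> vge vL n ((k%:R * c) *: x).
Proof.
move=> hx; rewrite -mulr_algl -[n]add0r vgeM // -[0](mul0r p%:Z).
rewrite (vge_algE p0 vLK) vge0M ?(veq_vge hc) //; exact/vge_nat/vge1.
Qed.

Let vge_D m n x : vge vL n x -> vge vL n (D m x).
Proof. by move=> hx; rewrite vgeB ?vge_Y ?vge_kc. Qed.

(* On the graded piece of degree [n] the operator [Y] acts as the scalar
   [n * c], since [c] is the residue of [Y piL / piL]. *)
Let vge_Dn (n : nat) x : vge vL n%:Z x -> vge vL (n%:Z + 1) (D n x).
Proof.
have [d ->] := comb_span vLK degLK hpin pin_inj x.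
move=> /(comb_vge vLK hpin pin_inj) h.
have -> : D n (\sum_i d i *: piy i) = \sum_i D n (d i *: piy i).
  by rewrite /D linear_sum scaler_sumr -sumrB.
apply: vge_sum => i _; have [->|di] := eqVneq (d i) 0.
  by rewrite scale0r /D linear0 scaler0 subrr vge_0.
have hd := veq_dv vK di; have := h i; rewrite (veq_vge_le _ (veq_term vLK hpin i hd)) /pin => ni.
rewrite (DE n i) vgeD //.
  have -> : D i (d i *: piy i) = d i *: (Y (piL ^+ i) - (i%:R * c) *: piL ^+ i).
    by rewrite /D linearZ scalerBr !scalerA [d i * _]mulrC.
  rewrite -mulr_algl; apply: vge_le (vgeM (veq_vge (vLK hd)) (Ypi i)) _.
  by move: ni; clear; lia.
move: ni; rewrite le_eqVlt => /orP[/eqP ni|ni]; last first.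
  rewrite mulrBl scalerBl vgeB //; apply: vge_kc.
    by rewrite (veq_vge_le _ (veq_term vLK hpin i hd)) /pin; move: ni; clear; lia.
  by rewrite (veq_vge_le _ (veq_term vLK hpin i hd)) /pin; move: ni; clear; lia.
(* A term of valuation exactly [n] has [n = k p + i], so the scalars [n c] and [i c] agree modulo
   [p]. *)
have [k kE] : exists k : nat, vK (d i) = k%:Z.
  have := ltn_ord i; case: (vK (d i)) ni => [k|k]; first by exists k.
  by move: p0; clear; nia.
have -> : (i%:R - n%:R) * c = - ((k%:R * c) * p%:R) :> K.
  have -> : n = (k * p + i)%N by move: ni; rewrite kE; clear; lia.
  by rewrite natrD natrM; ring.
rewrite scaleNr vgeN [_ * p%:R]mulrC -scalerA -mulr_algl -in_algE alg_nat addrC.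
apply: vgeM; last by apply: vge_kc; apply: h.
apply: vge_le (veq_vge vLp) _; move: e_gt0 p0; clear; nia.
Qed.

(** In degree [n] the operator [D m] acts as [(n - m) c], a unit since [0 < n - m < p]. *)
Let veq_D (m n : nat) x : (m < n < p)%N -> veq vL n%:Z x -> veq vL n%:Z (D m x).
Proof.
move=> /andP[mn np] hx; rewrite (DE m n); apply: veqDr; first exact/vge_Dn/veq_vge.
rewrite -natrB ?(ltnW mn) // -mulr_algl -in_algE rmorphM rmorph_nat -[n%:Z]add0r.
apply: veqM => //; rewrite -[0]addr0; apply: veqM => //; apply: vL_nat_unit.
by rewrite gtnNdvd ?subn_gt0 // (leq_ltn_trans (leq_subr _ _)).
Qed.

(** The product [Y (Y - c) ... (Y - (j - 1) c)] applied to [x]: each factor annihilates one graded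
    piece and so raises the valuation. *)
Fixpoint descent j x : L := if j is i.+1 then D i (descent i x) else x.

Let Q_add j x y : descent j (x + y) = descent j x + descent j y.
Proof. by elim: j => //= j ->; rewrite D_add. Qed.

Let vge_Q j x : vge vL 0 x -> vge vL j%:Z (descent j x).
Proof. by move=> hx; elim: j => //= j IH; rewrite -addn1 PoszD vge_Dn. Qed.

Let vge_Qn n j x : vge vL n x -> vge vL n (descent j x).
Proof. by move=> hx; elim: j => //= j IH; apply: vge_D. Qed.

Let veq_Qn (n j : nat) x : (j <= n < p)%N -> veq vL n%:Z x -> veq vL n%:Z (descent j x).
Proof.
move=> + hx; elim: j => //= j IH /andP[jn np]; apply: veq_D; first by rewrite jn.
by apply: IH; rewrite (ltnW jn).
Qed.

(* [descent j alpha] has valuation at least [j]; adding [piL ^+ m] to [alpha]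
   when needed makes the bound sharp for [j = m] and keeps the smaller [j]. *)
Let ex_cyclic m : (m < p)%N ->
  exists2 alpha, vge vL 0 alpha & forall j, (j <= m)%N -> veq vL j%:Z (descent j alpha).
Proof.
elim: m => [|m IH] mp.
  by exists 1; [exact: vge1|case=> // _; exact: veq1].
have [alpha ha hj] := IH (ltnW mp).
have [h|h] := boolP (veq vL m.+1%:Z (descent m.+1 alpha)).
  exists alpha => // j; rewrite leq_eqVlt => /orP[/eqP ->//|]; exact: hj.
have hpm := hpiX m.+1; exists (alpha + piL ^+ m.+1).
  by rewrite vgeD // (vge_le (veq_vge hpm)).
move=> j; rewrite leq_eqVlt => /orP[/eqP ->|jm]; rewrite Q_add.
  by apply: veqDr; [apply: vge_veq => //; apply: vge_Q|apply: veq_Qn => //; rewrite leqnn].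
apply: veqD; first exact: hj.
apply: vge_le (vge_Qn _ (veq_vge hpm)) _; move: jm; clear; lia.
Qed.

(** Since [Y] maps [descent j] to [descent (j + 1)] plus [j c] times [descent j], the powers of [Y]
    are unitriangular in the [descent j], and the change of family has determinant 1. *)
Let iterY_Q k alpha : exists d : nat -> K,
  [/\ d k = 1, forall j, (k < j)%N -> d j = 0 & forall m, (k < m)%N ->
     iter k Y alpha = \sum_(j < m) d j *: descent j alpha].
Proof.
elim: k => [|k [d [dk dz dE]]].
  exists (fun j => (j == 0%N)%:R); split => // [[]//|m m0].
  rewrite (bigD1 (Ordinal m0)) //= scale1r big1 ?addr0 // => j.
  by rewrite -(inj_eq val_inj) /= => /negPf ->; rewrite scale0r.
exists (fun j => (if j is i.+1 then d i else 0) + d j * (j%:R * c)); split.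
- by rewrite dk dz // mul0r addr0.
- case=> // j kj; rewrite !dz ?mul0r ?addr0 //; exact: ltnW.
case=> // m km; rewrite iterS (dE m.+1) ?(ltnW km) // linear_sum.
under [RHS]eq_bigr do rewrite scalerDl.
rewrite big_split /= [X in _ = X + _]big_ord_recl /= scale0r add0r.
rewrite big_ord_recr [X in _ = _ + X]big_ord_recr /= (dz m); last by [].
rewrite mul0r !scale0r linear0 !addr0.
rewrite -big_split; apply: eq_bigr => j _ /=.
by rewrite linearZ /= -scalerA -scalerDr /bump /= /D subrK.
Qed.

Let wt := (\sum_(k < p) t' * k)%N.

Let diag_wt : 'M[K]_p := diag_mx (\row_k u ^+ (t' * k)).

Let det_diag_wt : veq vK wt%:Z (\det diag_wt).
Proof.
rewrite det_diag /wt (big_morph Posz PoszD (erefl _)).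
by apply: veq_prod => k _; rewrite mxE; apply: hu.
Qed.

Let coords_wt (alpha : L) (y : 'I_p -> L) (N : 'M[K]_p) :
  (forall k : 'I_p, iter k Y alpha = \sum_j N k j *: y j) ->
  forall k : 'I_p, iter k X alpha = \sum_j (diag_wt *m N) k j *: y j.
Proof.
move=> hN k; rewrite iterXY hN scaler_sumr; apply: eq_bigr => j _.
by rewrite scalerA mul_diag_mx !mxE.
Qed.

(** The exponent is [wt = t' p (p - 1) / 2], and [e = (p - 1) t'], whence [2 wt = p e]; doubling
    avoids the fraction. *)
Lemma minimal_index_divisible :
  (2 * logn p (minimal_index L) = p * (e * abs_inertia_degree K))%N.
Proof.
rewrite (@minimal_indexE wt).
- rewrite -expnM pfactorK // /wt -big_distrr /= divisible_jumpE.
  rewrite -(big_mkord xpredT id) bin2_sum.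
  have := mul_bin_diag p 1; rewrite bin1 => h.
  rewrite [RHS]mulnCA -mulnA.
  have -> : (p.-1 * (t' * (p * abs_inertia_degree K)) =
    abs_inertia_degree K * (t' * (p * p.-1)))%N by ring.
  by rewrite h; ring.
- have [|alpha ha hj] := @ex_cyclic p.-1; first by rewrite prednK.
  have hO : O_L alpha by apply/vLE.
  exists alpha => //.
  have hy (i : 'I_p) : veq vL (pin i) (descent i alpha).
    by apply: hj; rewrite -ltnS prednK.
  have [d hd] := choice (fun k => iterY_Q k alpha).
  pose N : 'M[K]_p := \matrix_(k, j) d k j.
  have hN : forall k : 'I_p, iter k Y alpha = \sum_j N k j *: descent j alpha.
    move=> k; have [_ _ h] := hd k; rewrite (h p) //.
    by apply: eq_bigr => j _; rewrite mxE.
  have detN : \det N = 1.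
    rewrite det_trig; first by rewrite big1 // => k _; rewrite mxE; case: (hd k).
    by apply/is_trig_mxP => k j kj; rewrite mxE; have [_ h _] := hd k; apply: h.
  apply: (orbit_index hy pin_inj pin_small hO (coords_wt hN)).
  by rewrite det_mulmx detN mulr1.
(* [Y] preserves [O_L], so the coordinates of the [Y ^ k alpha] are integral, and the diagonal
   factor alone forces the valuation [wt]. *)
move=> alpha m ha hm.
have [d hd] := choice (fun k : 'I_p => comb_span vLK degLK hpin pin_inj (iter k Y alpha)).
pose N : 'M[K]_p := \matrix_(k, j) d k j.
have hN : forall k : 'I_p, iter k Y alpha = \sum_j N k j *: piy j.
  by move=> k; rewrite hd; apply: eq_bigr => j _; rewrite mxE.
have intN : intmx vK N.
  move=> k j; have : vge vL 0 (iter k Y alpha).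
    by have /vLE := ha; elim: (k : nat) => //= l IH hl; apply/vge_Y/IH.
  by rewrite hN; move/(comb_int p0 vLK hpin pin_inj pin_small).
have [d' hd' ->] := orbit_index_inv hpin pin_inj pin_small ha (coords_wt hN) hm.
exists d' => //; rewrite det_mulmx in hd'.
have := vgeM (veq_vge det_diag_wt) (intmx_det intN).
by rewrite (veq_vge_le _ hd') addr0 lez_nat.
Qed.

End JumpDivisible.

End WildExtension.

(** * Minimal index *)

Lemma dim_baseField (F0 : fieldType) (F : fieldExtType F0) (L : fieldExtType F) :
  \dim (fullv : {vspace baseFieldType L}) = (\dim {:L} * \dim {:F})%N.
Proof.
rewrite -dim_baseVspace; congr (\dim _); apply/vspaceP => x.
rewrite mem_baseVspace [LHS]memvf; exact/esym/memvf.
Qed.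

(** * From ramification groups to valuations *)

Section JumpValue.
Variables (p : nat) (p_prime : prime p) (Qp : padicNumbers p).
Variables (K : fieldExtType Qp) (L : splittingFieldType K).
Variables (vK : dval K) (vL : dval L).
Hypothesis vKE : forall x : K, integers x <-> vge vK 0 x.
Hypothesis vLE : forall x : L, O_L x <-> vge vL 0 x.
Hypothesis galLK : galois 1%VS {:L}.
Hypothesis degLK : \dim {:L} = p.

Lemma ramified_veq : ramified L ->
  forall n c, veq vK n c -> veq vL (n * p%:Z) (in_alg L c).
Proof.
rewrite /ramified /ramification_index; set S := (X in xget _ X) => ram.
(* The default value 0 is not greater than 1, so being ramified already shows that an index
   exists. *)
have /(@xgetPex _ 0%N S) : exists e, S e.
  apply: contrapT => h; move: ram; rewrite xgetPN //.
  by move=> x hx; apply: h; exists x.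
move: (xget 0%N S) ram => e e1 [u /(uniformizerP vKE) hu].
move=> /(@generates_powerP p Qp (baseFieldType L) vL vLE) he n c hc.
have ep := ramification_degree p_prime vKE vLE galLK degLK e1 hu he.
by rewrite ep in he; apply: (veq_alg_mul vKE vLE hu he).
Qed.

Lemma ramification_groupP (piL : L) (i : int) g : veq vL 1 piL ->
  ramification_group piL i g <->
  g \in 'Gal({:L} / 1)%g /\ forall x, vge vL 0 x -> vge vL (i + 1) (g x - x).
Proof.
move=> hpi; have hpz := veq_piz (i + 1) hpi; split=> -[gG h]; split => // x.
  by move=> /vLE/h[y /vLE hy ->]; rewrite -[X in vge _ X]addr0 vgeM // veq_vge.
move=> /vLE/h hx; exists ((g x - x) / piL ^ (i + 1)).
  by apply/vLE; rewrite -(subrr (i + 1)) vgeM // veq_vge // veqV.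
by rewrite mulrC divfK // (veq_neq0 hpz).
Qed.

(** For [s] in [G_t] outside [G_(t+1)], the valuation of [s piL - piL] is at least [t + 1]. It
    cannot be greater, since by [X_jump] it bounds the valuation of [s x - x] for every integral
    [x]. *)
Lemma ex_jump_generator (piL : L) (t : int) : ramified L -> veq vL 1 piL ->
  ramification_jump piL t -> exists (s : gal_of {:L}) (t0 : nat),
    [/\ t = t0%:Z, s \in 'Gal({:L} / 1)%g & veq vL (t0%:Z + 1) (s piL - piL)].
Proof.
move=> /ramified_veq vLK hpi [tge hne].
have [s [hs hns]] : exists s, ramification_group piL t s /\ ~ ramification_group piL (t + 1) s.
  apply: contrapT => h; apply: hne; apply/seteqP; split=> g hg.
    by apply: contrapT => hg'; apply: h; exists g.
  apply/(ramification_groupP _ _ hpi); have [gG hx] := (ramification_groupP _ _ hpi).1 hg.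
  split=> // x /hx h1; apply: vge_le h1 _; lia.
have [sG hx] := (ramification_groupP _ _ hpi).1 hs.
have {}hns : ~ forall x, vge vL 0 x -> vge vL (t + 1 + 1) (s x - x).
  by move=> h; apply: hns; apply/(ramification_groupP _ _ hpi).
(* If [s] fixed [piL], it would fix all powers of [piL], hence [L], and lie in every ramification
   group. *)
have [e|ne] := eqVneq (s piL - piL) 0.
  case: hns => x _; have [c ->] := comb_span vLK degLK
    (y := fun i : 'I_p => piL ^+ i) (n := fun i : 'I_p => i%:Z * 1)
    (fun i => veqX i hpi) (fun i j k h => @ord_eq_mod p i j k ltac:(by rewrite !mulr1 in h)) x.
  rewrite rmorph_sum -sumrB vge_sum // => i _.
  have si : s (c i *: piL ^+ i) = c i *: piL ^+ i.
    rewrite linearZ rmorphXn; congr (_ *: _ ^+ _).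
    by apply/eqP; rewrite -subr_eq0; apply/eqP.
  by rewrite [X in X - _]si subrr vge_0.
have hv := veq_dv vL ne; have hpi0 : vge vL 0 piL := vge_le (veq_vge hpi) ler01.
have := hx _ hpi0; rewrite (veq_vge_le _ hv) => tle.
(* [s piL] and [piL] both have valuation 1, so [t0 >= 0]; this rules out the jump [-1]. *)
have vpos : 1 <= vL (s piL - piL).
  rewrite -(veq_vge_le _ hv) vgeB ?(veq_vge hpi) //.
  by apply: (vge_gal vLE); apply: veq_vge.
have [t0 t0E] : exists t0 : nat, vL (s piL - piL) = t0%:Z + 1.
  by move: vpos; case: (vL _) => [[|k]|] // _; exists k; rewrite addrC.
rewrite t0E in hv tle; exists s, t0; split => //.
apply/eqP; rewrite eq_le; apply/andP; split; first by lia.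
rewrite leNgt; apply/negP => lt; apply: hns => x hx0.
have := X_jump p_prime vKE vLE galLK degLK vLK sG hpi hv hx0.
by rewrite gal_sub1E => h; apply: vge_le h _; lia.
Qed.

End JumpValue.

Theorem theorem1p6 (p : nat) (p_prime : prime p) (Qp : padicNumbers p)
    (K : fieldExtType Qp) (L : splittingFieldType K)
    (galLK : galois 1%VS {:L}) (degLK : \dim {:L} = p) (ramLK : ramified L)
    (piL : L) (piL_unif : uniformizer (E := baseFieldType L) piL)
    (t : int) (t_jump : ramification_jump piL t) :
  let a : int := (t %% p%:Z)%Z in
  let nu (i : nat) : int := ((a + i%:Z * t) %/ p%:Z)%Z in
  let eK : int := (abs_ramification_index K)%:Z in
  let fK : int := (abs_inertia_degree K)%:Z in
  let F (i : nat) : int := i%:Z * eK - (p%:Z - 1) * nu i in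
  (a <> 0 ->
     (logn p (minimal_index L))%:Z =
       fK * (\sum_(i < p) nu i + \big[Order.min/F 0%N]_(i < p) F i)) /\
  (a = 0 ->
     (logn p (minimal_index L))%:R =
       2%:R^-1 * (\dim (fullv : {vspace baseFieldType L}))%:R :> rat).
Proof.
have [vK vKE] := ex_valuation p_prime K.
have [vL vLE] := ex_valuation_L p_prime L.
have hpi : veq vL 1 piL by apply/(@uniformizerP p Qp (baseFieldType L) vL vLE).
have vLK := ramified_veq p_prime vKE vLE galLK degLK ramLK.
have [s [t0 [tE sG hs]]] := ex_jump_generator p_prime vKE vLE galLK degLK ramLK hpi t_jump.
move=> a nu eK fK F.
have p0 := prime_gt0 p_prime.
have aE : a = (t0 %% p)%N%:Z by rewrite /a tE modz_nat.
have nuE i : nu i = ((t0 %% p + i * t0) %/ p)%N%:Z.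
  by rewrite /nu aE tE -PoszM -PoszD divz_nat.
split=> [a_neq0|a0].
  have pt : ~~ (p %| t0)%N.
    by apply/negP => /eqP h; apply: a_neq0; rewrite aE h.
  have FE i : F i = i%:Z * eK - p.-1%:Z * (nu i) by rewrite /F predn_int.
  set m := \big[Order.min/_]_(_ < _) _.
  (* The initial value [F 0] of the minimum belongs to the index 0, so the minimum is attained at an
     index below [p]. *)
  have [j mj] : exists j : 'I_p, m = F j.
    apply: (big_ind (fun x => exists j : 'I_p, x = F j)) => [|x y [j ->] [k ->]|i _].
    - by exists (Ordinal p0).
    - by case: leP => _; [exists j|exists k].
    - by exists i.
  have hm (i : 'I_p) : m <= F i by apply: bigmin_le.
  have main := @minimal_index_prime_to_p _ p_prime _ _ _ _ _ vKE vLE galLK degLK vLK.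
  rewrite (main _ _ _ sG hpi hs pt m j).
  - by congr (_ * (_ + _)); apply: eq_bigr => i _; rewrite nuE.
  - by move=> i; rewrite -nuE -FE.
  - by rewrite -nuE -FE.
have pt : (p %| t0)%N.
  by move: a0; rewrite aE => -[] /eqP.
have := @minimal_index_divisible _ p_prime _ _ _ _ _ vKE vLE galLK degLK vLK.
move=> /(_ _ _ _ sG hpi hs pt).
(* The degree of [L] over Q_p is [p e_K f_K], twice the exponent found. *)
rewrite dim_baseField degLK (padic_field_dim p_prime vKE) => h.
have {}h := congr1 (fun n : nat => n%:R : rat) h; rewrite natrM in h.
by rewrite -h mulrA mulVf ?mul1r.
Qed.
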